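(* Let $e$ be a nonzero nilpotent element of $\mathfrak{sl}_N$ and $\mathcal O=SL_N\cdot e$. Let $\mathfrak s_\star$ denote the generic isotropy subalgebra for the diagonal action of $SL_N$ on $\mathcal O\times\mathcal O$ (described up to isomorphism). (i) If $\operatorname{rank}(e)\ge N/2$ and $e^2\neq 0$, then $\mathfrak s_\star=\{0\}$, $r(\mathcal O)=\operatorname{rk}\mathfrak{sl}_N=N-1$, and $\mathbf{CS}(\mathcal O)=\mathfrak{sl}_N$. (ii) If $\operatorname{rank}(e)=j<N/2$ and $e^2\ne 0$ (so $2\le j\le [\frac{N-1}{2}]$), then $\mathfrak s_\star=\mathfrak{gl}_{N-2j}$, $r(\mathcal O)=2j-1$, and $\mathbf{CS}(\mathcal O)=\mathsf D^o_{2j}(N)$. (iii) If $\mathcal O=\mathcal O_{(2^r,1^{N-2r})}$, then $\mathcal O$ is spherical and $1\le r\le N/2$. Here $\mathfrak s_\star=\mathfrak{gl}_{N-2r}\oplus\mathfrak t_{r-1}$, $r(\mathcal O)=\operatorname{rank}(e)=r$, and $$\mathbf{CS}(\mathcal O)=\mathsf D^o_{2r}(N)\cap\{\sigma_3=\dots=\sigma_{2r-1}=0\}=\mathsf D_{2r}(N)\cap\{\sigma_1=\sigma_3=\dots=\sigma_{2r-1}=0\},$$ where the vanishing conditions are on the $\sigma_i$ with $i$ odd in the indicated range.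
   Context: The ground field $\Bbbk$ is algebraically closed of characteristic $0$. $G=SL_N$, $N\ge 2$; $\operatorname{rank}(e)$ is the usual matrix rank; $[x]$ is the integer part. $\mathcal O_{\lambda}$ is the nilpotent orbit of matrices with Jordan block sizes given by the partition $\lambda$ of $N$. $\mathsf D_r(N)=\{M\in\mathfrak{gl}_N\mid\operatorname{rank}(M)\le r\}$ and $\mathsf D^o_r(N)=\mathsf D_r(N)\cap\mathfrak{sl}_N$. The functions $\sigma_i$ are defined by $\det(tI-M)=t^N-\sigma_1(M)t^{N-1}+\dots+(-1)^N\sigma_N(M)$. $\mathfrak t_m$ is an $m$-dimensional toral (diagonalisable) Lie algebra, $\mathfrak{gl}_0=\{0\}$. Rank and sphericity: with $B\subset G$ a Borel subgroup, $r(X)$ for an irreducible $G$-variety $X$ is the rank of the free abelian group of weights (characters of $B$) of all nonzero $B$-semi-invariant rational functions on $X$; $X$ is spherical if $B$ has a dense orbit in $X$. Generic isotropy subalgebra: there is a dense open subset of $\mathcal O\times\mathcal O$ on which all stabilisers are $G$-conjugate; $\mathfrak s_\star$ is the Lie algebra of such a stabiliser (the common centraliser of a generic pair $(x,y)$). Conical secant variety: $\mathbb P\mathcal O\subset\mathbb P\mathfrak g$ ($\mathfrak g=\mathfrak{sl}_N$) is the projectivisation of the conical variety $\mathcal O$. The secant variety of $X=\overline{\mathbb P\mathcal O}$ is the closure of the union of all lines through two distinct points of $X$. $\mathbf{CS}(\mathcal O)\subset\mathfrak g$ is the affine cone over this secant variety (the preimage under $\mathfrak g\setminus\{0\}\to\mathbb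 P\mathfrak g$ together with $0$). *)

(* Defs.v *)
From HB Require Import structures.
From mathcomp Require Import all_boot all_order all_algebra.
From mathcomp Require Import classical_sets.
From mathcomp Require Import mpoly.

Set Implicit Arguments.
Unset Strict Implicit.
Unset Printing Implicit Defensive.

Import GRing.Theory.

Local Open Scope ring_scope.
Local Open Scope classical_set_scope.

Section Definitions.
Variable k : closedFieldType.

(** * Zariski topology on matrix spaces *)

Definition peval m n (p : {mpoly k[m * n]}) (x : 'M[k]_(m, n)) : k :=
  p.@[fun i => mxvec x 0 i].

Definition vanishes_on m n (p : {mpoly k[m * n]}) (A : set 'M[k]_(m, n)) :=
  forall x, A x -> peval p x = 0.

Definition zclosure m n (A : set 'M[k]_(m, n)) : set 'M[k]_(m, n) :=
  [set x | forall p : {mpoly k[m * n]}, vanishes_on p A -> peval p x = 0].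

Definition zopen_in m n (X U : set 'M[k]_(m, n)) : Prop :=
  U `<=` X /\ X `&` zclosure (X `\` U) `<=` X `\` U.

Definition zdense_in m n (X A : set 'M[k]_(m, n)) : Prop :=
  A `<=` X /\ X `<=` zclosure A.

Section FixedSize.
Variable N : nat.
Implicit Types (x y g b : 'M[k]_N) (X O B s : set 'M[k]_N).

(** * The group SL_N acting by conjugation *)

Definition SL : set 'M[k]_N := [set g | \det g = 1].
Definition sl : set 'M[k]_N := [set x | \tr x = 0].

Definition mxconj g x : 'M[k]_N := g *m x *m invmx g.

Definition orbit_of B x : set 'M[k]_N := [set mxconj b x | b in B].

Definition nilpotent_mx x := exists n, x ^+ n = 0.

(** * Nilpotent orbits and partitions *)

Definition partition_of (lam : seq nat) : bool :=
  [&& sorted geq lam, 0%N \notin lam & sumn lam == N].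

(* Ones on the superdiagonal, except in the rows that end a block: row i
   (numbered from 0) ends a block iff i.+1 is a partial sum of lam. *)
Definition jordan_nilp (lam : seq nat) : 'M[k]_N :=
  \matrix_(i, j) ((j == i.+1 :> nat) && (i.+1 \notin scanl addn 0%N lam))%:R.

Definition nilp_orbit (lam : seq nat) : set 'M[k]_N :=
  [set x | exists2 g, g \in unitmx & x = mxconj g (jordan_nilp lam)].

(** * Determinantal varieties and coefficients of the characteristic polynomial *)

Definition Dr (r : nat) : set 'M[k]_N := [set x | (\rank x <= r)%N].
Definition Dro (r : nat) : set 'M[k]_N := Dr r `&` sl.

(* Meaningful for i <= N only: N - i is truncated. *)
Definition sigma (i : nat) x : k := (-1) ^+ i * (char_poly x)`_(N - i).

(** * Borel subgroups, rank and sphericity *)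

Definition upper_SL : set 'M[k]_N :=
  [set b | SL b /\ forall i j : 'I_N, (j < i)%N -> b i j = 0].

(* The Borel subgroups of SL_N: stabilisers of complete flags, that is,
   SL_N-conjugates of the group of upper triangular matrices. *)
Definition borel B : Prop :=
  exists2 g, SL g & B = [set mxconj g b | b in upper_SL].

(* Only the values of chi on B are relevant.  B being Zariski closed in the
   matrix space, its regular functions are restrictions of polynomials. *)
Definition is_character B (chi : 'M[k]_N -> k) : Prop :=
  [/\ exists p : {mpoly k[N * N]}, forall b, B b -> chi b = peval p b,
      chi 1%:M = 1
    & forall b b', B b -> B b' -> chi (b *m b') = chi b * chi b'].

(* For a conjugation-stable, locally closed, irreducible X, a nonzero rational
   function on X is a fraction p / q of polynomials that are not identically
   zero on X.  The last clause is the identity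
   (p / q) (b^-1 x b) = chi b * (p / q) (x) in the function field of X. *)
Definition is_weight B X (chi : 'M[k]_N -> k) : Prop :=
  is_character B chi /\
  exists p q : {mpoly k[N * N]},
    [/\ ~ vanishes_on p X, ~ vanishes_on q X &
        forall b x, B b -> X x ->
          peval p (mxconj (invmx b) x) * peval q x =
          chi b * (peval p x * peval q (mxconj (invmx b) x))].

(* The weights form a free abelian group with basis chi_0, ..., chi_(r-1). *)
Definition weight_group_rank B X (r : nat) : Prop :=
  exists chi : 'I_r -> 'M[k]_N -> k,
    [/\ forall i, is_weight B X (chi i),
        forall m : 'I_r -> int,
          (forall b, B b -> \prod_(i < r) chi i b ^ m i = 1) ->
          forall i, m i = 0
      & forall w, is_weight B X w ->
          exists m : 'I_r -> int,
            forall b, B b -> w b = \prod_(i < r) chi i b ^ m i].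

Definition variety_rank X (r : nat) : Prop :=
  forall B, borel B -> weight_group_rank B X r.

Definition spherical X : Prop :=
  forall B, borel B -> exists2 x, X x & zdense_in X (orbit_of B x).

(** * Generic isotropy subalgebra of O * O *)

Definition pair_mx (u : 'M[k]_N * 'M[k]_N) : 'M[k]_(N, N + N) :=
  row_mx u.1 u.2.

Definition stabiliser (u : 'M[k]_N * 'M[k]_N) : set 'M[k]_N :=
  [set g | [/\ SL g, mxconj g u.1 = u.1 & mxconj g u.2 = u.2]].

Definition lie m (x y : 'M[k]_m) : 'M[k]_m := x *m y - y *m x.

(* The Lie algebra of the stabiliser (the characteristic being 0). *)
Definition isotropy (u : 'M[k]_N * 'M[k]_N) : set 'M[k]_N :=
  [set z | [/\ sl z, lie z u.1 = 0 & lie z u.2 = 0]].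

(* P describes an isomorphism class of Lie subalgebras of sl_N. *)
Definition generic_isotropy O (P : set 'M[k]_N -> Prop) : Prop :=
  exists U : set ('M[k]_N * 'M[k]_N),
    let OO := pair_mx @` (O `*` O) in
    [/\ zopen_in OO (pair_mx @` U),
        zdense_in OO (pair_mx @` U),
        forall u v, U u -> U v ->
          exists2 g, SL g & stabiliser v = [set mxconj g h | h in stabiliser u]
      & forall u, U u -> P (isotropy u)].

Definition lie_isom (V : lmodType k) (br : V -> V -> V) s
    (f : {linear V -> 'M[k]_N}) : Prop :=
  [/\ injective f, range f = s & forall u v, f (br u v) = lie (f u) (f v)].

Definition toral s : Prop :=
  exists2 g, g \in unitmx & forall z, s z -> is_diag_mx (mxconj g z).

Definition iso_gl (m : nat) s : Prop :=
  exists f : {linear 'M[k]_m -> 'M[k]_N}, lie_isom (@lie m) s f.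

(* The summand t_d is k^d with zero bracket; being toral, it has to act on k^N
   by simultaneously diagonalisable matrices. *)
Definition gl_toral_lie m d (u v : 'M[k]_m * 'rV[k]_d) : 'M[k]_m * 'rV[k]_d :=
  (lie u.1 v.1, 0).

Definition iso_gl_toral (m d : nat) s : Prop :=
  exists f : {linear ('M[k]_m * 'rV[k]_d)%type -> 'M[k]_N},
    lie_isom (@gl_toral_lie m d) s f /\ toral (range (fun t => f (0, t))).

(** * Conical secant variety *)

(* Points of the projective space of 'M_N are the one-dimensional subspaces. *)
Definition proj_points (A : set 'M[k]_N) : set {vspace 'M[k]_N} :=
  [set l | exists2 x, A x /\ x != 0 & l = <[x]>%VS].

Definition proj_closure (S : set {vspace 'M[k]_N}) : set {vspace 'M[k]_N} :=
  [set l | \dim l = 1%N /\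
     forall d (p : {mpoly k[N * N]}), p \is d.-homog ->
       (forall l', S l' -> forall x, x \in l' -> peval p x = 0) ->
       forall x, x \in l -> peval p x = 0].

Definition secant_variety (X : set {vspace 'M[k]_N}) : set {vspace 'M[k]_N} :=
  proj_closure
    [set l | \dim l = 1%N /\
       exists l1 l2, [/\ X l1, X l2, l1 <> l2 & (l <= l1 + l2)%VS]].

Definition affine_cone (S : set {vspace 'M[k]_N}) : set 'M[k]_N :=
  [set x | x = 0 \/ (x != 0 /\ S <[x]>%VS)].

Definition CS O : set 'M[k]_N :=
  affine_cone (secant_variety (proj_closure (proj_points O))).

End FixedSize.
End Definitions.

Arguments SL {k} N.
Arguments sl {k} N.
Arguments jordan_nilp {k} N lam.
Arguments nilp_orbit {k} N lam.
Arguments Dr {k} N r.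
Arguments Dro {k} N r.

(* Main.v *)
Require Import Defs.
From HB Require Import structures.
From mathcomp Require Import all_boot all_order all_algebra.
From mathcomp Require Import cyclic separable cyclotomic.
From mathcomp Require Import classical_sets boolp mpoly.
From mathcomp Require Import ring zify.

(* The argument is explicit matrix algebra; a closed condition is propagated
   along polynomial curves, and an orbit is irreducible because it is a
   rational image of GL_N.

   Secant variety.  CS(O) is the closure of C + C, where C is the closed cone
   spanned by O.  If e^2 <> 0, limits of conjugates of e show that C contains
   every product A R with A : N x j of rank j <= rank e and R A square-zero of
   rank at most one.  A generic traceless matrix of rank at most 2j is a
   companion matrix, and its odd rows and its even rows form two such products.
   If e^2 = 0, then (c + x)(c - x - y)(c + y) = c (c^2 - x y) shows that sums
   have an even characteristic polynomial; conversely the odd and even rows of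
   an even companion matrix are square-zero.

   Isotropy.  A pair is generic when suitable words have a nonsingular Gram
   matrix for the trace form: if e^2 <> 0 the words span a full matrix algebra
   M_n, so that the centraliser is scalar on k^n and arbitrary on a complement;
   if e^2 = 0 the Hankel matrix of the traces of (xy)^m detects that xy has r
   distinct nonzero eigenvalues, and the pair has the normal form
   x = (0 1; 0 0), y = (0 0; D 0) with D diagonal.

   Rank.  Corner minors give semi-invariants of the upper triangular group,
   whose quotients realise enough weights; a torus acting trivially at a generic
   point, up to unipotent elements, bounds the weights from above. *)

Set Implicit Arguments.
Unset Strict Implicit.
Unset Printing Implicit Defensive.

Import GRing.Theory.
Local Open Scope ring_scope.
Local Open Scope classical_set_scope.

(** * Algebras of functions and localisation *)

(** Degenerations reach only the closed cone C, not the orbit. This costs nothing: a polynomial that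
    is nonzero at a point of C is nonzero at some multiple of an element of O, and the polynomials
    used are homogeneous or come in families stable under rescaling. The size j given to the
    degenerations is rank(e) if 2 rank(e) <= N, and N/2 rounded up otherwise. For odd N in the
    second case 2j = N + 1, one row more than there is room for; this is the origin of the
    alternative [n = 2 * j] or [n.+1 = 2 * j] with [q = 0], and of the row [h] that follows a
    one-dimensional left kernel through the degenerations. Characteristic 0 is used to solve trace
    relations (n and 2 invertible), to have 1, ..., r distinct and nonzero, to read off the parity
    of a polynomial, and to have primitive roots of unity. The rank falls from 2j - 1 to r for
    square-zero orbits because the minors [Theta] involve x^2: where they are nonzero, they separate
    the outer diagonal entries of b one by one; without them only ratios of opposite entries
    occur. *)

Section FunAlg.
Variable k : closedFieldType.

(** One closure calculus serves polynomial functions on matrix spaces, polynomials in a curve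
    parameter and localisations of either. *)
Record funalg (T : Type) (P : (T -> k) -> Prop) : Prop := FunAlg {
  fa_const : forall c, P (fun=> c);
  fa_add : forall f g, P f -> P g -> P (fun t => f t + g t);
  fa_mul : forall f g, P f -> P g -> P (fun t => f t * g t) }.

(** The property of being an integral domain, stated pointwise; irreducibility is always used in
    this form. *)
Definition fundom (T : Type) (P : (T -> k) -> Prop) :=
  forall f g, P f -> P g -> (exists t, f t != 0) -> (exists t, g t != 0) ->
  exists t, f t != 0 /\ g t != 0.

(** Localisation of [P] at [d], realised by functions on all of [T]. Values where [d] vanishes are
    unconstrained, so the default values of inverses do no harm. *)
Definition loc (T : Type) (P : (T -> k) -> Prop) (d f : T -> k) : Prop :=
  exists n h, P h /\ forall t, d t != 0 -> d t ^+ n * f t = h t.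

Definition mxfun (T : Type) (P : (T -> k) -> Prop) m n (F : T -> 'M[k]_(m, n)) :=
  forall i j, P (fun t => F t i j).

Definition polyfun m n (f : 'M[k]_(m, n) -> k) : Prop :=
  exists p : {mpoly k[m * n]}, forall x, f x = peval p x.

Definition upoly (f : k -> k) : Prop := exists u : {poly k}, forall s, f s = u.[s].

Section Closure.
Variables (T : Type) (P : (T -> k) -> Prop).
Hypothesis PA : funalg P.

Lemma fa_opp f : P f -> P (fun t => - f t).
Proof.
move=> Pf; have := fa_mul PA (fa_const PA (-1)) Pf.
by congr P; apply: funext => t; rewrite mulN1r.
Qed.

Lemma fa_sub f g : P f -> P g -> P (fun t => f t - g t).
Proof. by move=> Pf Pg; apply: (fa_add PA) => //; apply: fa_opp. Qed.

Lemma fa_exp f n : P f -> P (fun t => f t ^+ n).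
Proof.
move=> Pf; elim: n => [|n IH]; first exact: (fa_const PA 1).
have := fa_mul PA Pf IH.
by congr P; apply: funext => t; rewrite exprS.
Qed.

Lemma fa_sum (I : Type) (r : seq I) (Q : pred I) (F : I -> T -> k) :
  (forall i, P (F i)) -> P (fun t => \sum_(i <- r | Q i) F i t).
Proof.
move=> PF; elim: r => [|i r IH].
  by have := fa_const PA 0; congr P; apply: funext => t; rewrite big_nil.
case Qi: (Q i); last first.
  by move: IH; congr P; apply: funext => t; rewrite big_cons Qi.
have := fa_add PA (PF i) IH.
by congr P; apply: funext => t; rewrite big_cons Qi.
Qed.

Lemma fa_prod (I : Type) (r : seq I) (Q : pred I) (F : I -> T -> k) :
  (forall i, P (F i)) -> P (fun t => \prod_(i <- r | Q i) F i t).
Proof.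
move=> PF; elim: r => [|i r IH].
  by have := fa_const PA 1; congr P; apply: funext => t; rewrite big_nil.
case Qi: (Q i); last first.
  by move: IH; congr P; apply: funext => t; rewrite big_cons Qi.
have := fa_mul PA (PF i) IH.
by congr P; apply: funext => t; rewrite big_cons Qi.
Qed.

Lemma fa_det n (F : T -> 'M[k]_n) : mxfun P F -> P (fun t => \det (F t)).
Proof.
move=> PF; apply: fa_sum => s; apply: (fa_mul PA); first exact: (fa_const PA).
exact: fa_prod.
Qed.

Lemma fa_tr n (F : T -> 'M[k]_n) : mxfun P F -> P (fun t => \tr (F t)).
Proof. by move=> PF; apply: fa_sum. Qed.

Lemma mxfun_const m n (A : 'M[k]_(m, n)) : mxfun P (fun=> A).
Proof. by move=> i j; apply: (fa_const PA). Qed.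

Lemma mxfun_add m n (F G : T -> 'M[k]_(m, n)) :
  mxfun P F -> mxfun P G -> mxfun P (fun t => F t + G t).
Proof.
move=> PF PG i j; have := fa_add PA (PF i j) (PG i j).
by congr P; apply: funext => t; rewrite !mxE.
Qed.

Lemma mxfun_opp m n (F : T -> 'M[k]_(m, n)) :
  mxfun P F -> mxfun P (fun t => - F t).
Proof.
move=> PF i j; have := fa_opp (PF i j).
by congr P; apply: funext => t; rewrite !mxE.
Qed.

Lemma mxfun_mul m n p (F : T -> 'M[k]_(m, n)) (G : T -> 'M[k]_(n, p)) :
  mxfun P F -> mxfun P G -> mxfun P (fun t => F t *m G t).
Proof.
move=> PF PG i j.
have := @fa_sum _ (index_enum 'I_n) xpredT (fun l t => F t i l * G t l j)
  (fun l => fa_mul PA (PF i l) (PG l j)).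
by congr P; apply: funext => t; rewrite !mxE.
Qed.

Lemma mxfun_scale m n (f : T -> k) (F : T -> 'M[k]_(m, n)) :
  P f -> mxfun P F -> mxfun P (fun t => f t *: F t).
Proof.
move=> Pf PF i j; have := fa_mul PA Pf (PF i j).
by congr P; apply: funext => t; rewrite !mxE.
Qed.

Lemma mxfun_scalar n (f : T -> k) : P f -> mxfun P (fun t => (f t)%:M : 'M_n).
Proof.
move=> Pf i j; have := fa_mul PA Pf (fa_const PA (i == j)%:R).
by congr P; apply: funext => t; rewrite !mxE mulr_natr.
Qed.

Lemma mxfun_exp n (F : T -> 'M[k]_n) d : mxfun P F -> mxfun P (fun t => F t ^+ d).
Proof.
move=> PF; elim: d => [|d IH]; first exact: (mxfun_const (1%:M : 'M_n)).
have := mxfun_mul PF IH.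
by congr mxfun; apply: funext => t; rewrite exprS.
Qed.

Lemma mxfun_row m n1 n2 (F : T -> 'M[k]_(m, n1)) (G : T -> 'M[k]_(m, n2)) :
  mxfun P F -> mxfun P G -> mxfun P (fun t => row_mx (F t) (G t)).
Proof.
move=> PF PG i j; have [j1|j2] := splitP j.
  move=> e; have := PF i j1; congr P; apply: funext => t.
  by rewrite (_ : j = lshift n2 j1) ?row_mxEl //; apply: val_inj => /=; rewrite e.
move=> e; have := PG i j2; congr P; apply: funext => t.
by rewrite (_ : j = rshift n1 j2) ?row_mxEr //; apply: val_inj => /=; rewrite e.
Qed.

Lemma mxfun_tr m n (F : T -> 'M[k]_(m, n)) :
  mxfun P F -> mxfun P (fun t => (F t)^T).
Proof.
move=> PF i j; have := PF j i.
by congr P; apply: funext => t; rewrite mxE.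
Qed.

Lemma mxfun_col m1 m2 n (F : T -> 'M[k]_(m1, n)) (G : T -> 'M[k]_(m2, n)) :
  mxfun P F -> mxfun P G -> mxfun P (fun t => col_mx (F t) (G t)).
Proof.
move=> PF PG; have := mxfun_tr (mxfun_row (mxfun_tr PF) (mxfun_tr PG)).
by congr mxfun; apply: funext => t; rewrite tr_row_mx !trmxK.
Qed.

Lemma mxfun_block m1 m2 n1 n2 (F : T -> 'M[k]_(m1, n1)) (G : T -> 'M[k]_(m1, n2))
    (H : T -> 'M[k]_(m2, n1)) (K : T -> 'M[k]_(m2, n2)) :
  mxfun P F -> mxfun P G -> mxfun P H -> mxfun P K ->
  mxfun P (fun t => block_mx (F t) (G t) (H t) (K t)).
Proof. by move=> PF PG PH PK; apply: mxfun_col; apply: mxfun_row. Qed.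

Lemma mxfun_lsub m n1 n2 (F : T -> 'M[k]_(m, n1 + n2)) :
  mxfun P F -> mxfun P (fun t => lsubmx (F t)).
Proof.
move=> PF i j; have := PF i (lshift n2 j).
by congr P; apply: funext => t; rewrite mxE.
Qed.

Lemma mxfun_rsub m n1 n2 (F : T -> 'M[k]_(m, n1 + n2)) :
  mxfun P F -> mxfun P (fun t => rsubmx (F t)).
Proof.
move=> PF i j; have := PF i (rshift n1 j).
by congr P; apply: funext => t; rewrite mxE.
Qed.

Lemma mxfun_adj n (F : T -> 'M[k]_n) : mxfun P F -> mxfun P (fun t => \adj (F t)).
Proof.
move=> PF i j.
suff : P (fun t => cofactor (F t) j i).
  by congr P; apply: funext => t; rewrite mxE.
apply: (fa_mul PA); first exact: (fa_const PA).
apply: fa_det => a b; have := PF (lift j a) (lift i b).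
by congr P; apply: funext => t; rewrite !mxE.
Qed.

Lemma polyfun_comp m n (f : 'M[k]_(m, n) -> k) (F : T -> 'M[k]_(m, n)) :
  polyfun f -> mxfun P F -> P (fun t => f (F t)).
Proof.
case=> p fE PF.
suff : P (fun t => \sum_(c <- msupp p) p@_c * \prod_i mxvec (F t) 0 i ^+ c i).
  by congr P; apply: funext => t; rewrite fE /peval mevalE.
apply: fa_sum => c; apply: (fa_mul PA); first exact: (fa_const PA).
apply: fa_prod => i; apply: fa_exp.
case/mxvec_indexP: i => a b.
by have := PF a b; congr P; apply: funext => t; rewrite mxvecE.
Qed.

End Closure.

Lemma upoly_funalg : funalg upoly.
Proof.
split=> [c|f g [u fE] [v gE]|f g [u fE] [v gE]].
- by exists c%:P => s; rewrite hornerC.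
- by exists (u + v) => s; rewrite hornerD fE gE.
- by exists (u * v) => s; rewrite hornerM fE gE.
Qed.

Lemma upoly_id : upoly id.
Proof. by exists 'X => s; rewrite hornerX. Qed.

Lemma upoly_fundom : fundom upoly.
Proof.
move=> f g [u fE] [v gE] [s fs] [t gt].
have u0 : u != 0 by apply: contraNneq fs => u0; rewrite fE u0 horner0.
have v0 : v != 0 by apply: contraNneq gt => v0; rewrite gE v0 horner0.
have /closed_nonrootP [z] : u * v != 0 by rewrite mulf_neq0.
rewrite rootE hornerM mulf_eq0 negb_or => /andP[h1 h2].
by exists z; rewrite fE gE.
Qed.

Lemma polyfun_funalg m n : funalg (@polyfun m n).
Proof.
split=> [c|f g [u fE] [v gE]|f g [u fE] [v gE]].
- by exists c%:MP => s; rewrite /peval mevalC.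
- by exists (u + v) => s; rewrite /peval mevalD fE gE.
- by exists (u * v) => s; rewrite /peval mevalM fE gE.
Qed.

Lemma polyfun_entry m n i j : polyfun (fun x : 'M[k]_(m, n) => x i j).
Proof. by exists 'X_(mxvec_index i j) => x; rewrite /peval mevalXU mxvecE. Qed.

Lemma mxfun_id m n : mxfun (@polyfun m n) id.
Proof. by move=> i j; apply: polyfun_entry. Qed.

Lemma mxfun_line m n (A B : 'M[k]_(m, n)) : mxfun upoly (fun s => A + s *: B).
Proof.
apply: (mxfun_add upoly_funalg); first exact: (mxfun_const upoly_funalg).
apply: (mxfun_scale upoly_funalg); first exact: upoly_id.
exact: (mxfun_const upoly_funalg).
Qed.

(** The line through a point where [f] is nonzero and one where [g] is nonzero reduces the claim to
    one variable. *)
Lemma polyfun_fundom m n : fundom (@polyfun m n).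
Proof.
move=> f g Pf Pg [x fx] [y gy].
have L := mxfun_line x (y - x).
have [||z [fz gz]] := upoly_fundom (polyfun_comp upoly_funalg Pf L)
                            (polyfun_comp upoly_funalg Pg L).
- by exists 0; rewrite scale0r addr0.
- by exists 1; rewrite scale1r addrC subrK.
- by exists (x + z *: (y - x)).
Qed.

Section Localisation.
Variables (T : Type) (P : (T -> k) -> Prop).
Hypothesis PA : funalg P.
Variable d : T -> k.
Hypothesis Pd : P d.

Lemma loc_base f : P f -> loc P d f.
Proof. by move=> Pf; exists 0, f; split=> // t _; rewrite mul1r. Qed.

Lemma loc_funalg : funalg (loc P d).
Proof.
split=> [c|f g [n [u [Pu fE]]] [l [v [Pv gE]]]|f g [n [u [Pu fE]]] [l [v [Pv gE]]]].
- exact: loc_base (fa_const PA c).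
- exists (n + l)%N, (fun t => d t ^+ l * u t + d t ^+ n * v t); split.
    by apply: (fa_add PA); apply: (fa_mul PA) => //; apply: fa_exp.
  move=> t dt; rewrite -(fE t dt) -(gE t dt) mulrDr exprD.
  by rewrite [X in X * f t]mulrC -!mulrA.
- exists (n + l)%N, (fun t => u t * v t); split; first exact: (fa_mul PA).
  by move=> t dt; rewrite -(fE t dt) -(gE t dt) exprD mulrACA.
Qed.

Lemma loc_inv : loc P d (fun t => (d t)^-1).
Proof.
exists 1, (fun=> 1); split; first exact: (fa_const PA).
by move=> t dt; rewrite expr1 mulfV.
Qed.

Lemma loc_ext f g : (forall t, d t != 0 -> f t = g t) -> loc P d f -> loc P d g.
Proof.
move=> fg [n [h [Ph fE]]]; exists n, h; split=> // t dt.
by rewrite -fg // fE.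
Qed.

(** Multiplying each numerator by [d] once more yields elements of [P] whose nonvanishing includes
    that of [d]. *)
Lemma loc_nz f g : fundom P -> loc P d f -> loc P d g ->
  (exists t, d t != 0 /\ f t != 0) -> (exists t, d t != 0 /\ g t != 0) ->
  exists t, [/\ d t != 0, f t != 0 & g t != 0].
Proof.
move=> dom [n [u [Pu fE]]] [l [v [Pv gE]]] [t [dt ft]] [s [ds gs]].
have [||z []] := dom _ _ (fa_mul PA Pd Pu) (fa_mul PA Pd Pv).
- by exists t; rewrite -fE // !mulf_neq0 // expf_neq0.
- by exists s; rewrite -gE // !mulf_neq0 // expf_neq0.
rewrite !mulf_eq0 !negb_or => /andP[dz uz] /andP[_ vz].
exists z; split=> //.
  by move: uz; rewrite -fE // mulf_eq0 negb_or => /andP[].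
by move: vz; rewrite -gE // mulf_eq0 negb_or => /andP[].
Qed.

Lemma loc_invmx n (F : T -> 'M[k]_n) :
  loc P d (fun t => (\det (F t))^-1) -> (forall t, d t != 0 -> \det (F t) != 0) ->
  mxfun (loc P d) F -> mxfun (loc P d) (fun t => invmx (F t)).
Proof.
move=> dV dF PF i j.
apply: (@loc_ext (fun t => (\det (F t))^-1 * (\adj (F t)) i j)) => [t dt|].
  by rewrite /invmx unitmxE unitfE dF // [RHS]mxE.
apply: (fa_mul loc_funalg dV).
exact: (mxfun_adj loc_funalg).
Qed.

End Localisation.

Lemma upoly_ext f h : upoly f -> upoly h -> (exists t, h t != 0) ->
  (forall t, h t != 0 -> f t = 0) -> forall t, f t = 0.
Proof.
move=> Pf Ph exh hf t; apply/eqP; apply: contraTT isT => ft.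
have [||z [fz hz]] := upoly_fundom Pf Ph => //; first by exists t.
by move: fz; rewrite hf // eqxx.
Qed.

Lemma zclosureP m n (A : set 'M[k]_(m, n)) x :
  zclosure A x <-> forall f, polyfun f -> (forall y, A y -> f y = 0) -> f x = 0.
Proof.
split=> [clx f [p fE] fA|H p pA]; last by apply: (H (peval p)) => //; exists p.
by rewrite fE; apply: clx => y /fA; rewrite fE.
Qed.

Lemma sub_zclosure m n (A : set 'M[k]_(m, n)) : A `<=` zclosure A.
Proof. by move=> x Ax p; apply. Qed.

(** The limit argument behind all degenerations: a polynomial vanishing on [A] vanishes along the
    curve off the zeros of [h], hence for every parameter. *)
Lemma zclosure_curve m n (A : set 'M[k]_(m, n)) (F : k -> 'M[k]_(m, n)) h :
  mxfun upoly F -> upoly h -> (exists t, h t != 0) ->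
  (forall t, h t != 0 -> zclosure A (F t)) -> forall t, zclosure A (F t).
Proof.
move=> PF Ph exh hF t; apply/zclosureP => f Pf fA.
apply: (upoly_ext (polyfun_comp upoly_funalg Pf PF) Ph exh) => s hs.
by have /zclosureP := hF s hs; apply.
Qed.

Lemma zclosureS m n (A B : set 'M[k]_(m, n)) :
  A `<=` zclosure B -> zclosure A `<=` zclosure B.
Proof.
move=> AB x /zclosureP clx; apply/zclosureP => f Pf fB; apply: clx => // y Ay.
by have /zclosureP := AB _ Ay; apply.
Qed.

Lemma zclosure_map m n p q (A : set 'M[k]_(m, n)) (B : set 'M[k]_(p, q))
    (F : 'M[k]_(m, n) -> 'M[k]_(p, q)) :
  mxfun (@polyfun m n) F -> (forall x, A x -> zclosure B (F x)) ->
  forall x, zclosure A x -> zclosure B (F x).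
Proof.
move=> PF AB x /zclosureP clx; apply/zclosureP => f Pf fB.
apply: (clx (fun x => f (F x))) => [|y Ay].
  exact: (polyfun_comp (polyfun_funalg m n)).
by have /zclosureP := AB y Ay; apply.
Qed.

End FunAlg.

(** * Linear algebra and conjugation *)

Section Linear.
Variable k : closedFieldType.

Lemma nth_root_ex n (c : k) : (0 < n)%N -> exists x, x ^+ n = c.
Proof.
move=> n0; have /closed_rootP [x] : size ('X^n - c%:P : {poly k}) != 1%N.
  by rewrite size_XnsubC // eqSS -lt0n.
by rewrite rootE !hornerE subr_eq0 => /eqP <-; exists x.
Qed.

Lemma mxconj_eq N (g x y : 'M[k]_N) :
  g \in unitmx -> g *m x = y *m g -> mxconj g x = y.
Proof. by move=> ug e; rewrite /mxconj e mulmxK. Qed.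

Lemma mxconjV_eq N (g x y : 'M[k]_N) :
  g \in unitmx -> g *m y = x *m g -> mxconj (invmx g) x = y.
Proof.
by move=> ug e; apply: mxconj_eq; rewrite ?unitmx_inv // -[x](mulmxK ug) -e !mulmxA mulVmx ?mul1mx.
Qed.

Lemma mxconjM N (g h x : 'M[k]_N) : g \in unitmx -> h \in unitmx ->
  mxconj (g *m h) x = mxconj g (mxconj h x).
Proof.
move=> ug uh; apply: mxconj_eq; first by rewrite unitmx_mul ug.
by rewrite /mxconj !mulmxA !(mulmxKV _) // -!mulmxA.
Qed.

Lemma mxconj1 N (x : 'M[k]_N) : mxconj 1%:M x = x.
Proof. by apply: mxconj_eq; rewrite ?unitmx1 // mul1mx mulmx1. Qed.

Lemma mxconjK N (g x : 'M[k]_N) : g \in unitmx -> mxconj (invmx g) (mxconj g x) = x.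
Proof. by move=> ug; rewrite -mxconjM ?unitmx_inv // mulVmx // mxconj1. Qed.

Lemma mxconjVK N (g x : 'M[k]_N) : g \in unitmx -> mxconj g (mxconj (invmx g) x) = x.
Proof. by move=> ug; rewrite -mxconjM ?unitmx_inv // mulmxV // mxconj1. Qed.

Lemma mxconj_mul N (g x y : 'M[k]_N) : g \in unitmx ->
  mxconj g (x *m y) = mxconj g x *m mxconj g y.
Proof. by move=> ug; rewrite /mxconj !mulmxA mulmxKV. Qed.

Lemma mxconjD N (g x y : 'M[k]_N) : mxconj g (x + y) = mxconj g x + mxconj g y.
Proof. by rewrite /mxconj mulmxDr mulmxDl. Qed.

Lemma mxconjZ N (g x : 'M[k]_N) a : mxconj g (a *: x) = a *: mxconj g x.
Proof. by rewrite /mxconj -scalemxAr -scalemxAl. Qed.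

Lemma mxconj_scale N (g x : 'M[k]_N) a : a != 0 -> g \in unitmx ->
  mxconj (a *: g) x = mxconj g x.
Proof.
move=> a0 ug; apply: mxconj_eq; first by rewrite unitmxZ ?unitfE.
by rewrite -scalemxAl -scalemxAr /mxconj mulmxKV.
Qed.

Lemma SL_unit N (g : 'M[k]_N) : SL N g -> g \in unitmx.
Proof. by rewrite /SL /= unitmxE => ->; rewrite unitr1. Qed.

(** Conjugation ignores scalars and the field has N-th roots, so SL_N-orbits can be handled with
    arbitrary invertible matrices. *)
Lemma SL_scale N (g : 'M[k]_N) : (0 < N)%N -> g \in unitmx ->
  exists2 a, a != 0 & SL N (a *: g).
Proof.
move=> N0 ug; have dg : \det g != 0 by rewrite -unitfE -unitmxE.
have [a aE] := nth_root_ex (\det g)^-1 N0; exists a.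
  by apply: contraNneq dg => a0; rewrite -invr_eq0 -aE a0 expr0n gtn_eqF.
by rewrite /SL /= detZ aE mulVf.
Qed.

Lemma SL_mul N (g h : 'M[k]_N) : SL N g -> SL N h -> SL N (g *m h).
Proof. by rewrite /SL /= det_mulmx => -> ->; rewrite mulr1. Qed.

Lemma SL_inv N (g : 'M[k]_N) : SL N g -> SL N (invmx g).
Proof. by rewrite /SL /= det_inv => ->; rewrite invr1. Qed.

Lemma orbit_conj N (e g x : 'M[k]_N) : (0 < N)%N -> g \in unitmx ->
  orbit_of (SL N) e x -> orbit_of (SL N) e (mxconj g x).
Proof.
move=> N0 ug [h SLh <-]; have uh := SL_unit SLh.
have [|a a0 SLa] := @SL_scale N (g *m h) N0; first by rewrite unitmx_mul ug.
exists (a *: (g *m h)) => //.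
by rewrite mxconj_scale ?mxconjM // unitmx_mul ug.
Qed.

Lemma mxconj_orbit N (e g : 'M[k]_N) : (0 < N)%N -> g \in unitmx ->
  orbit_of (SL N) e (mxconj g e).
Proof.
move=> N0 ug; apply: orbit_conj => //; exists 1%:M; last exact: mxconj1.
by rewrite /SL /= det1.
Qed.

Lemma rank_factor m n (M : 'M[k]_(m, n)) r : \rank M = r ->
  exists (A : 'M_(m, r)) (R : 'M_(r, n)),
    [/\ M = A *m R, \rank A = r & \rank R = r].
Proof.
move=> <-; exists (col_base M), (row_base M); split; first by rewrite mulmx_base.
  by apply/eqP; exact: col_base_full.
by apply/eqP; exact: row_base_free.
Qed.

Lemma rank_right_inv m n (M : 'M[k]_(m, n)) : \rank M = m -> exists B, M *m B = 1%:M.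
Proof. by move=> rM; apply/row_freeP; rewrite /row_free rM. Qed.

Lemma rank_left_inv m n (M : 'M[k]_(m, n)) : \rank M = n -> exists B, B *m M = 1%:M.
Proof. by move=> rM; apply/row_fullP; rewrite /row_full rM. Qed.

Lemma right_inv_rank m n (M : 'M[k]_(m, n)) B : M *m B = 1%:M -> \rank M = m.
Proof. by move=> e; apply/eqP; apply/row_freeP; exists B. Qed.

Lemma left_inv_rank m n (M : 'M[k]_(m, n)) B : B *m M = 1%:M -> \rank M = n.
Proof. by move=> e; apply/eqP; apply/row_fullP; exists B. Qed.

Lemma row_transport m n (U V : 'M[k]_(m, n)) : \rank U = m -> \rank V = m ->
  exists2 g : 'M_n, g \in unitmx & U *m g = V.
Proof.
move=> rU rV; have [B UB] := rank_right_inv rU.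
have [|g ug e] := @complete_unitmx _ m n U (B *m V).
  by rewrite mulmxA UB mul1mx rU rV.
by exists g; rewrite // -e mulmxA UB mul1mx.
Qed.

Lemma col_transport m n (U V : 'M[k]_(m, n)) : \rank U = n -> \rank V = n ->
  exists2 g : 'M_m, g \in unitmx & g *m U = V.
Proof.
move=> rU rV.
have [||g ug e] := @row_transport n m U^T V^T; rewrite ?mxrank_tr //.
exists g^T; first by rewrite unitmx_tr.
by apply: trmx_inj; rewrite trmx_mul trmxK.
Qed.

(** Both matrices have the hyperplane killed by [h] as column space, and matrices of full column
    rank with the same column space differ by an invertible column operation. *)
Lemma hyperplane_transport m j (h : 'rV[k]_j) (U V : 'M[k]_(j, m)) :
  j = m.+1 -> h != 0 -> h *m U = 0 -> h *m V = 0 -> \rank U = m -> \rank V = m ->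
  exists2 g : 'M_m, g \in unitmx & U *m g = V.
Proof.
move=> jm h0 hU hV rU rV.
have key (W : 'M[k]_(j, m)) : h *m W = 0 -> \rank W = m -> (W^T :=: kermx h^T)%MS.
  move=> hW rW; apply/eqmxP; rewrite -(geq_leqif (mxrank_leqif_eq _)).
    by rewrite mxrank_ker !mxrank_tr rW rank_rV h0 jm subn1.
  by rewrite sub_kermx -trmx_mul hW trmx0.
have /eqmxP/eqmxMunitP [P uP e] : (V^T :=: U^T)%MS.
  by apply: eqmx_trans (key V hV rV) _; apply: eqmx_sym; apply: key.
exists P^T; first by rewrite unitmx_tr.
by apply: trmx_inj; rewrite trmx_mul trmxK -e.
Qed.

Lemma det_neq0_rank n (M : 'M[k]_n) : \det M != 0 -> \rank M = n.
Proof. by move=> d; apply: mxrank_unit; rewrite unitmxE unitfE. Qed.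

Lemma unit_det n (M : 'M[k]_n) : M \in unitmx -> \det M != 0.
Proof. by rewrite unitmxE unitfE. Qed.

Lemma complete_col m j (A : 'M[k]_(m + j, j)) : \rank A = j ->
  exists G : 'M_(m + j, m), row_mx G A \in unitmx.
Proof.
move=> rA.
have r1 : \rank (col_mx 0 1%:M : 'M[k]_(m + j, j)) = j.
  by apply: (@left_inv_rank _ _ _ (row_mx 0 1%:M)); rewrite mul_row_col mul0mx add0r mulmx1.
have [g ug gE] := col_transport r1 rA.
exists (g *m col_mx 1%:M 0).
suff -> : row_mx (g *m col_mx 1%:M 0) A = g by [].
rewrite -gE -mul_mx_row -[RHS]mulmx1; congr (_ *m _).
by rewrite -block_mxEh -scalar_mx_block.
Qed.

Lemma nonzero_right_inv n (h : 'rV[k]_n) : h != 0 -> exists v : 'cV_n, h *m v = 1%:M.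
Proof. by move=> h0; apply: rank_right_inv; rewrite rank_rV h0. Qed.

Lemma nonzero_left_inv n (v : 'cV[k]_n) : v != 0 -> exists h : 'rV_n, h *m v = 1%:M.
Proof.
move=> v0; have [|w e] := @nonzero_right_inv _ v^T.
  by apply: contra_neq v0 => e; apply: trmx_inj; rewrite e trmx0.
by exists w^T; apply: trmx_inj; rewrite trmx_mul trmxK e trmx1.
Qed.

(** [P = c r] satisfies P^2 = (d - 1) P, so the inverse is 1 - P / d. *)
Lemma unit_one_plus_rank1 n (c : 'cV[k]_n) (r : 'rV[k]_n) :
  (1 + (r *m c) 0 0) != 0 -> 1%:M + c *m r \in unitmx.
Proof.
move=> d0; set d := (1 + (r *m c) 0 0); set P := c *m r.
have PP : P *m P = (d - 1) *: P.
  rewrite /P mulmxA -(mulmxA c r c) [r *m c]mx11_scalar mul_mx_scalar -scalemxAl.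
  by rewrite /d addrC addKr.
suff e : (1%:M + P) *m (1%:M - d^-1 *: P) = 1%:M by case: (mulmx1_unit e).
rewrite mulmxDl mul1mx mulmxBr mulmx1 -scalemxAr PP scalerA.
rewrite -[X in _ + (X - _)]scale1r -scalerBl mulrBr mulVf // mulr1.
by rewrite subKr subrK.
Qed.

(** The rows are matched first, by [Q1]. The transvection [S] then moves [Q1 a] to [a'], and it
    fixes both rows because [h'] and [b'] kill [a' - Q1 a]. *)
Lemma frame_transport n (h h' b b' : 'rV[k]_n) (a a' : 'cV[k]_n) :
  h *m a = 1%:M -> h' *m a' = 1%:M -> b *m a = 0 -> b' *m a' = 0 ->
  b != 0 -> b' != 0 ->
  exists2 Q, Q \in unitmx & [/\ h' *m Q = h, b' *m Q = b & Q *m a = a'].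
Proof.
move=> ha ha' ba ba' b0 b'0.
have rk (h1 b1 : 'rV[k]_n) (a1 : 'cV_n) : h1 *m a1 = 1%:M -> b1 *m a1 = 0 ->
    b1 != 0 -> \rank (col_mx h1 b1) = 2%N.
  move=> e1 e2 b1n0; have [c cE] := nonzero_right_inv b1n0.
  apply: (@right_inv_rank _ _ _ (row_mx a1 (c - a1 *m (h1 *m c)))).
  rewrite mul_col_row !mulmxBr !mulmxA e1 e2 cE mul1mx !mul0mx subr0 subrr.
  by rewrite [in RHS](scalar_mx_block 1 1 1).
have [Q1 uQ1] := row_transport (rk _ _ _ ha' ba' b'0) (rk _ _ _ ha ba b0).
rewrite mul_col_mx => /eq_col_mx [e1 e2].
pose a1 := Q1 *m a.
have ha1 : h' *m a1 = 1%:M by rewrite mulmxA e1.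
have ba1 : b' *m a1 = 0 by rewrite mulmxA e2.
pose S := 1%:M + (a' - a1) *m h'.
have h'd : h' *m (a' - a1) = 0 by rewrite mulmxBr ha1 ha' subrr.
have b'd : b' *m (a' - a1) = 0 by rewrite mulmxBr ba1 ba' subrr.
have uS : S \in unitmx.
  by apply: unit_one_plus_rank1; rewrite h'd mxE addr0 oner_neq0.
exists (S *m Q1); first by rewrite unitmx_mul uS.
split.
- by rewrite mulmxA mulmxDr mulmx1 mulmxA h'd mul0mx addr0.
- by rewrite mulmxA mulmxDr mulmx1 mulmxA b'd mul0mx addr0.
- by rewrite -mulmxA mulmxDl mul1mx -mulmxA ha1 mulmx1 addrC subrK.
Qed.

End Linear.

(** * Conjugation-stable closed cones *)

Section Cones.
Variable k : closedFieldType.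

Record stable_cone N (C : set 'M[k]_N) : Prop := StableCone {
  sc_conj : forall g x, g \in unitmx -> C x -> C (mxconj g x);
  sc_scale : forall c x, c != 0 -> C x -> C (c *: x);
  sc_closed : zclosure C `<=` C }.

Definition cone_of N (O : set 'M[k]_N) : set 'M[k]_N :=
  [set x | exists c y, [/\ c != 0, O y & x = c *: y]].

Definition closed_cone N (O : set 'M[k]_N) := zclosure (cone_of O).

Lemma mxfun_mxconj N T (P : (T -> k) -> Prop) (g : 'M[k]_N) (F : T -> 'M[k]_N) :
  funalg P -> mxfun P F -> mxfun P (fun t => mxconj g (F t)).
Proof.
move=> PA PF; apply: mxfun_mul => //; last exact: mxfun_const.
by apply: mxfun_mul => //; apply: mxfun_const.
Qed.

Lemma closed_cone_stable N (e : 'M[k]_N) : (0 < N)%N ->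
  stable_cone (closed_cone (orbit_of (SL N) e)).
Proof.
move=> N0; split=> [g x ug|c x c0|].
- apply: zclosure_map => [|{}x [c [y [c0 Oy ->]]]].
    by apply: mxfun_mxconj; [exact: polyfun_funalg|exact: mxfun_id].
  apply: sub_zclosure; exists c, (mxconj g y); split=> //; last by rewrite mxconjZ.
  exact: orbit_conj.
- apply: zclosure_map => [|{}x [a [y [a0 Oy ->]]]].
    apply: (@mxfun_scale _ _ _ (polyfun_funalg k N N) _ _ (fun=> c) id).
      exact: (fa_const (polyfun_funalg k N N)).
    exact: mxfun_id.
  apply: sub_zclosure; exists (c * a), y; split=> //; last by rewrite scalerA.
  by rewrite mulf_neq0.
- exact: zclosureS.
Qed.

Lemma sub_closed_cone N (O : set 'M[k]_N) : O `<=` closed_cone O.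
Proof.
move=> x Ox; apply: sub_zclosure; exists 1, x; split=> //; last by rewrite scale1r.
exact: oner_neq0.
Qed.

Section Stable.
Variables (N : nat) (C : set 'M[k]_N).
Hypothesis SC : stable_cone C.

Lemma sc_eqr (g x y : 'M[k]_N) : g \in unitmx -> g *m x = y *m g -> C x -> C y.
Proof. by move=> ug e Cx; rewrite -(mxconj_eq ug e); apply: (sc_conj SC). Qed.

Lemma sc_eql (g x y : 'M[k]_N) : g \in unitmx -> g *m y = x *m g -> C x -> C y.
Proof.
move=> ug e Cx; rewrite -(mxconjV_eq ug e); apply: (sc_conj SC) => //.
by rewrite unitmx_inv.
Qed.

Lemma sc_curve (F : k -> 'M[k]_N) h : mxfun (@upoly k) F -> upoly h ->
  (exists t, h t != 0) -> (forall t, h t != 0 -> C (F t)) -> forall t, C (F t).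
Proof.
move=> PF Ph exh hF t; apply: (sc_closed SC).
apply: (zclosure_curve PF Ph exh) => s hs.
by apply: sub_zclosure; apply: hF.
Qed.

End Stable.

Lemma nilp_last n (P : nat -> 'M[k]_n -> Prop) (D : 'M[k]_n) m :
  (exists d, forall i, (d <= i)%N -> ~ P i D) -> P m D ->
  exists2 p, (m <= p)%N & P p D /\ ~ P p.+1 D.
Proof.
case=> d dP Pm.
have : exists q, ~ P (m + q)%N D by exists d; apply: dP; rewrite leq_addl.
move=> exq; have exb : exists q, ~~ `[< P (m + q)%N D >].
  by case: exq => q nq; exists q; apply/asboolP.
case: (ex_minnP exb) => [[|q]] /asboolP nq minq; first by rewrite addn0 in nq.
exists (m + q)%N; first by rewrite leq_addr.
split; last by rewrite -addnS.
apply: contrapT => nP; have /minq : ~~ `[< P (m + q)%N D >] by apply/asboolP.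
by rewrite ltnn.
Qed.

Lemma nilp_pow n (D : 'M[k]_n) : nilpotent_mx D ->
  exists d, forall i, (d <= i)%N -> D ^+ i = 0.
Proof.
by case=> d Dd; exists d => i /subnK <-; rewrite exprD Dd mulr0.
Qed.

(** Let i be the last exponent with h D^i nonzero and w a vector on which this row takes the value
    1. A multiple of D^i w corrects D^(i-1) w into the kernel of [h], and h D^(i+1) = 0 keeps the
    value of [h D] on it equal to 1. *)
Lemma nilp_row_pair n (D : 'M[k]_n) (h : 'rV_n) : nilpotent_mx D -> h *m D != 0 ->
  exists v : 'cV_n, h *m v = 0 /\ h *m D *m v != 0.
Proof.
move=> /nilp_pow [d Dd] hD.
have [||p p1 [hp /contrapT hp1]] :=
    @nilp_last _ (fun p D => h *m D ^+ p <> 0) D 1.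
- by exists d => i di; rewrite Dd // mulmx0.
- by rewrite expr1; apply/eqP.
case: p p1 hp hp1 => // p _ /eqP hp hp1.
have [w hw] := nonzero_right_inv hp.
exists (D ^+ p *m w - (h *m D ^+ p *m w) 0 0 *: (D ^+ p.+1 *m w)).
have DD i : D *m D ^+ i = D ^+ i.+1 by rewrite exprS.
split.
  by rewrite mulmxBr -scalemxAr !mulmxA hw scalemx1 -mx11_scalar subrr.
rewrite mulmxBr -scalemxAr !mulmxA -!(mulmxA h D) !DD hp1 hw mul0mx scaler0 subr0.
exact: oner_neq0.
Qed.

Lemma rank1_le n (c : 'cV[k]_n) (r : 'rV[k]_n) : (\rank (c *m r) <= 1)%N.
Proof. by apply: leq_trans (mxrankM_maxr _ _) _; apply: rank_leq_row. Qed.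

Lemma rank_sq n (e : 'M[k]_n) :
  (\rank (e *m e) + \rank (e :&: kermx e)%MS = \rank e)%N.
Proof. exact: mxrank_mul_ker. Qed.

(** If [u] lies in the row space of [e] and [u e = 0], then e (1 - psi u) with u psi = 1 is a limit
    of conjugates of [e] and has rank one less. Its square vanishes only if e^2 is a multiple phi u,
    which governs the choice of [u]. *)
Lemma rank_drop N (C : set 'M[k]_N) (e : 'M[k]_N) : stable_cone C -> C e ->
  nilpotent_mx e -> e *m e != 0 -> (2 < \rank e)%N ->
  exists e', [/\ C e', nilpotent_mx e', e' *m e' != 0 & ((\rank e').+1 = \rank e)%N].
Proof.
move=> SC Ce nilpe e2 re; have [d Dd] := nilp_pow nilpe.
have [u [u0 ue uk nphi]] : exists u : 'rV_N,
    [/\ u != 0, (u <= e)%MS, u *m e = 0 & forall phi, e *m e <> phi *m u].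
  (* First candidate: a row of the last nonzero power of [e]. *)
  have [||p p1 [/eqP ep /contrapT ep1]] := @nilp_last _ (fun p D => D ^+ p <> 0) e 2.
  - by exists d => i di; rewrite Dd.
  - by rewrite expr2; apply/eqP.
  have /row_subPn [i] : ~~ (e ^+ p <= (0 : 'M_N))%MS by rewrite submx0.
  rewrite submx0; set u0 := row i _ => u00.
  have u0k : u0 *m e = 0 by rewrite -row_mul -[_ *m _]exprSr ep1 row0.
  have u0e : (u0 <= e)%MS.
    apply: (submx_trans (row_sub _ _)).
    by case: (p) p1 => // q _; rewrite exprSr submxMl.
  have [[phi ephi]|np] := pselect (exists phi, e *m e = phi *m u0); last first.
    by exists u0; split=> // phi E; apply: np; exists phi.
  (* The candidate fails only if e^2 = phi u0 has rank at most one. As [e] has rank above 2, the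
     rows in its image and kernel then form a space of dimension at least 2, and any of them not
     proportional to [u0] works. *)
  have r1 : (\rank (e *m e) <= 1)%N by rewrite ephi rank1_le.
  have : (1 < \rank (e :&: kermx e)%MS)%N.
    by rewrite -(leq_add2l 1); apply: leq_trans re _; rewrite -(rank_sq e) leq_add2r.
  move=> r2; have /row_subPn [i' nsub] : ~~ (e :&: kermx e <= u0)%MS.
    by apply: contraL r2 => /mxrankS le; rewrite -leqNgt (leq_trans le) ?rank_leq_row.
  exists (row i' (e :&: kermx e)%MS); set u := row _ _ in nsub *.
  have uek : (u <= e :&: kermx e)%MS by apply: row_sub.
  rewrite sub_capmx in uek; case/andP: uek => ue uk.
  split=> //; [|by apply/sub_kermxP|].
    by apply: contraNneq nsub => ->; rewrite sub0mx.
  move=> psi E; rewrite ephi in E e2.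
  have /row_subPn [l] : ~~ (phi *m u0 <= (0 : 'M_N))%MS by rewrite submx0.
  rewrite submx0 => nz; case/negP: nsub.
  have E1 : (psi l 0) *: u = (phi l 0) *: u0.
    have := congr1 (row l) E; rewrite !row_mul.
    have rc (f : 'cV[k]_N) : row l f = (f l 0)%:M.
      by rewrite [LHS]mx11_scalar mxE.
    by rewrite !rc !mul_scalar_mx.
  have psi0 : psi l 0 != 0.
    apply: contraNneq nz => psi0; rewrite row_mul [row l phi]mx11_scalar mxE mul_scalar_mx.
    by rewrite -E1 psi0 scale0r.
  by rewrite -[u](scalerK psi0) E1 !scalemx_sub.
have [psi upsi] := nonzero_right_inv u0.
(* [G s] multiplies [psi] by s and fixes the kernel of [u]. Since [u e = 0], G^-1 e G equals e G,
   which remains polynomial down to s = 0. *)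
pose G (s : k) := 1%:M + (s - 1) *: (psi *m u).
pose y (s : k) := e + (s - 1) *: (e *m psi *m u).
have Cy s : s != 0 -> C (y s).
  move=> s0; apply: (@sc_eql _ C SC (G s) e) => //.
    rewrite /G scalemxAl unit_one_plus_rank1 //.
    by rewrite -scalemxAr upsi !mxE mulr1 addrC subrK.
  have uy : u *m y s = 0 by rewrite mulmxDr uk add0r -scalemxAr !mulmxA uk !mul0mx scaler0.
  rewrite mulmxDl mul1mx -scalemxAl -mulmxA uy mulmx0 scaler0 addr0.
  by rewrite mulmxDr mulmx1 -scalemxAr mulmxA.
pose e' := e *m (1%:M - psi *m u).
have e'E : e' = y 0.
  by rewrite /e' /y sub0r scaleN1r mulmxBr mulmx1 mulmxA.
have e'e' : forall i, e' ^+ i.+1 = e ^+ i.+1 *m (1%:M - psi *m u).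
  elim=> [|i IH]; first by rewrite !expr1.
  have -> : e ^+ i.+2 = e ^+ i.+1 *m e by rewrite exprSr.
  have -> : e' ^+ i.+2 = e' ^+ i.+1 *m e' by rewrite exprSr.
  rewrite IH /e' !mulmxA; congr (_ *m _).
  by rewrite -[LHS]mulmxA mulmxBl mul1mx -mulmxA uk mulmx0 subr0.
exists e'; split.
- rewrite e'E; apply: (sc_curve SC (h := id)) => //.
  + apply: (mxfun_add (upoly_funalg k)); first exact: (mxfun_const (upoly_funalg k)).
    apply: (mxfun_scale (upoly_funalg k)); last exact: (mxfun_const (upoly_funalg k)).
    by apply: (fa_sub (upoly_funalg k)); [exact: upoly_id|exact: (fa_const (upoly_funalg k))].
  + exact: upoly_id.
  + by exists 1; apply: oner_neq0.
- by exists d.+1; rewrite e'e' Dd ?mul0mx.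
- rewrite -[_ *m _]/(e' ^+ 2) e'e' expr2 mulmxBr mulmx1 mulmxA subr_eq0.
  by apply/eqP.
- have kE : (kermx (1%:M - psi *m u) :=: u)%MS.
    apply/eqmxP/andP; split; last first.
      by apply/sub_kermxP; rewrite mulmxBr mulmx1 mulmxA upsi mul1mx subrr.
    apply/rV_subP => w /sub_kermxP; rewrite mulmxBr mulmx1 mulmxA => /eqP.
    by rewrite subr_eq0 => /eqP ->; rewrite submxMl.
  rewrite -(mxrank_mul_ker e (1%:M - psi *m u)) -/e' -addn1; congr (_ + _)%N.
  have -> : (e :&: kermx (1%:M - psi *m u) :=: u)%MS.
    apply/eqmxP/andP; split; first by apply: submx_trans (capmxSr _ _) _; rewrite kE.
    by rewrite sub_capmx ue kE submx_refl.
  by rewrite rank_rV u0.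
Qed.

Lemma rank_drop_to N (C : set 'M[k]_N) (e : 'M[k]_N) j : stable_cone C -> C e ->
  nilpotent_mx e -> e *m e != 0 -> (1 < j <= \rank e)%N ->
  exists e', [/\ C e', nilpotent_mx e', e' *m e' != 0 & \rank e' = j].
Proof.
move=> SC; move: {2}(\rank e - j)%N (erefl (\rank e - j)%N) => d.
elim: d e => [|d IH] e dE Ce ne e2 /andP[j1 je].
  by exists e; split=> //; apply/eqP; rewrite eqn_leq je -subn_eq0 dE.
have jle : (j < \rank e)%N by rewrite -subn_gt0 dE.
have [e' [Ce' ne' e'2 re']] := rank_drop SC Ce ne e2 (leq_ltn_trans j1 jle).
by apply: (IH e') => //; [rewrite -re' subSn in dE; [case: dE|rewrite -ltnS re'] |rewrite j1 -ltnS re'].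
Qed.

End Cones.

Lemma idempotent_pair_mul (k : fieldType) n (P Q : 'M[k]_n) x y z x' y' z' :
  P *m P = P -> Q *m Q = Q -> P *m Q = 0 -> Q *m P = 0 ->
  (x%:M + y *: P + z *: Q) *m (x'%:M + y' *: P + z' *: Q) =
  (x * x')%:M + (x * y' + y * x' + y * y') *: P + (x * z' + z * x' + z * z') *: Q.
Proof.
move=> PP QQ PQ QP.
rewrite !mulmxDl !mulmxDr -!scalemxAl -!scalemxAr PP QQ PQ QP !scaler0 !addr0.
rewrite !mul_scalar_mx !mul_mx_scalar scale_scalar_mx !scalerA.
apply/matrixP=> i j; rewrite !mxE.
by move: (P i j) (Q i j) (x * x' *+ (i == j)) => p q d; ring.
Qed.

(** * Degeneration of an orbit with nonzero square to block matrices with a rank-one square-zero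
    corner *)

Section Degeneration.
Variable k : closedFieldType.
Variables m j : nat.
Variable C : set 'M[k]_(m + j).
Hypothesis SC : stable_cone C.

(** The shape of a product [A R] in a basis (G | A): then X = R G and D = R A. *)
Definition lowblk (X : 'M[k]_(j, m)) (D : 'M[k]_j) : 'M[k]_(m + j) := block_mx 0 0 X D.

Lemma lowblk_conj (P : 'M_m) (Q : 'M_j) X D X' D' : P \in unitmx -> Q \in unitmx ->
  Q *m X' = X *m P -> Q *m D' = D *m Q -> C (lowblk X D) -> C (lowblk X' D').
Proof.
move=> uP uQ eX eD; apply: (sc_eql SC (g := block_mx P 0 0 Q)).
  by rewrite unitmxE det_ublock unitrM -!unitmxE uP.
by rewrite /lowblk !mulmx_block !mul0mx !mulmx0 !addr0 !add0r eX eD.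
Qed.

Lemma mxfun_lowblk X D : mxfun (@upoly k) X -> mxfun (@upoly k) D ->
  mxfun (@upoly k) (fun s : k => lowblk (X s) (D s)).
Proof.
move=> PX PD; have c0 m1 n1 : mxfun (@upoly k) (fun=> 0 : 'M_(m1, n1)).
  exact: mxfun_const (upoly_funalg k) _ _ _.
exact: mxfun_block.
Qed.

Lemma lowblkZ c X D : c *: lowblk X D = lowblk (c *: X) (c *: D).
Proof. by rewrite /lowblk scale_block_mx !scaler0. Qed.

Lemma lowblk_of_factor (A : 'M_(m + j, j)) (R : 'M_(j, m + j)) G :
  row_mx G A \in unitmx -> C (A *m R) <-> C (lowblk (R *m G) (R *m A)).
Proof.
move=> uG; have e : row_mx G A *m lowblk (R *m G) (R *m A) = A *m R *m row_mx G A.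
  by rewrite mul_row_block !mulmx0 !add0r -mul_mx_row -mul_mx_row -mulmxA mul_mx_row.
by split; [apply: (sc_eql SC) e|apply: (sc_eqr SC) e].
Qed.

(** Each of the two conditions is the nonvanishing of a polynomial in [G] and can be met separately,
    hence both can be met at once. *)
Lemma generic_complement (A : 'M[k]_(m + j, j)) (R : 'M_(j, m + j)) :
  \rank A = j -> \rank R = j -> exists G : 'M_(m + j, m),
    row_mx G A \in unitmx /\ \rank (R *m G) = minn m j.
Proof.
move=> rA rR; have [G0 uG0] := complete_col rA.
have [B RB] := rank_right_inv rR.
pose f1 (G : 'M[k]_(m + j, m)) := \det (row_mx G A).
have Pf1 : polyfun f1.
  apply: fa_det; first exact: polyfun_funalg.
  apply: mxfun_row; first exact: mxfun_id.
  exact: mxfun_const (polyfun_funalg _ _ _) _ _ _.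
have exf1 : exists G, f1 G != 0 by exists G0; apply: unit_det.
pose r := minn m j.
pose f2 (G : 'M[k]_(m + j, m)) := \det ((pid_mx r : 'M_(r, j)) *m (R *m G) *m (pid_mx r : 'M_(m, r))).
have Pf2 : polyfun f2.
  have PA := polyfun_funalg k (m + j) m.
  apply: fa_det; first exact: PA.
  apply: (mxfun_mul PA); last exact: (mxfun_const PA).
  apply: (mxfun_mul PA); first exact: (mxfun_const PA).
  by apply: (mxfun_mul PA); [exact: (mxfun_const PA)|exact: mxfun_id].
have exf2 : exists G, f2 G != 0.
  exists (B *m (pid_mx r : 'M_(j, m))).
  rewrite /f2 (mulmxA R) RB mul1mx !pid_mx_id ?geq_minl ?geq_minr // pid_mx_1 det1.
  exact: oner_neq0.
have [G [G1 G2]] := polyfun_fundom Pf1 Pf2 exf1 exf2.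
exists G; split; first by rewrite unitmxE unitfE.
apply/eqP; rewrite eqn_leq; apply/andP; split.
  by rewrite leq_min rank_leq_col rank_leq_row.
rewrite -[leqLHS](det_neq0_rank G2).
by apply: leq_trans (mxrankM_maxl _ _) (mxrankM_maxr _ _).
Qed.

Lemma normal_form (e : 'M[k]_(m + j)) : C e -> nilpotent_mx e -> e *m e != 0 ->
  \rank e = j -> exists X D, [/\ C (lowblk X D), \rank X = minn m j,
    nilpotent_mx D, D != 0 & \rank (row_mx X D) = j].
Proof.
move=> Ce [d ed] e2 re; have [A [R [eE rA rR]]] := rank_factor re.
have [G [uG rG]] := generic_complement rA rR.
exists (R *m G), (R *m A); split=> //.
- by apply/(lowblk_of_factor R uG); rewrite -eE.
- exists d; have [A' A'A] := rank_left_inv rA; have [R' RR'] := rank_right_inv rR.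
  have pw i : e ^+ i.+1 = A *m (R *m A) ^+ i *m R.
    elim: i => [|i IH]; first by rewrite expr1 expr0 mulmx1.
    rewrite exprSr IH [in RHS]exprSr -[_ * e]/(_ *m e) -[_ * (R *m A)]/(_ *m _).
    by rewrite eE !mulmxA.
  have : A' *m (A *m (R *m A) ^+ d *m R) *m R' = 0.
    by rewrite -pw exprSr ed mul0r mulmx0 mul0mx.
  by rewrite !mulmxA A'A mul1mx -mulmxA RR' mulmx1.
- apply: contraNneq e2 => RA0.
  by rewrite eE mulmxA -(mulmxA A R) RA0 mulmx0 mul0mx.
- by rewrite -mul_mx_row mxrankMfree // row_free_unit.
Qed.

Hypothesis j2 : (1 < j)%N.
Hypothesis jm : (j <= m.+1)%N.

(** For j <= m the rank alone determines [X] up to column operations. For j = m + 1 the left kernel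
    of [X] is a line that column operations cannot move, and [h] records it. *)
Definition generic_pair (X : 'M[k]_(j, m)) (h : 'rV[k]_j) :=
  \rank X = minn m j /\ (m.+1 = j -> h *m X = 0).

Lemma generic_transport X Y h : h != 0 -> generic_pair X h -> generic_pair Y h ->
  exists2 P : 'M_m, P \in unitmx & X *m P = Y.
Proof.
move=> h0 [rX hX] [rY hY].
have [jm'|mj] := leqP j m.
  by apply: row_transport; rewrite ?rX ?rY; apply/minn_idPr.
have {}mj : m.+1 = j by apply/eqP; rewrite eqn_leq jm mj.
have mm : minn m j = m by apply/minn_idPl; rewrite -mj.
by rewrite mm in rX rY; apply: (hyperplane_transport (h := h)) => //; [exact: hX|exact: hY].
Qed.

(** A one-parameter group adapted to vectors [a], [v] with [h v = 0] and [h D v] nonzero contracts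
    [D], after rescaling, to its component from [v] to [a]. Since the group fixes the row [h],
    column operations can restore [X] at every stage. *)
Lemma rank1_degeneration (e : 'M[k]_(m + j)) : C e -> nilpotent_mx e ->
  e *m e != 0 -> \rank e = j -> exists X (h b : 'rV[k]_j) (a : 'cV[k]_j),
  [/\ C (lowblk X (a *m b)), generic_pair X h, h *m a = 1%:M, b *m a = 0 & b != 0].
Proof.
move=> Ce ne e2 re; have [X [D [CXD rX nD D0 rXD]]] := normal_form Ce ne e2 re.
have [h [hD hX]] : exists h : 'rV_j, h *m D != 0 /\ (m.+1 = j -> h *m X = 0).
  have [jm'|mj] := leqP j m.
    have /row_subPn [i] : ~~ (D <= (0 : 'M_j))%MS by rewrite submx0.
    rewrite submx0 rowE => hD; exists (delta_mx 0 i); split=> // mj.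
    by rewrite -mj ltnn in jm'.
  (* For j = m + 1 the row must come from the left kernel of [X]; [h D] is then nonzero because (X |
     D) has full row rank. *)
  have /row_subPn [i] : ~~ (kermx X <= (0 : 'M_j))%MS.
    rewrite submx0 -mxrank_eq0 mxrank_ker subn_eq0 -ltnNge rX.
    by rewrite (leq_ltn_trans (geq_minl _ _)).
  rewrite submx0; set h := row i _ => h0.
  have hX : h *m X = 0 by rewrite -row_mul mulmx_ker row0.
  exists h; split=> //; apply: contraNneq h0 => hD.
  have [B XDB] := rank_right_inv rXD.
  by rewrite -[h]mulmx1 -XDB mulmxA mul_mx_row hX hD row_mx0 mul0mx.
have h0 : h != 0 by apply: contraNneq hD => ->; rewrite mul0mx.
have [v [hv hDv]] := nilp_row_pair nD hD.
have hDv0 : (h *m D *m v) 0 0 != 0.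
  by apply: contraNneq hDv => e0; rewrite [_ *m v]mx11_scalar e0 raddf0.
pose c := (h *m D *m v) 0 0.
have hDvE : h *m D *m v = c%:M by rewrite [LHS]mx11_scalar.
pose a := c^-1 *: (D *m v).
have ha : h *m a = 1%:M by rewrite -scalemxAr mulmxA hDvE scale_scalar_mx mulVf.
have v0 : v != 0 by apply: contraNneq hDv => ->; rewrite mulmx0.
have [g gv] := nonzero_left_inv v0.
pose b := g - (g *m a) *m h.
have bv : b *m v = 1%:M by rewrite mulmxBl -(mulmxA _ h v) hv mulmx0 subr0.
have ba : b *m a = 0 by rewrite mulmxBl -(mulmxA _ h a) ha mulmx1 subrr.
have b0 : b != 0.
  by apply: contraPneq bv => ->; rewrite mul0mx => /eqP; rewrite eq_sym oner_eq0.
clearbody b a.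
(* [E s] fixes [a], multiplies [v] by s^2 and the common kernel of [h] and [b] by s; [F s] is s^2
   times its inverse. At s = 0 they become a h and v b, so that E D F becomes a (h D v) b. *)
pose E (s : k) : 'M_j := s%:M + (1 - s) *: (a *m h) + (s ^+ 2 - s) *: (v *m b).
pose F (s : k) : 'M_j := s%:M + (s ^+ 2 - s) *: (a *m h) + (1 - s) *: (v *m b).
have FE (s : k) : F s *m E s = (s ^+ 2)%:M.
  have aa : a *m h *m (a *m h) = a *m h by rewrite mulmxA -(mulmxA a) ha mulmx1.
  have vv : v *m b *m (v *m b) = v *m b by rewrite mulmxA -(mulmxA v) bv mulmx1.
  have av : a *m h *m (v *m b) = 0 by rewrite mulmxA -(mulmxA a) hv mulmx0 mul0mx.
  have va : v *m b *m (a *m h) = 0 by rewrite mulmxA -(mulmxA v) ba mulmx0 mul0mx.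
  rewrite /F /E (idempotent_pair_mul _ _ _ _ _ _ aa vv av va).
  have -> : s * (1 - s) + (s ^+ 2 - s) * s + (s ^+ 2 - s) * (1 - s) = 0 by ring.
  have -> : s * (s ^+ 2 - s) + (1 - s) * s + (1 - s) * (s ^+ 2 - s) = 0 by ring.
  by rewrite !scale0r !addr0 expr2.
have hE (s : k) : h *m E s = h.
  rewrite /E !mulmxDr -!scalemxAr (mulmxA h a) (mulmxA h v) ha hv mul1mx mul0mx scaler0 addr0.
  by rewrite mul_mx_scalar -scalerDl addrC subrK scale1r.
have uE (s : k) : s != 0 -> F s \in unitmx /\ E s \in unitmx.
  move=> s0; suff : F s *m E s \in unitmx by rewrite unitmx_mul => /andP.
  by rewrite FE unitmxE det_scalar unitfE expf_neq0 // expf_neq0.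
have step (s : k) : s != 0 -> C (lowblk X (E s *m D *m F s)).
  move=> s0; have [uF uEs] := uE s s0.
  have s20 : s ^+ 2 != 0 by rewrite expf_neq0.
  have gE : generic_pair (E s *m X) h.
    split; last by move=> mj; rewrite mulmxA hE hX.
    by rewrite -rX eqmxMfull // row_full_unit.
  have gX : generic_pair X h by [].
  have [P uP EXP] := generic_transport h0 gE gX.
  rewrite -[lowblk _ _]scale1r -(mulfV s20) -scalerA; apply: (sc_scale SC) => //.
  rewrite lowblkZ; apply: (lowblk_conj uP uF _ _ CXD).
    rewrite -scalemxAr -{1}EXP !mulmxA FE mul_scalar_mx -scalemxAl scalerA mulVf //.
    by rewrite scale1r.
  rewrite -scalemxAr !mulmxA FE mul_scalar_mx -!scalemxAl scalerA mulVf //.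
  by rewrite scale1r.
exists X, h, (c *: b), a; split=> //.
- have -> : a *m (c *: b) = E 0 *m D *m F 0.
    rewrite /E /F !expr0n !subr0 !scale0r !addr0 !scale1r raddf0 !add0r.
    by rewrite mulmxA -(mulmxA a h D) -(mulmxA a _ v) hDvE mul_mx_scalar -scalemxAr -scalemxAl.
  apply: (@sc_curve _ _ C SC (fun s => lowblk X (E s *m D *m F s)) id) => //.
  + have U := upoly_funalg k; have uid := upoly_id k.
    apply: mxfun_lowblk; first exact: (mxfun_const U).
    have q0 : upoly (fun s : k => 1 - s) by apply: (fa_sub U) => //; apply: (fa_const U).
    have q1 : upoly (fun s : k => s ^+ 2 - s) by apply: (fa_sub U) => //; apply: (fa_exp U).
    apply: (mxfun_mul U); first apply: (mxfun_mul U); last 1 first.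
    * apply: (mxfun_add U); first apply: (mxfun_add U).
      - exact: (mxfun_scalar U).
      - by apply: (mxfun_scale U) => //; exact: (mxfun_const U).
      - by apply: (mxfun_scale U) => //; exact: (mxfun_const U).
    * apply: (mxfun_add U); first apply: (mxfun_add U).
      - exact: (mxfun_scalar U).
      - by apply: (mxfun_scale U) => //; exact: (mxfun_const U).
      - by apply: (mxfun_scale U) => //; exact: (mxfun_const U).
    * exact: (mxfun_const U).
  + exact: upoly_id.
  + by exists 1; apply: oner_neq0.
- by rewrite -scalemxAl ba scaler0.
- by rewrite scaler_eq0 negb_or hDv0.
Qed.

Variable e : 'M[k]_(m + j).
Hypotheses (Ce : C e) (nilpe : nilpotent_mx e) (e2 : e *m e != 0) (rank_e : (j <= \rank e)%N).

(** All generic data are equivalent: [frame_transport] matches the vectors, and then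
    [generic_transport] matches [Y] by column operations. *)
Lemma lowblk_generic Y (h b : 'rV[k]_j) (a : 'cV[k]_j) : generic_pair Y h ->
  h *m a = 1%:M -> b *m a = 0 -> b != 0 -> C (lowblk Y (a *m b)).
Proof.
move=> gY ha ba b0.
have [|e' [Ce' ne' e'2 re']] := rank_drop_to SC Ce nilpe e2 (j := j); first by rewrite j2.
have [X [h1 [b1 [a1 [CX gX ha1 ba1 b10]]]]] := rank1_degeneration Ce' ne' e'2 re'.
have [Q uQ [hQ bQ Qa]] := frame_transport ha1 ha ba1 ba b10 b0.
have uQ' : invmx Q \in unitmx by rewrite unitmx_inv.
have h1Q : h1 *m invmx Q = h by rewrite -hQ mulmxK.
have h10 : h1 != 0.
  by apply: contraPneq ha1 => ->; rewrite mul0mx => /eqP; rewrite eq_sym oner_eq0.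
have gQY : generic_pair (invmx Q *m Y) h1.
  split; last by move=> mj; rewrite mulmxA h1Q gY.2.
  by rewrite eqmxMfull ?row_full_unit // gY.1.
have [P uP XP] := generic_transport h10 gX gQY.
apply: (lowblk_conj uP uQ' _ _ CX) => //.
by rewrite mulmxA -Qa mulKmx // -bQ -!mulmxA mulmxV // mulmx1.
Qed.

(** Genericity is removed along a line from (Y, a) to a generic (Y1, a1) with the same [b]; the
    relation [b a = 0] is linear in [a] and persists. *)
Lemma lowblk_rank1 Y (b : 'rV[k]_j) (a : 'cV[k]_j) : b *m a = 0 ->
  C (lowblk Y (a *m b)).
Proof.
wlog b0 : a b / b != 0 => [H|].
  have [->|b0 ba] := eqVneq b 0; last exact: H.
  move=> _; rewrite mulmx0 -(mul0mx _ (const_mx 1 : 'rV[k]_j)).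
  apply: H; last by rewrite mulmx0.
  apply/eqP => /rowP /(_ (Ordinal (ltnW j2))); rewrite !mxE => /eqP.
  by rewrite oner_eq0.
move=> ba.
have j0 : (0 < j)%N by apply: ltnW.
have jlast : (j.-1 < j)%N by rewrite prednK.
pose i0 := Ordinal j0; pose i1 := Ordinal jlast.
have i01 : (i1 == i0) = false.
  by apply: negbTE; rewrite -val_eqE /= -lt0n -ltnS prednK.
have [||W uW bW] := @row_transport _ 1 j b (delta_mx 0 i0).
- by rewrite rank_rV b0.
- by rewrite mxrank_delta.
pose r := minn m j.
(* In coordinates where [b] is the first coordinate form, [a1] is the last basis vector and the
   columns of [Y1] are the first min(m, j) basis vectors, padded by zeros. *)
pose Y1 : 'M_(j, m) := W *m pid_mx r.
pose a1 : 'cV_j := W *m delta_mx i1 0.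
pose h1 : 'rV_j := delta_mx 0 i1 *m invmx W.
have ba1 : b *m a1 = 0 by rewrite mulmxA bW mul_delta_mx_0 // eq_sym i01.
have ha1 : h1 *m a1 = 1%:M.
  rewrite /h1 -mulmxA mulKmx // mul_delta_mx.
  by apply/matrixP => x y; rewrite !ord1 !mxE.
pose Ys (s : k) := Y + s *: (Y1 - Y).
pose as_ (s : k) := a + s *: (a1 - a).
have bas s : b *m as_ s = 0.
  by rewrite /as_ mulmxDr -scalemxAr mulmxBr ba ba1 subrr scaler0 addr0.
have PY : mxfun (@upoly k) Ys by exact: mxfun_line.
have Pa : mxfun (@upoly k) as_ by exact: mxfun_line.
have U := upoly_funalg k.
have Ys1 : Ys 1 = Y1 by rewrite /Ys scale1r addrC subrK.
have as1 : as_ 1 = a1 by rewrite /as_ scale1r addrC subrK.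
pose d1 s := \det ((pid_mx r : 'M_(r, j)) *m invmx W *m Ys s *m (pid_mx r : 'M_(m, r))).
have Pd1 : upoly d1.
  apply: (fa_det U); apply: (mxfun_mul U); last exact: (mxfun_const U).
  by apply: (mxfun_mul U) => //; exact: (mxfun_const U).
have d11 : d1 1 != 0.
  rewrite /d1 Ys1 /Y1 -!mulmxA (mulKmx uW) mulmxA.
  by rewrite !pid_mx_id ?geq_minl ?geq_minr // pid_mx_1 det1 oner_neq0.
have rY s : d1 s != 0 -> \rank (Ys s) = r.
  move=> d1s; apply/eqP; rewrite eqn_leq; apply/andP; split.
    by rewrite leq_min rank_leq_col rank_leq_row.
  rewrite -[leqLHS](det_neq0_rank d1s).
  by apply: leq_trans (mxrankM_maxl _ _) (mxrankM_maxr _ _).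
have [d2 [Pd2 d21 hd2]] : exists d2, [/\ upoly d2, d2 1 != 0 & forall s, d2 s != 0 ->
    exists h, h *m as_ s = 1%:M /\ (m.+1 = j -> h *m Ys s = 0)].
  have [jm'|mj] := leqP j m.
    exists (fun s => (h1 *m as_ s) 0 0); split.
    - by apply: (mxfun_mul U) => //; exact: (mxfun_const U).
    - by rewrite as1 ha1 mxE oner_neq0.
    move=> s hs; exists (((h1 *m as_ s) 0 0)^-1 *: h1); split; last first.
      by move=> mj; rewrite -mj ltnn in jm'.
    by rewrite -scalemxAl {2}[h1 *m _]mx11_scalar scale_scalar_mx mulVf.
  have {}mj : m.+1 = j by apply/eqP; rewrite eqn_leq jm mj.
  have rm : r = m by apply/minn_idPl; rewrite -mj.
  pose Z : 'M[k]_(j, m + 1) := row_mx (pid_mx m) (delta_mx i1 0).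
  have ZZ : Z *m Z^T = 1%:M.
    rewrite tr_row_mx mul_row_col tr_pid_mx mul_pid_mx minnn minnn trmx_delta mul_delta_mx.
    apply/matrixP => x y; rewrite !mxE -!val_eqE /=.
    have jm1 : j.-1 = m by rewrite -mj.
    have xm : (x <= m)%N by rewrite -ltnS mj.
    rewrite jm1.
    have [xy|xy] := eqVneq (x : nat) y.
      rewrite -xy andbb; have [->|xnm] := eqVneq (x : nat) m; first by rewrite ltnn add0r.
      by rewrite ltn_neqAle xnm xm addr0.
    rewrite /= add0r; have [xm'|_] := eqVneq (x : nat) m => //=.
    by have [ym'|_] := eqVneq (y : nat) m => //; rewrite xm' ym' eqxx in xy.
  exists (fun s => \det (invmx W *m row_mx (Ys s) (as_ s) *m Z^T)); split.
  - apply: (fa_det U); apply: (mxfun_mul U); last exact: (mxfun_const U).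
    apply: (mxfun_mul U); first exact: (mxfun_const U).
    exact: (mxfun_row PY Pa).
  - rewrite Ys1 as1 /Y1 /a1 -mul_mx_row (mulKmx uW) rm -/Z ZZ det1.
    exact: oner_neq0.
  move=> s ds.
  (* Here [h] must also kill [Ys s]: it is the last row of a left inverse of the matrix (Ys s | as_
     s). *)
  have /rank_left_inv [B BE] : \rank (row_mx (Ys s) (as_ s)) = (m + 1)%N.
    apply/eqP; rewrite eqn_leq rank_leq_col /=.
    have jr : (m + 1)%N = \rank (invmx W *m row_mx (Ys s) (as_ s) *m Z^T).
      by rewrite (det_neq0_rank ds) addn1.
    rewrite [leqLHS]jr.
    by apply: leq_trans (mxrankM_maxl _ _) (mxrankM_maxr _ _).
  move: BE; rewrite -[B]vsubmxK mul_col_row [RHS](scalar_mx_block m 1).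
  by move=> /eq_block_mx [_ _ e3 e4]; exists (dsubmx B).
have hcurve : mxfun (@upoly k) (fun s => lowblk (Ys s) (as_ s *m b)).
  apply: mxfun_lowblk => //; apply: (mxfun_mul U) => //; exact: (mxfun_const U).
have := @sc_curve _ _ C SC _ (fun s => d1 s * d2 s) hcurve (fa_mul U Pd1 Pd2) _ _ 0.
rewrite /Ys /as_ !scale0r !addr0; apply.
  by exists 1; rewrite mulf_neq0.
move=> s; rewrite mulf_eq0 negb_or => /andP[/rY rYs /hd2 [h [has hYs]]].
by apply: (lowblk_generic (h := h) _ has (bas s) b0); split.
Qed.

Lemma factor_mem (A : 'M[k]_(m + j, j)) (R : 'M[k]_(j, m + j))
    (b : 'rV[k]_j) (a : 'cV[k]_j) :
  \rank A = j -> R *m A = a *m b -> b *m a = 0 -> C (A *m R).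
Proof.
move=> rA RA ba; have [G uG] := complete_col rA.
by apply/(lowblk_of_factor R uG); rewrite RA; apply: lowblk_rank1.
Qed.

End Degeneration.

(** * Irreducibility and the conical secant variety *)

Section Orbits.
Variable k : closedFieldType.

Section Irreducible.
Variables (N : nat) (e : 'M[k]_N).
Hypothesis N0 : (0 < N)%N.
Let O := orbit_of (SL N) e.

(** Along the orbit map polynomial functions pull back to the localisation of the polynomial ring at
    the determinant, which is a domain. *)
Lemma orbit_irreducible f h : polyfun f -> polyfun h ->
  (exists2 x, O x & f x != 0) -> (exists2 x, O x & h x != 0) ->
  exists x, [/\ O x, f x != 0 & h x != 0].
Proof.
move=> Pf Ph [_ [g1 /SL_unit u1 <-] f1] [_ [g2 /SL_unit u2 <-] h2].
have PA := polyfun_funalg k N N.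
have Pd : polyfun (fun g : 'M[k]_N => \det g) by apply: (fa_det PA); exact: mxfun_id.
have LA := loc_funalg PA Pd.
have Pc : mxfun (loc (@polyfun k N N) (fun g : 'M[k]_N => \det g)) (fun g => mxconj g e).
  apply: (mxfun_mul LA).
    apply: (mxfun_mul LA); last exact: (mxfun_const LA).
    by move=> i j; apply: loc_base; apply: mxfun_id.
  apply: (loc_invmx PA Pd) => //; first exact: (loc_inv PA).
  by move=> i j; apply: loc_base; apply: mxfun_id.
have [||g [dg fg hg]] := loc_nz PA Pd (@polyfun_fundom _ _ _)
   (polyfun_comp LA Pf Pc) (polyfun_comp LA Ph Pc).
- by exists g1; split=> //; apply: unit_det.
- by exists g2; split=> //; apply: unit_det.
exists (mxconj g e); split=> //; apply: mxconj_orbit => //.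
by rewrite unitmxE unitfE.
Qed.

(** A pair of group elements is coded as one N x 2N matrix, and the localisation is at the product
    of the two determinants. *)
Lemma orbit2_irreducible (f h : 'M[k]_(N, N + N) -> k) : polyfun f -> polyfun h ->
  (exists x y, [/\ O x, O y & f (row_mx x y) != 0]) ->
  (exists x y, [/\ O x, O y & h (row_mx x y) != 0]) ->
  exists x y, [/\ O x, O y, f (row_mx x y) != 0 & h (row_mx x y) != 0].
Proof.
move=> Pf Ph [_ [_ [[g1 /SL_unit u1 <-] [g2 /SL_unit u2 <-] f1]]].
move=> [_ [_ [[g3 /SL_unit u3 <-] [g4 /SL_unit u4 <-] h1]]].
have PA := polyfun_funalg k N (N + N).
pose d (g : 'M[k]_(N, N + N)) := \det (lsubmx g) * \det (rsubmx g).
have Pl : polyfun (fun g : 'M[k]_(N, N + N) => \det (lsubmx g)).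
  by apply: (fa_det PA); apply: mxfun_lsub; exact: mxfun_id.
have Pr : polyfun (fun g : 'M[k]_(N, N + N) => \det (rsubmx g)).
  by apply: (fa_det PA); apply: mxfun_rsub; exact: mxfun_id.
have Pd : polyfun d by apply: (fa_mul PA).
have LA := loc_funalg PA Pd.
have dP g : d g != 0 -> \det (lsubmx g) != 0 /\ \det (rsubmx g) != 0.
  by rewrite mulf_eq0 negb_or => /andP.
have LAl : loc (@polyfun k _ _) d (fun g => (\det (lsubmx g))^-1).
  apply: (@loc_ext _ _ _ _ (fun g => \det (rsubmx g) * (d g)^-1)).
    by move=> g /dP [dl dr]; rewrite /d invfM mulrCA divff // mulr1.
  by apply: (fa_mul LA); [apply: loc_base|apply: (loc_inv PA)].
have LAr : loc (@polyfun k _ _) d (fun g => (\det (rsubmx g))^-1).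
  apply: (@loc_ext _ _ _ _ (fun g => \det (lsubmx g) * (d g)^-1)).
    by move=> g /dP [dl dr]; rewrite /d invfM mulrA divff // mul1r.
  by apply: (fa_mul LA); [apply: loc_base|apply: (loc_inv PA)].
have Pc : mxfun (loc (@polyfun k _ _) d)
    (fun g => row_mx (mxconj (lsubmx g) e) (mxconj (rsubmx g) e)).
  apply: mxfun_row; apply: (mxfun_mul LA).
  - apply: (mxfun_mul LA); last exact: (mxfun_const LA).
    by move=> i j; apply: loc_base; apply: mxfun_lsub; apply: mxfun_id.
  - apply: (loc_invmx PA Pd) => // [g /dP []//|].
    by move=> i j; apply: loc_base; apply: mxfun_lsub; apply: mxfun_id.
  - apply: (mxfun_mul LA); last exact: (mxfun_const LA).
    by move=> i j; apply: loc_base; apply: mxfun_rsub; apply: mxfun_id.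
  - apply: (loc_invmx PA Pd) => // [g /dP []//|].
    by move=> i j; apply: loc_base; apply: mxfun_rsub; apply: mxfun_id.
have [||g [/dP [dl dr] fg hg]] := loc_nz PA Pd (@polyfun_fundom _ _ _)
   (polyfun_comp LA Pf Pc) (polyfun_comp LA Ph Pc).
- exists (row_mx g1 g2); rewrite /d !row_mxKl !row_mxKr; split=> //.
  by rewrite mulf_neq0 // unit_det.
- exists (row_mx g3 g4); rewrite /d !row_mxKl !row_mxKr; split=> //.
  by rewrite mulf_neq0 // unit_det.
exists (mxconj (lsubmx g) e), (mxconj (rsubmx g) e).
by split=> //; apply: mxconj_orbit => //; rewrite unitmxE unitfE.
Qed.

(** A whole family of polynomials is allowed because the scalars for which nonvanishing can be
    proved are not known in advance. Density needs only one member that is nonzero somewhere. *)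
Lemma generic_locus (Fam : ('M[k]_(N, N + N) -> k) -> Prop) :
  (forall f, Fam f -> polyfun f) ->
  (exists f x y, [/\ Fam f, O x, O y & f (row_mx x y) != 0]) ->
  let OO := @pair_mx k N @` (O `*` O) in
  let U := [set u | (O `*` O) u /\ exists2 f, Fam f & f (pair_mx u) != 0] in
  zopen_in OO (@pair_mx k N @` U) /\ zdense_in OO (@pair_mx k N @` U).
Proof.
move=> PF [f0 [x0 [y0 [Ff0 Ox0 Oy0 f0xy]]]] OO U.
have UOO : @pair_mx k N @` U `<=` OO by move=> _ [u [Ou _] <-]; exists u.
split; split=> //.
- move=> z [OOz /zclosureP clz]; split=> // -[u [Ou [f Ff fu]] uz].
  move/eqP: fu; apply; rewrite uz; apply: clz; first exact: PF.
  move=> y [[v Ov <-] nU]; apply/eqP; apply: contrapT => fv; apply: nU.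
  by exists v => //; split=> //; exists f => //; apply/negP.
- move=> _ [[x y] [/= Ox Oy] <-]; apply/zclosureP => f Pf fU.
  apply/eqP; apply: contrapT => /negP fxy.
  have [||x1 [y1 [Ox1 Oy1 fn0 f0n0]]] := orbit2_irreducible Pf (PF _ Ff0).
  + by exists x, y.
  + by exists x0, y0.
  move/eqP: fn0; apply; apply: (fU (row_mx x1 y1)).
  by exists (x1, y1) => //; split=> //; exists f0.
Qed.

End Irreducible.

Lemma closed_cone_nonzero N (O : set 'M[k]_N) (f : 'M[k]_N -> k) y : polyfun f ->
  closed_cone O y -> f y != 0 -> exists c x, [/\ c != 0, O x & f (c *: x) != 0].
Proof.
move=> Pf /zclosureP cl fy; apply: contrapT => H; move/eqP: fy; apply.
apply: cl => // _ [c [x [c0 Ox ->]]]; apply/eqP; apply: contrapT => /negP fc.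
by apply: H; exists c, x.
Qed.

Lemma closed_cone_nonzero2 N (O : set 'M[k]_N) (f : 'M[k]_(N, N + N) -> k) y z :
  polyfun f -> closed_cone O y -> closed_cone O z -> f (row_mx y z) != 0 ->
  exists c x c' x', [/\ c != 0, O x, c' != 0, O x' & f (row_mx (c *: x) (c' *: x')) != 0].
Proof.
move=> Pf Cy Cz fyz.
have PA := polyfun_funalg k N N.
have [|c [x [c0 Ox fx]]] := closed_cone_nonzero (f := fun y => f (row_mx y z)) _ Cy fyz.
  apply: (polyfun_comp PA Pf); apply: mxfun_row; first exact: mxfun_id.
  exact: (mxfun_const PA).
have [|c' [x' [c'0 Ox' fx']]] :=
    closed_cone_nonzero (f := fun z => f (row_mx (c *: x) z)) _ Cz fx.
  apply: (polyfun_comp PA Pf); apply: mxfun_row; last exact: mxfun_id.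
  exact: (mxfun_const PA).
by exists c, x, c', x'.
Qed.

Lemma closed_cone_homog N (O : set 'M[k]_N) (f : 'M[k]_N -> k) d y : polyfun f ->
  (forall c x, f (c *: x) = c ^+ d * f x) ->
  closed_cone O y -> f y != 0 -> exists2 x, O x & f x != 0.
Proof.
move=> Pf hf Cy fy; have [c [x [c0 Ox fx]]] := closed_cone_nonzero Pf Cy fy.
by exists x => //; move: fx; rewrite hf mulf_eq0 negb_or => /andP[].
Qed.

Lemma peval_homog m n (p : {mpoly k[m * n]}) d c x : p \is d.-homog ->
  peval p (c *: x) = c ^+ d * peval p x.
Proof.
move=> /dhomogP hp; rewrite /peval !mevalE big_distrr /= !big_seq.
apply: eq_bigr => i /hp <-; rewrite mulrCA; congr (_ * _).
rewrite /= mdegE -prodrXr -big_split /=; apply: eq_bigr => l _.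
by rewrite linearZ mxE exprMn.
Qed.

Lemma peval_homog_sum m n (p : {mpoly k[m * n]}) x :
  peval p x = \sum_(d < msize p) peval (pihomog [measure of mdeg] d p) x.
Proof. by rewrite {1}(@pihomog_partitionE _ _ [measure of mdeg] (msize p) p) // /peval raddf_sum. Qed.

(** For fixed x the polynomial c |-> p(c x) has the homogeneous components of p at x as
    coefficients, and it vanishes for all nonzero c. *)
Lemma vanish_homog m n (A : set 'M[k]_(m, n)) (p : {mpoly k[m * n]}) :
  (forall c x, c != 0 -> A x -> A (c *: x)) -> vanishes_on p A ->
  forall d, (d < msize p)%N -> vanishes_on (pihomog [measure of mdeg] d p) A.
Proof.
move=> hA pA d dp x Ax.
pose u : {poly k} := \poly_(d < msize p) peval (pihomog [measure of mdeg] d p) x.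
have uE c : c != 0 -> u.[c] = 0.
  move=> c0; rewrite -(pA _ (hA c x c0 Ax)) peval_homog_sum horner_poly.
  apply: eq_bigr => i _; rewrite mulrC -peval_homog //; exact: pihomogP.
have : u`_d = 0.
  suff -> : u = 0 by rewrite coef0.
  apply/eqP; apply: contraT => u0.
  have /closed_nonrootP [z] : u * 'X != 0 by rewrite mulf_neq0 // polyX_eq0.
  rewrite rootE hornerM hornerX mulf_eq0 negb_or => /andP[uz z0].
  by rewrite uE ?eqxx // in uz.
by rewrite coef_poly dp.
Qed.

Section Secant.
Variables (N : nat) (O : set 'M[k]_N) (e1 e2 : 'M[k]_N).
Hypotheses (O0 : forall x, O x -> x != 0).
Hypotheses (Oe1 : O e1) (Oe2 : O e2) (e12 : <[e1]>%VS <> <[e2]>%VS).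
Let C := closed_cone O.
Let S := [set x | exists y z, [/\ C y, C z & x = y + z]].

Let C_scale c x : c != 0 -> C x -> C (c *: x).
Proof.
move=> c0; apply: zclosure_map => [|{}x [a [y [a0 Oy ->]]]].
  apply: (@mxfun_scale _ _ _ (polyfun_funalg k N N) _ _ (fun=> c) id).
    exact: (fa_const (polyfun_funalg k N N)).
  exact: mxfun_id.
apply: sub_zclosure; exists (c * a), y; split=> //; last by rewrite scalerA.
by rewrite mulf_neq0.
Qed.

Let C0 : C 0.
Proof.
have := @zclosure_curve k N N (cone_of O) (fun s => s *: e1) id.
rewrite -/C => /(_ _ _ _ _ 0); rewrite scale0r; apply.
- apply: (mxfun_scale (upoly_funalg k)); first exact: upoly_id.
  exact: (mxfun_const (upoly_funalg k)).
- exact: upoly_id.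
- by exists 1; apply: oner_neq0.
- by move=> t t0; apply: C_scale => //; apply: sub_closed_cone.
Qed.

Let proj_C l x : proj_closure (proj_points O) l -> x \in l -> C x.
Proof.
move=> [_ hl] xl; apply/zclosureP => f [p fE] fO.
rewrite fE peval_homog_sum big1 // => d _.
apply: (hl d) => //; first exact: pihomogP.
move=> _ [y [Oy y0] ->] z /vlineP [c ->].
rewrite (peval_homog _ _ (pihomogP _ _ _)).
rewrite (@vanish_homog _ _ (cone_of O) p) ?mulr0 //.
- move=> a w a0 [b [v [b0 Ov ->]]]; exists (a * b), v.
  by rewrite scalerA mulf_neq0.
- by move=> w Ow; rewrite -fE fO.
- by exists 1, y; rewrite oner_neq0 scale1r.
Qed.

Let C_proj y : C y -> y != 0 -> proj_closure (proj_points O) <[y]>%VS.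
Proof.
move=> Cy y0; split; first by rewrite dim_vline y0.
move=> d p hp pO x /vlineP [c ->]; rewrite (peval_homog _ _ hp).
rewrite Cy ?mulr0 // => _ [a [z [a0 Oz ->]]].
apply: (pO <[z]>%VS); last by apply/vlineP; exists a.
by exists z => //; split=> //; apply: O0.
Qed.

(** The projective closure is tested by homogeneous polynomials only, which makes no difference for
    cones. Secants need two distinct points: proportional summands and single vectors of the cone
    are reached through lines to [e1] or [e2]. *)
Lemma CS_closure : CS O = zclosure S.
Proof.
apply/seteqP; split=> x.
- case=> [->|[x0 [_ hx]]].
    by apply: sub_zclosure; exists 0, 0; rewrite addr0.
  apply/zclosureP => f [p fE] fS; rewrite fE peval_homog_sum big1 // => d _.
  apply: (hx d) => //; [exact: pihomogP| |exact: memv_line].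
  move=> l [_ [l1 [l2 [h1 h2 _ ll]]]] z zl.
  have /memv_addP [z1 z1l [z2 z2l ->]] := subvP ll z zl.
  apply: (@vanish_homog _ _ S p) => //.
  + move=> c w c0 [u [v [Cu Cv ->]]]; exists (c *: u), (c *: v).
    by rewrite scalerDr; split=> //; apply: C_scale.
  + by move=> w Sw; rewrite -fE fS.
  + by exists z1, z2; split=> //; [apply: (proj_C h1)|apply: (proj_C h2)].
- move=> Sx; have [->|x0] := eqVneq x 0; first by left.
  right; split=> //; split; first by rewrite dim_vline x0.
  move=> d p hp hsec w /vlineP [c ->]; rewrite (peval_homog _ _ hp).
  rewrite Sx ?mulr0 // => _ [y [z [Cy Cz ->]]].
  have sec l1 l2 : proj_closure (proj_points O) l1 -> proj_closure (proj_points O) l2 ->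
      l1 <> l2 -> forall u, u != 0 -> u \in (l1 + l2)%VS -> peval p u = 0.
    move=> h1 h2 l12 u u0 ul; apply: (hsec <[u]>%VS); last exact: memv_line.
    split; first by rewrite dim_vline u0.
    by exists l1, l2; split=> //; rewrite -memvE.
  have ne1 := O0 Oe1; have ne2 := O0 Oe2.
  have pe1 := C_proj (sub_closed_cone Oe1) ne1.
  have pe2 := C_proj (sub_closed_cone Oe2) ne2.
  have secC u : C u -> u != 0 -> peval p u = 0.
    move=> Cu u0; have pu := C_proj Cu u0.
    have [E|ne] := pselect (<[u]>%VS = <[e1]>%VS); last first.
      by apply: (sec _ _ pu pe1 ne _ u0); apply: (subvP (addvSl _ _)); exact: memv_line.
    apply: (sec _ _ pu pe2 _ _ u0); first by rewrite E.
    by apply: (subvP (addvSl _ _)); exact: memv_line.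
  (* A polynomial of degree 0 may be a nonzero constant, so vanishing at 0 must come from an
     existing secant. *)
  have p0 : peval p 0 = 0.
    apply: (hsec <[e1]>%VS); last exact: mem0v.
    split; first by rewrite dim_vline ne1.
    by exists <[e1]>%VS, <[e2]>%VS; split=> //; exact: addvSl.
  have [->//|yz0] := eqVneq (y + z) 0.
  have [y0|y0] := eqVneq y 0; first by move: yz0; rewrite y0 add0r => ?; apply: secC.
  have [z0|z0] := eqVneq z 0; first by move: yz0; rewrite z0 addr0 => ?; apply: secC.
  have [E|ne] := pselect (<[y]>%VS = <[z]>%VS); last first.
    apply: (sec _ _ (C_proj Cy y0) (C_proj Cz z0) ne _ yz0).
    by apply: memv_add; exact: memv_line.
  have /vlineP [a ya] : y \in <[z]>%VS by rewrite -E memv_line.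
  have E2 : y + z = (a + 1) *: z by rewrite scalerDl scale1r -ya.
  apply: secC => //; rewrite E2; apply: C_scale => //.
  by apply: contraNneq yz0 => a0; rewrite E2 a0 scale0r.
Qed.

End Secant.

Lemma nilp_rank_lt N (e : 'M[k]_N) : (0 < N)%N -> nilpotent_mx e -> (\rank e < N)%N.
Proof.
move=> N0 [d ed]; rewrite ltn_neqAle rank_leq_row andbT.
apply/negP => re; have ue : e \in unitmx by rewrite -row_free_unit /row_free.
have : e ^+ d \in unitmx.
  elim: (d) => [|i IH]; first exact: unitmx1.
  by rewrite exprS unitmx_mul ue.
by rewrite ed => /mxrank_unit; rewrite mxrank0 => N00; rewrite -N00 in N0.
Qed.

(** Proportional nonzero matrices have the same row space. As rank(e) < N, some [g] moves a row [w]
    of [e] to a vector [u] outside that space, and conjugation by its inverse moves the row space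
    along. *)
Lemma two_lines N (e : 'M[k]_N) : (0 < N)%N -> nilpotent_mx e -> e != 0 ->
  exists2 e', orbit_of (SL N) e e' & <[e]>%VS <> <[e']>%VS.
Proof.
move=> N0 ne e0; have re := nilp_rank_lt N0 ne.
have /row_subPn [i] : ~~ (e <= (0 : 'M_N))%MS by rewrite submx0.
rewrite submx0; set w := row i e => w0.
have /row_subPn [l ul] : ~~ ((1%:M : 'M[k]_N) <= e)%MS.
  by apply: contraL re => /mxrankS; rewrite mxrank1 leqNgt.
set u := row l _ in ul.
have u0 : u != 0 by apply: contraNneq ul => ->; apply: sub0mx.
have [||g ug wg] := @row_transport _ 1 N w u; rewrite ?rank_rV ?w0 ?u0 //.
have ug' : invmx g \in unitmx by rewrite unitmx_inv.
exists (mxconj (invmx g) e); first exact: mxconj_orbit.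
move=> E; have /vlineP [c ec] : mxconj (invmx g) e \in <[e]>%VS by rewrite E memv_line.
case/negP: ul; rewrite -wg.
have -> : (w *m g = row i g *m (c *: e))%MS.
  by rewrite -ec /mxconj invmxK /w -!row_mul !mulmxA mulmxV // mul1mx.
by rewrite -scalemxAr scalemx_sub // submxMl.
Qed.

End Orbits.

(** * Companion matrices *)

Section Companion.
Variable k : closedFieldType.

Definition natmx m n (F : nat -> nat -> k) : 'M[k]_(m, n) := \matrix_(i < m, l < n) F i l.

(** Column c is the basis vector of index [w c]; multiplication by this matrix or its transpose
    selects columns or rows. *)
Definition selmx N j (w : nat -> nat) : 'M[k]_(N, j) := natmx N j (fun i c => (i == w c)%:R).

Section Selection.
Variables (N j : nat) (w : nat -> nat).
Hypothesis wN : forall c, (c < j)%N -> (w c < N)%N.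
Hypothesis w_inj : forall c d, (c < j)%N -> (d < j)%N -> w c = w d -> c = d.

Lemma trsel_natmx n F : (selmx N j w)^T *m natmx N n F = natmx j n (fun c l => F (w c) l).
Proof.
apply/matrixP => c l; rewrite !mxE (bigD1 (Ordinal (wN (ltn_ord c)))) //= !mxE eqxx mul1r.
rewrite big1 ?addr0 // => i; rewrite -val_eqE /= => /negbTE ic.
by rewrite !mxE ic mul0r.
Qed.

Lemma natmx_sel n F : natmx n N F *m selmx N j w = natmx n j (fun l c => F l (w c)).
Proof.
apply/matrixP => l c; rewrite !mxE (bigD1 (Ordinal (wN (ltn_ord c)))) //= !mxE eqxx mulr1.
rewrite big1 ?addr0 // => i; rewrite -val_eqE /= => /negbTE ic.
by rewrite !mxE ic mulr0.
Qed.

Lemma trsel_sel : (selmx N j w)^T *m selmx N j w = 1%:M.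
Proof.
rewrite trsel_natmx; apply/matrixP => c d; rewrite !mxE; congr (nat_of_bool _)%:R.
rewrite -val_eqE /=; apply/idP/idP => [/eqP e|/eqP ->//].
by apply/eqP; apply: w_inj.
Qed.

Lemma rank_sel : \rank (selmx N j w) = j.
Proof. exact: left_inv_rank trsel_sel. Qed.

Lemma natmx_factor n F :
  (forall i l, (i < N)%N -> (l < n)%N -> (forall c, (c < j)%N -> i <> w c) -> F i l = 0) ->
  natmx N n F = selmx N j w *m natmx j n (fun c l => F (w c) l).
Proof.
move=> F0; rewrite -trsel_natmx mulmxA; apply/matrixP => i l; rewrite !mxE.
have [[c e]|nex] := pselect (exists c : 'I_j, i = w c :> nat).
  have Pi i' : (selmx N j w *m (selmx N j w)^T) i i' = (i' == i)%:R.
    rewrite mxE (bigD1 c) //= big1 ?addr0 => [|d]; first by rewrite !mxE e eqxx mul1r -e.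
    rewrite -val_eqE /= => /negbTE dc; rewrite !mxE e.
    rewrite (_ : (w c == w d) = false) ?mul0r //; apply/negbTE/eqP => /w_inj E.
    by rewrite E ?eqxx // in dc.
  rewrite (bigD1 i) //= Pi eqxx mul1r big1 ?addr0; first by rewrite mxE.
  by move=> i' /negbTE ii'; rewrite Pi ii' mul0r.
rewrite F0 //; last by move=> c cj E; apply: nex; exists (Ordinal cj).
rewrite big1 // => i' _; rewrite !mxE big1 ?mul0r // => d _; rewrite !mxE.
by have [E|_] := eqVneq (i : nat) (w d); [case: nex; exists d|rewrite mul0r].
Qed.

End Selection.

(** Take for A the selection of the rows [w] and for R these rows of [F]. Then R A is the submatrix
    on rows and columns [w], and the hypotheses say that it is [a b] with [b a = 0]. All explicit
    memberships in the cone are obtained in this way. *)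
Lemma sel_mem N (C : set 'M[k]_N) (e : 'M[k]_N) j (w : nat -> nat) (a b : nat -> k) F :
  stable_cone C -> C e -> nilpotent_mx e -> e *m e != 0 -> (1 < j <= \rank e)%N ->
  (2 * j <= N.+1)%N ->
  (forall c, (c < j)%N -> (w c < N)%N) ->
  (forall c d, (c < j)%N -> (d < j)%N -> w c = w d -> c = d) ->
  (forall i l, (i < N)%N -> (l < N)%N -> (forall c, (c < j)%N -> i <> w c) -> F i l = 0) ->
  (forall c d, (c < j)%N -> (d < j)%N -> F (w c) (w d) = a c * b d) ->
  \sum_(c < j) b c * a c = 0 -> C (natmx N N F).
Proof.
move=> SC Ce ne e2 /andP[j1 jr] jN wN winj F0 Fab ba.
rewrite (natmx_factor wN winj F0).
have rs := rank_sel wN winj.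
have RA : natmx j N (fun c l => F (w c) l) *m selmx N j w =
    natmx j 1 (fun c _ => a c) *m natmx 1 j (fun _ => b).
  rewrite natmx_sel //; apply/matrixP => c d; rewrite !mxE big_ord1 !mxE.
  by rewrite Fab.
have ba0 : natmx 1 j (fun _ => b) *m natmx j 1 (fun c _ => a c) = 0.
  by apply/matrixP => c d; rewrite !mxE -[RHS]ba; apply: eq_bigr => i _; rewrite !mxE.
have [m Nm] : exists m, N = (m + j)%N by exists (N - j)%N; lia.
move: (natmx j N _) (selmx N j w) rs RA => R A.
have jm : (j <= m.+1)%N by lia.
clear -SC Ce ne e2 j1 jr ba0 Nm jm; subst N => rA RA.
exact: (factor_mem SC j1 jm Ce ne e2 jr rA RA ba0).
Qed.

(* The companion matrix with last column [c]: [e_l |-> e_(l+1)], [e_(n-1) |-> c]. *)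
Definition compf n (c : nat -> k) (i l : nat) : k :=
  if l == n.-1 then c i else (i == l.+1)%:R.

(** The columns of [U] are v, M v, M^2 v, ...; in this basis [M] is a shift except on the last
    vector. *)
Lemma cyclic_companion n (M : 'M[k]_n) (v : 'cV[k]_n) :
  \matrix_(i < n, a < n) (M ^+ a *m v) i 0 \in unitmx ->
  exists c g, g \in unitmx /\ mxconj g M = natmx n n (compf n c).
Proof.
set U := \matrix_(i, a) _ => uU.
pose c0 : 'cV_n := invmx U *m (M ^+ n *m v).
pose c i := if insub i is Some i' then c0 (i' : 'I_n) 0 else 0.
have cE (i : 'I_n) : c i = c0 i 0 by rewrite /c valK.
exists c, (invmx U); split; first by rewrite unitmx_inv.
apply: mxconjV_eq => //; apply/matrixP => i l; rewrite !mxE.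
have -> : \sum_j M i j * U j l = (M ^+ l.+1 *m v) i 0.
  rewrite exprS -[_ * _]/(_ *m _) -mulmxA mxE; apply: eq_bigr => j _.
  by rewrite [U j l]mxE.
have [ln|ln] := eqVneq (l : nat) n.-1.
  have -> : l.+1 = n by rewrite ln prednK // (leq_ltn_trans _ (ltn_ord l)).
  rewrite -[M ^+ n *m v](mulKVmx uU) -/c0 mxE; apply: eq_bigr => j _.
  by rewrite [natmx _ _ _ _ _]mxE /compf ln eqxx cE.
have l1n : (l.+1 < n)%N by have := ltn_ord l; lia.
rewrite (bigD1 (Ordinal l1n)) //= big1 ?addr0.
  by rewrite !mxE /compf (negbTE ln) eqxx mulr1.
move=> j; rewrite -val_eqE /= => /negbTE jl.
by rewrite [natmx _ _ _ _ _]mxE /compf (negbTE ln) jl mulr0.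
Qed.

Lemma mxtrace_conj n (g M : 'M[k]_n) : g \in unitmx -> \tr (mxconj g M) = \tr M.
Proof. by move=> ug; rewrite /mxconj mxtrace_mulC mulKmx. Qed.

Lemma char_poly_conj n (g M : 'M[k]_n) : g \in unitmx ->
  char_poly (mxconj g M) = char_poly M.
Proof.
move=> ug; rewrite /char_poly; pose G := map_mx polyC g.
have uG : G \in unitmx by rewrite map_unitmx.
have -> : char_poly_mx (mxconj g M) = G *m char_poly_mx M *m invmx G.
  rewrite /char_poly_mx mulmxBr mulmxBl mul_mx_scalar -scalemxAl mulmxV // scalemx1.
  by rewrite -map_invmx -!map_mxM.
by rewrite !det_mulmx mulrAC -det_mulmx mulmxV // det1 mul1r.
Qed.

Lemma tr_compf n c : (1 < n)%N -> \tr (natmx n n (compf n c)) = c n.-1.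
Proof.
move=> n1; have ln : (n.-1 < n)%N by rewrite prednK // ltnW.
rewrite /mxtrace (bigD1 (Ordinal ln)) //= big1 ?addr0; first by rewrite mxE /compf eqxx.
move=> i; rewrite -val_eqE /= => /negbTE il; rewrite mxE /compf il.
by rewrite (_ : (_ == _) = false) //; apply/negbTE; rewrite neq_ltn leqnn.
Qed.

Lemma natmxD m n (F G : nat -> nat -> k) :
  natmx m n F + natmx m n G = natmx m n (fun i l => F i l + G i l).
Proof. by apply/matrixP => i l; rewrite !mxE. Qed.

Lemma eq_natmx m n (F G : nat -> nat -> k) :
  (forall i l, (i < m)%N -> (l < n)%N -> F i l = G i l) -> natmx m n F = natmx m n G.
Proof. by move=> FG; apply/matrixP => i l; rewrite !mxE FG. Qed.

Lemma block_natmx n q (F : nat -> nat -> k) :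
  block_mx (natmx n n F) 0 0 (0 : 'M_q) =
  natmx (n + q) (n + q) (fun i l => if (i < n)%N && (l < n)%N then F i l else 0).
Proof.
apply/matrixP => i l; rewrite [RHS]mxE /=.
case: (splitP i) => i' iE; case: (splitP l) => l' lE; rewrite iE lE.
- have -> : i = lshift q i' by exact: val_inj.
  have -> : l = lshift q l' by exact: val_inj.
  by rewrite block_mxEul mxE.
- have -> : i = lshift q i' by exact: val_inj.
  have -> : l = rshift n l' by exact: val_inj.
  by rewrite block_mxEur mxE.
- have -> : i = rshift n i' by exact: val_inj.
  have -> : l = lshift q l' by exact: val_inj.
  by rewrite block_mxEdl mxE.
- have -> : i = rshift n i' by exact: val_inj.
  have -> : l = rshift n l' by exact: val_inj.
  by rewrite block_mxEdr mxE.
Qed.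

Definition parity_part (b : bool) n c (i l : nat) : k :=
  if [&& (i < n)%N, (l < n)%N & odd i == b] then compf n c i l else 0.

Lemma companion_split n q c :
  block_mx (natmx n n (compf n c)) 0 0 (0 : 'M_q) =
  natmx (n + q) (n + q) (parity_part true n c) + natmx (n + q) (n + q) (parity_part false n c).
Proof.
rewrite block_natmx natmxD; apply: eq_natmx => i l _ _; rewrite /parity_part.
by case: (i < n)%N; case: (l < n)%N; case: (odd i); rewrite /= ?addr0 ?add0r.
Qed.

(** The subdiagonal joins indices of opposite parity, so the submatrix on rows and columns of one
    parity retains at most the last column; the required orthogonality is [c n.-1 = 0]. If n = 2j -
    1, there are only j - 1 odd rows and one more has to be added. *)
Lemma companion_parts_mem n q (C : set 'M[k]_(n + q)) (e : 'M[k]_(n + q)) j c :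
  stable_cone C -> C e -> nilpotent_mx e -> e *m e != 0 -> (1 < j <= \rank e)%N ->
  (n = 2 * j)%N \/ (n.+1 = 2 * j /\ q = 0)%N -> c n.-1 = 0 ->
  C (natmx (n + q) (n + q) (parity_part true n c)) /\
  C (natmx (n + q) (n + q) (parity_part false n c)).
Proof.
move=> SC Ce ne e2 jr nj cn; have [j1 _] := andP jr.
have jN : (2 * j <= (n + q).+1)%N by lia.
have sumd (a : nat -> k) : a j.-1 = 0 -> \sum_(d < j) (d == j.-1 :> nat)%:R * a d = 0.
  move=> a0; apply: big1 => d _; have [->|] := eqVneq; first by rewrite a0 mulr0.
  by rewrite mul0r.
case: nj => [nE|[nE q0]].
- split.
  + apply: (sel_mem SC Ce ne e2 jr jN (w := fun c => c.*2.+1)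
       (a := fun d => c d.*2.+1) (b := fun d => (d == j.-1 :> nat)%:R)).
    * by move=> d dj; lia.
    * by move=> d d' _ _; lia.
    * move=> i l iN lN H; rewrite /parity_part; case: ifP => // /and3P[i_n l_n /eqP io].
      by have := H (i./2); rewrite -[X in X <> _]odd_double_half io; lia.
    * move=> d d' dj d'j; rewrite /parity_part /compf /= odd_double /=.
      have -> : (d.*2.+1 < n)%N by lia.
      have -> : (d'.*2.+1 < n)%N by lia.
      have -> : (d'.*2.+1 == n.-1) = (d' == j.-1) by lia.
      rewrite /=; case: eqP => _; rewrite ?mulr1 ?mulr0 //.
      by have -> : (d.*2.+1 == d'.*2.+2) = false by lia.
    * by apply: (sumd (fun d => c d.*2.+1)); rewrite -[RHS]cn; congr c; lia.
  + apply: (sel_mem SC Ce ne e2 jr jN (w := fun c => c.*2)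
       (a := fun d => 0) (b := fun d => 0)).
    * by move=> d dj; lia.
    * by move=> d d' _ _; lia.
    * move=> i l iN lN H; rewrite /parity_part; case: ifP => // /and3P[i_n l_n /eqP io].
      by have := H (i./2); rewrite -[X in X <> _]odd_double_half io; lia.
    * move=> d d' dj d'j; rewrite /parity_part /compf /= odd_double /=.
      have -> : (d'.*2 == n.-1) = false by lia.
      have -> : (d.*2 == d'.*2.+1) = false by lia.
      by rewrite mul0r; case: ifP.
    * by apply: big1 => d _; rewrite mul0r.
- split.
  (* The zero row 0 fills the last place [j.-1]. Column 0 then contributes the subdiagonal entry at
     (1, 0), whence a = e_0 and b = e_(j-1). *)
  + apply: (sel_mem SC Ce ne e2 jr jN (w := fun d => if d == j.-1 then 0%N else d.*2.+1)
       (a := fun d => (d == 0%N :> nat)%:R) (b := fun d => (d == j.-1 :> nat)%:R)).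
    * by move=> d dj; case: eqP; lia.
    * by move=> d d' dj d'j; case: eqP; case: eqP; lia.
    * move=> i l iN lN H; rewrite /parity_part; case: ifP => // /and3P[i_n l_n /eqP io].
      by have := H (i./2); case: eqP; lia.
    * move=> d d' dj d'j; rewrite /parity_part /compf.
      have [->|dn] := eqVneq d j.-1.
        rewrite !andbF; have -> : (j.-1 == 0)%N = false by lia.
        by rewrite mul0r.
      have [_|d'n] := eqVneq d' j.-1; last first.
        rewrite mulr0; have -> : (d'.*2.+1 == n.-1) = false by lia.
        have -> : (d.*2.+1 == d'.*2.+2) = false by lia.
        by case: ifP.
      rewrite mulr1 /= odd_double.
      have -> : (d.*2.+1 < n)%N by lia.
      have -> : (0 < n)%N by lia.
      have -> : (0 == n.-1)%N = false by lia.
      by have -> : (d.*2.+1 == 1)%N = (d == 0)%N by lia.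
    * by apply: (sumd (fun d => (d == 0%N)%:R)); rewrite (_ : (j.-1 == 0)%N = false) //; lia.
  + apply: (sel_mem SC Ce ne e2 jr jN (w := fun c => c.*2)
       (a := fun d => c d.*2) (b := fun d => (d == j.-1 :> nat)%:R)).
    * by move=> d dj; lia.
    * by move=> d d' _ _; lia.
    * move=> i l iN lN H; rewrite /parity_part; case: ifP => // /and3P[i_n l_n /eqP io].
      by have := H (i./2); rewrite -[X in X <> _]odd_double_half io; lia.
    * move=> d d' dj d'j; rewrite /parity_part /compf /= odd_double /=.
      have -> : (d.*2 < n)%N by lia.
      have -> : (d'.*2 < n)%N by lia.
      have -> : (d'.*2 == n.-1) = (d' == j.-1) by lia.
      rewrite /=; case: eqP => _; rewrite ?mulr1 ?mulr0 //.
      by have -> : (d.*2 == d'.*2.+1) = false by lia.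
    * by apply: (sumd (fun d => c d.*2)); rewrite -[RHS]cn; congr c; lia.
Qed.

End Companion.

(** * Secant varieties of the orbits with nonzero square *)

Section SecantCone.
Variable k : closedFieldType.

Lemma rank_gtP m n r (M : 'M[k]_(m, n)) : (r < \rank M)%N ->
  exists (A : 'M_(r.+1, m)) (B : 'M_(n, r.+1)), A *m M *m B = 1%:M.
Proof.
move sE: (\rank M) => s rM; have [L [R [ME rL rR]]] := rank_factor sE.
have [L' LL] := rank_left_inv rL; have [R' RR] := rank_right_inv rR.
exists (pid_mx r.+1 *m L'), (R' *m pid_mx r.+1).
rewrite ME !mulmxA -(mulmxA _ L' L) LL mulmx1 -(mulmxA _ R R') RR mulmx1.
by rewrite pid_mx_id // pid_mx_1.
Qed.

Lemma rank_le_closed m n r (A : set 'M[k]_(m, n)) :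
  (forall x, A x -> (\rank x <= r)%N) -> forall x, zclosure A x -> (\rank x <= r)%N.
Proof.
move=> Ar x /zclosureP clx; rewrite leqNgt; apply/negP => /rank_gtP [P [Q PQ]].
have PA := polyfun_funalg k m n.
have : \det (P *m x *m Q) = 0.
  apply: (clx (fun x => \det (P *m x *m Q))) => [|y Ay].
    apply: (fa_det PA); apply: (mxfun_mul PA); last exact: (mxfun_const PA).
    by apply: (mxfun_mul PA); [exact: (mxfun_const PA)|exact: mxfun_id].
  apply/eqP; apply: contraT => /det_neq0_rank rd.
  have : (r.+1 <= \rank y)%N.
    rewrite -[leqLHS]rd.
    by apply: leq_trans (mxrankM_maxl _ _) (mxrankM_maxr _ _).
  by move=> /leq_trans /(_ (Ar y Ay)); rewrite ltnn.
by rewrite PQ det1 => /eqP; rewrite oner_eq0.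
Qed.

Lemma tr0_closed N (A : set 'M[k]_N) :
  (forall x, A x -> \tr x = 0) -> forall x, zclosure A x -> \tr x = 0.
Proof.
move=> At x /zclosureP clx; apply: clx => //.
by apply: (fa_tr (polyfun_funalg k N N)); exact: mxfun_id.
Qed.

Lemma mxrank_mxconj N (g x : 'M[k]_N) : g \in unitmx -> \rank (mxconj g x) = \rank x.
Proof.
move=> ug; rewrite /mxconj mxrankMfree ?row_free_unit ?unitmx_inv //.
by rewrite eqmxMfull // row_full_unit.
Qed.

Definition sumset N (C : set 'M[k]_N) : set 'M[k]_N :=
  [set x | exists y z, [/\ C y, C z & x = y + z]].

Lemma sumset_closure_conj N (C : set 'M[k]_N) g x : stable_cone C -> g \in unitmx ->
  zclosure (sumset C) x -> zclosure (sumset C) (mxconj g x).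
Proof.
move=> SC ug; apply: zclosure_map => [|{}x [y [z [Cy Cz ->]]]].
  by apply: mxfun_mxconj; [exact: polyfun_funalg|exact: mxfun_id].
apply: sub_zclosure; exists (mxconj g y), (mxconj g z); rewrite mxconjD.
by split=> //; apply: (sc_conj SC).
Qed.

(** A basis whose first vectors span the column space makes the last q rows vanish. *)
Lemma rank_block n q (M : 'M[k]_(n + q)) : (\rank M <= n)%N ->
  exists2 g, g \in unitmx & exists M' B, mxconj g M = block_mx M' B 0 0.
Proof.
move=> rM; exists (invmx (col_ebase M)); first by rewrite unitmx_inv col_ebase_unit.
set Y := mxconj _ _.
have dY : dsubmx Y = 0.
  have -> : Y = pid_mx (\rank M) *m (row_ebase M *m col_ebase M).
    rewrite /Y /mxconj invmxK -{2}(mulmx_ebase M) !mulmxA mulVmx ?mul1mx //.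
    exact: col_ebase_unit.
  apply/matrixP => i l; rewrite !mxE big1 // => c _; rewrite !mxE /=.
  rewrite (_ : (n + i < \rank M)%N = false) ?andbF ?mul0r //.
  by apply/negbTE; rewrite -leqNgt (leq_trans rM) // leq_addr.
exists (ulsubmx Y), (ursubmx Y); rewrite -[LHS]submxK.
congr block_mx; apply/matrixP => i l; rewrite !mxE.
  by have /matrixP /(_ i (lshift q l)) := dY; rewrite !mxE.
by have /matrixP /(_ i (rshift n l)) := dY; rewrite !mxE.
Qed.

(** When [M'] is invertible, image and kernel are complementary, so [B] can be conjugated away. *)
Lemma block_unit_conj n q (M' : 'M[k]_n) (B : 'M[k]_(n, q)) (g : 'M[k]_n) :
  g \in unitmx -> M' \in unitmx -> exists2 h, h \in unitmx &
    block_mx M' B 0 0 = mxconj h (block_mx (mxconj g M') 0 0 0).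
Proof.
move=> ug uM; pose h : 'M_(n + q) := block_mx g (g *m (invmx M' *m B)) 0 1%:M.
have uh : h \in unitmx by rewrite unitmxE det_ublock det1 mulr1 -unitmxE.
exists (invmx h); first by rewrite unitmx_inv.
symmetry; apply: mxconjV_eq => //.
rewrite /h !mulmx_block !mulmx0 !mul0mx !addr0 /mxconj !mulmxA.
by rewrite -!(mulmxA _ (invmx g) g) mulVmx // mulmx1 -[_ *m M' *m invmx M']mulmxA mulmxV ?mulmx1.
Qed.

Definition cyc n (c : nat) := if c == n.-1 then 0%N else c.+1.

Lemma cyc_lt n c : (0 < n)%N -> (c < n)%N -> (cyc n c < n)%N.
Proof. by rewrite /cyc; case: eqP; lia. Qed.

Lemma cyc_inj n c d : (c < n)%N -> (d < n)%N -> cyc n c = cyc n d -> c = d.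
Proof. by rewrite /cyc; case: eqP; case: eqP; lia. Qed.

Lemma cyc_pow n a : (a < n)%N ->
  (selmx k n n (cyc n)) ^+ a *m selmx k n 1 (fun=> 0%N) = selmx k n 1 (fun=> a).
Proof.
elim: a => [|a IH] an; first by rewrite expr0 mul1mx.
rewrite exprS -[_ * _]/(_ *m _) -mulmxA IH ?(ltnW an) //.
rewrite natmx_sel => [|c _]; last exact: ltnW.
apply: eq_natmx => i l _ _; rewrite /cyc.
by rewrite (_ : (a == n.-1) = false) //; lia.
Qed.

(** The line leads from [Z] to the cyclic permutation matrix [K], which is invertible, has the
    cyclic vector [v] and is traceless as n > 1. The trace vanishes along the whole line, and for
    the companion form it is the entry [c n.-1]. *)
Lemma cyclic_dense n (Z : 'M[k]_n) : (1 < n)%N -> \tr Z = 0 ->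
  exists F h, [/\ mxfun (@upoly k) F, upoly h, exists t, h t != 0, F 0 = Z &
    forall t, h t != 0 -> F t \in unitmx /\ exists c g, [/\ g \in unitmx,
      mxconj g (F t) = natmx n n (compf n c) & c n.-1 = 0]].
Proof.
move=> n1 trZ; have n0 : (0 < n)%N := ltnW n1.
pose K := selmx k n n (cyc n).
pose v := selmx k n 1 (fun=> 0%N).
pose F (s : k) := Z + s *: (K - Z).
pose U s : 'M_n := \matrix_(i < n, a < n) (F s ^+ a *m v) i 0.
have F1 : F 1 = K by rewrite /F scale1r addrC subrK.
have PF : mxfun (@upoly k) F by exact: mxfun_line.
have A := upoly_funalg k.
have trK : \tr K = 0.
  rewrite /mxtrace big1 // => i _; rewrite mxE (_ : (_ == _) = false) //.
  by apply/negbTE/eqP; rewrite /cyc; case: i => i /= iN; case: eqP; lia.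
have trF s : \tr (F s) = 0 by rewrite mxtraceD mxtraceZ raddfB /= trK trZ subrr mulr0 addr0.
exists F, (fun s => \det (U s) * \det (F s)); split=> //.
- apply: (fa_mul A); apply: (fa_det A) => //.
  move=> i a; have := mxfun_mul A (mxfun_exp A a PF) (mxfun_const A v) i 0.
  by congr upoly; apply: funext => s; rewrite [RHS]mxE.
- exists 1; rewrite mulf_neq0 //; last first.
    rewrite F1; have := trsel_sel k (fun c => @cyc_lt n c n0) (@cyc_inj n).
    by move=> /mulmx1_unit [_ /unit_det].
  have -> : U 1 = 1%:M; last by rewrite det1 oner_neq0.
  by apply/matrixP => i a; rewrite mxE F1 cyc_pow // !mxE.
- by rewrite /F scale0r addr0.
move=> s; rewrite mulf_eq0 negb_or => /andP[dU dF].
split; first by rewrite unitmxE unitfE.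
have [|c [g [ug gE]]] := @cyclic_companion k n (F s) v; first by rewrite unitmxE unitfE.
by exists c, g; split=> //; rewrite -tr_compf // -gE mxtrace_conj.
Qed.

Lemma Dro_sub_closure N n q (C : set 'M[k]_N) (e : 'M[k]_N) j : N = (n + q)%N ->
  stable_cone C -> C e -> nilpotent_mx e -> e *m e != 0 -> (1 < j <= \rank e)%N ->
  (n = 2 * j)%N \/ (n.+1 = 2 * j /\ q = 0)%N -> Dro N n `<=` zclosure (sumset C).
Proof.
move=> NE SC Ce ne e2 jr nj; subst N.
have n1 : (1 < n)%N by have [j1 _] := andP jr; lia.
move=> M [rM trM]; have [g ug [M' [B ME]]] := rank_block rM.
rewrite -(mxconjK M ug); apply: sumset_closure_conj; rewrite ?unitmx_inv // ME.
have trM' : \tr M' = 0.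
  have : \tr (block_mx M' B 0 0) = 0 by rewrite -ME mxtrace_conj.
  by rewrite mxtrace_block mxtrace0 addr0.
have [F [h [PF Ph exh F0 hF]]] := cyclic_dense n1 trM'.
rewrite -F0; have A := upoly_funalg k.
apply: (zclosure_curve (F := fun t => block_mx (F t) B 0 0) _ Ph exh).
  apply: (mxfun_block PF); exact: (mxfun_const A).
move=> t /hF [uF [c [g' [ug' gE c0]]]].
have [h' uh' ->] := block_unit_conj B ug' uF.
apply: sumset_closure_conj => //; rewrite gE companion_split; apply: sub_zclosure.
have [h1 h2] := companion_parts_mem SC Ce ne e2 jr nj c0.
by exists (natmx (n + q) (n + q) (parity_part true n c)),
          (natmx (n + q) (n + q) (parity_part false n c)).
Qed.

Lemma orbit_invariants N (e x : 'M[k]_N) : orbit_of (SL N) e x ->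
  \rank x = \rank e /\ \tr x = \tr e.
Proof.
by move=> [g /SL_unit ug <-]; rewrite mxrank_mxconj // mxtrace_conj.
Qed.

Lemma orbit_cone_invariants N (e x : 'M[k]_N) : \tr e = 0 ->
  closed_cone (orbit_of (SL N) e) x -> (\rank x <= \rank e)%N /\ \tr x = 0.
Proof.
move=> tre Cx; split.
  apply: rank_le_closed Cx => _ [c [y [_ Oy ->]]].
  by rewrite -(orbit_invariants Oy).1 mxrank_scale.
apply: tr0_closed Cx => _ [c [y [_ Oy ->]]].
by rewrite mxtraceZ (orbit_invariants Oy).2 tre mulr0.
Qed.

Lemma CS_orbit N (e : 'M[k]_N) : (0 < N)%N -> nilpotent_mx e -> e != 0 ->
  CS (orbit_of (SL N) e) = zclosure (sumset (closed_cone (orbit_of (SL N) e))).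
Proof.
move=> N0 ne e0; have [e' Oe' ee'] := two_lines N0 ne e0.
apply: (CS_closure (e1 := e) (e2 := e')) => //.
- move=> x Ox; apply: contraNneq e0 => x0.
  by rewrite -mxrank_eq0 -(orbit_invariants Ox).1 x0 mxrank0.
- by have := mxconj_orbit e N0 (unitmx1 k N); rewrite mxconj1.
Qed.

Lemma orbit_self N (e : 'M[k]_N) : (0 < N)%N -> orbit_of (SL N) e e.
Proof. by move=> N0; have := mxconj_orbit e N0 (unitmx1 k N); rewrite mxconj1. Qed.

(** If rank(e) were at most one, a nonzero e^2 would have the row space of [e], and so would all
    powers, against nilpotency. *)
Lemma sq_neq0_rank N (e : 'M[k]_N) : nilpotent_mx e -> e *m e != 0 -> (1 < \rank e)%N.
Proof.
move=> /nilp_pow [d Dd] e2; rewrite ltnNge; apply/negP => r1.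
have r2 : (0 < \rank (e *m e))%N by rewrite lt0n mxrank_eq0.
have re : \rank (e *m e) = \rank e.
  apply/eqP; rewrite eqn_leq mxrankM_maxl /=.
  by apply: leq_trans r2.
have /andP[_ ee2] : (e *m e == e)%MS.
  by rewrite -(geq_leqif (mxrank_leqif_eq (submxMl e e))) re.
have sub i : (e <= e ^+ i.+1)%MS.
  elim: i => [|i IH]; first by rewrite expr1.
  by apply: (submx_trans ee2); rewrite exprSr -[_ * e]/(_ *m e); apply: submxMr.
by have := sub d; rewrite Dd // submx0 => /eqP e0; rewrite e0 mul0mx eqxx in e2.
Qed.

Lemma CS_big N (e : 'M[k]_N) : (0 < N)%N -> sl N e -> nilpotent_mx e -> e *m e != 0 ->
  (N <= 2 * \rank e)%N -> CS (orbit_of (SL N) e) = sl N.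
Proof.
move=> N0 tre ne e2 re; have e0 : e != 0 by apply: contraNneq e2 => ->; rewrite mul0mx.
rewrite CS_orbit //; set C := closed_cone _; have SC : stable_cone C by exact: closed_cone_stable.
apply/seteqP; split=> x.
  apply: tr0_closed => {}x [y [z [Cy Cz ->]]].
  by rewrite mxtraceD !(orbit_cone_invariants tre _).2 ?addr0.
move=> trx; have Dx : Dro N N x by split=> //; apply: rank_leq_row.
have re1 := sq_neq0_rank ne e2.
have Ce : C e by apply: sub_closed_cone; apply: orbit_self.
(* The least j with 2j >= N; the hypothesis on the rank says exactly that j <= rank(e). *)
pose j := uphalf N.
have reN := nilp_rank_lt N0 ne.
have jr : (1 < j <= \rank e)%N by rewrite /j; lia.
apply: (Dro_sub_closure (esym (addn0 N)) SC Ce ne e2 jr _ Dx).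
by rewrite /j; lia.
Qed.

Lemma CS_small N (e : 'M[k]_N) j : (0 < N)%N -> sl N e -> nilpotent_mx e -> e *m e != 0 ->
  \rank e = j -> (2 * j <= N)%N -> CS (orbit_of (SL N) e) = Dro N (2 * j).
Proof.
move=> N0 tre ne e2 re jN; have e0 : e != 0 by apply: contraNneq e2 => ->; rewrite mul0mx.
rewrite CS_orbit //; set C := closed_cone _; have SC : stable_cone C by exact: closed_cone_stable.
have Ce : C e by apply: sub_closed_cone; apply: orbit_self.
have jr : (1 < j <= \rank e)%N by rewrite re leqnn -re sq_neq0_rank.
apply/seteqP; split=> x; last first.
  move=> Dx; apply: (Dro_sub_closure (esym (subnKC jN)) SC Ce ne e2 jr _ Dx).
  by left.
move=> Sx; split.
  apply: rank_le_closed Sx => {}x [y [z [Cy Cz ->]]].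
  apply: leq_trans (mxrank_add _ _) _; rewrite mul2n -addnn -re.
  by apply: leq_add; apply: (orbit_cone_invariants tre _).1.
apply: tr0_closed Sx => {}x [y [z [Cy Cz ->]]].
by rewrite mxtraceD !(orbit_cone_invariants tre _).2 ?addr0.
Qed.

End SecantCone.

(** * Generic pairs and their centralisers *)

Section GenericPairs.
Variable k : closedFieldType.

Definition commutes N (z : 'M[k]_N) (u : 'M[k]_N * 'M[k]_N) : Prop :=
  z *m u.1 = u.1 *m z /\ z *m u.2 = u.2 *m z.

(* If the trace Gram matrix of these n^2 words is nonsingular, then they are
   linearly independent, hence span the matrix algebra they live in. *)
Definition word N n (x y : 'M[k]_N) (i : nat) : 'M[k]_N :=
  (x + y) ^+ (i %/ n) *m (x *m x) *m (x + y) ^+ (i %% n).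

Definition word_gram N n (x y : 'M[k]_N) : 'M[k]_(n * n) :=
  \matrix_(i, l) \tr (word n x y i *m word n x y l).

Lemma commute_word N n (x y z : 'M[k]_N) i : commutes z (x, y) ->
  z *m word n x y i = word n x y i *m z.
Proof.
move=> [/= zx zy].
have cm a b : z *m a = a *m z -> z *m b = b *m z -> z *m (a *m b) = a *m b *m z.
  by move=> e1 e2; rewrite mulmxA e1 -mulmxA e2 mulmxA.
have zs : z *m (x + y) = (x + y) *m z by rewrite mulmxDr mulmxDl zx zy.
have zp a : z *m (x + y) ^+ a = (x + y) ^+ a *m z.
  elim: a => [|a IH]; first by rewrite expr0 mulmx1 mul1mx.
  by rewrite exprS; apply: cm.
by apply: (cm) => //; apply: (cm) => //; apply: cm.
Qed.

Lemma mxtrace_mul_sum n (m' B : 'M[k]_n) :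
  \tr (m' *m B) = \sum_l mxvec m' 0 l * \tr (vec_mx (delta_mx 0 l) *m B).
Proof.
rewrite -{1}(mxvecK m') {1}(row_sum_delta (mxvec m')) linear_sum /= mulmx_suml raddf_sum /=.
by apply: eq_bigr => l _; rewrite linearZ /= -scalemxAl mxtraceZ.
Qed.

Lemma scalar_of_commute n (p : 'M[k]_n) : (forall m, p *m m = m *m p) ->
  exists a, p = a%:M.
Proof.
case: n p => [|n] p hp; first by exists 0; rewrite [LHS]flatmx0 [RHS]flatmx0.
exists (p 0 0); apply/matrixP => i l.
have := congr1 (fun m : 'M_(n.+1) => m i 0) (hp (delta_mx l 0)).
rewrite !mxE (bigD1 l) //= mxE !eqxx mulr1 big1 ?addr0 => [->|c cl]; last first.
  by rewrite mxE (negbTE cl) mulr0.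
rewrite (bigD1 0) //= mxE eqxx andbT big1 ?addr0 => [|c c0]; last first.
  by rewrite mxE (negbTE c0) andbF mul0r.
by case: eqP; rewrite ?mul1r ?mul0r // mulr1n.
Qed.

Section Factored.
Variables (n q : nat).
Variables (A : 'M[k]_(n + q, n)) (R : 'M[k]_(n, n + q)) (x1 y1 : 'M[k]_n).
Variables (x y : 'M[k]_(n + q)) (c d : k).
Hypotheses (xE : x = A *m x1 *m R) (yE : y = A *m y1 *m R).
Hypothesis gram : \det (word_gram n (c *: x) (d *: y)) != 0.
Let M := R *m A.

Let wordE i : exists m, word n (c *: x) (d *: y) i = A *m m *m R.
Proof.
have sE : c *: x + d *: y = A *m (c *: x1 + d *: y1) *m R.
  by rewrite mulmxDr mulmxDl -!scalemxAr -!scalemxAl xE yE.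
have lE m a : exists m', (c *: x + d *: y) ^+ a *m (A *m m *m R) = A *m m' *m R.
  elim: a => [|a [m' IH]]; first by exists m; rewrite expr0 mul1mx.
  exists ((c *: x1 + d *: y1) *m M *m m').
  by rewrite exprS -[_ * _]/(_ *m _) -mulmxA IH sE /M !mulmxA.
have rE m a : exists m', (A *m m *m R) *m (c *: x + d *: y) ^+ a = A *m m' *m R.
  elim: a => [|a [m' IH]]; first by exists m; rewrite expr0 mulmx1.
  exists (m' *m M *m (c *: x1 + d *: y1)).
  by rewrite exprSr -[_ * _]/(_ *m _) mulmxA IH sE /M !mulmxA.
have xxE : (c *: x) *m (c *: x) = A *m (c ^+ 2 *: (x1 *m M *m x1)) *m R.
  rewrite -scalemxAl -!scalemxAr scalerA -expr2 -scalemxAl xE /M !mulmxA.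
  by [].
have [m1 m1E] := lE (c ^+ 2 *: (x1 *m M *m x1)) (i %/ n)%N.
have [m2 m2E] := rE m1 (i %% n)%N.
by exists m2; rewrite /word xxE m1E m2E.
Qed.

(** The Gram matrix factors as [WW Z], where row i of [WW] is W_i and column l of [Z] is the
    functional m |-> tr(m M W_l M). Invertibility of [WW] makes the W_i a basis of all n x n
    matrices, and that of [Z] forces [M] to be invertible. *)
Let coreE : exists W : 'I_(n * n) -> 'M[k]_n,
  [/\ forall i : 'I_(n * n), word n (c *: x) (d *: y) i = A *m W i *m R, M \in unitmx &
      forall m, exists co : 'I_(n * n) -> k, m = \sum_i co i *: W i].
Proof.
have [W WE] := choice (fun i : 'I_(n * n) => wordE i); exists W.
pose WW : 'M_(n * n) := \matrix_i mxvec (W i).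
pose Z : 'M_(n * n) := \matrix_(l, i) \tr (vec_mx (delta_mx 0 l) *m (M *m W i *m M)).
have GE : word_gram n (c *: x) (d *: y) = WW *m Z.
  apply/matrixP => i l; rewrite !mxE !WE.
  have -> : A *m W i *m R *m (A *m W l *m R) = A *m (W i *m (M *m W l *m R)).
    by rewrite /M !mulmxA.
  rewrite mxtrace_mulC -(mulmxA (W i)) mxtrace_mul_sum.
  have -> : M *m W l *m R *m A = M *m W l *m M by rewrite /M !mulmxA.
  by apply: eq_bigr => a _; rewrite !mxE.
have : WW *m Z \in unitmx by rewrite -GE unitmxE unitfE.
rewrite unitmx_mul => /andP[uWW uZ]; split=> //.
- rewrite unitmxE unitfE; apply: contraT; rewrite negbK => dM.
  have nf : ~~ row_free M by rewrite row_free_unit unitmxE unitfE negbK.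
  have /row_subPn [i] : ~~ (kermx M <= (0 : 'M_n))%MS.
    by rewrite submx0 kermx_eq0.
  rewrite submx0; set v := row i _ => v0.
  have vM : v *m M = 0 by rewrite -row_mul mulmx_ker row0.
  have [u vu] := nonzero_right_inv v0.
  (* If [v M = 0], every functional tr(m M W_l M) vanishes on the nonzero matrix [u v]. *)
  have E : mxvec (u *m v) *m Z = 0.
    apply/rowP => l; rewrite !mxE.
    transitivity (\tr (u *m v *m (M *m W l *m M))).
      by rewrite mxtrace_mul_sum; apply: eq_bigr => a _; rewrite !mxE.
    by rewrite -(mulmxA u v) -(mulmxA M) (mulmxA v M) vM mul0mx mulmx0 mxtrace0.
  have : mxvec (u *m v) = 0 by rewrite -[LHS](mulmxK uZ) E mul0mx.
  move=> /(congr1 vec_mx); rewrite mxvecK linear0 => uv0.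
  have : v *m (u *m v) *m u = 0 by rewrite uv0 mulmx0 mul0mx.
  by rewrite !mulmxA vu mul1mx vu => /eqP; rewrite oner_eq0.
- move=> m; exists (fun i => (mxvec m *m invmx WW) 0 i).
  have mE : m = vec_mx (mxvec m *m invmx WW *m WW) by rewrite mulmxKV // mxvecK.
  rewrite [LHS]mE [X in vec_mx X]mulmx_sum_row linear_sum /=.
  by apply: eq_bigr => i _; rewrite linearZ /= rowK mxvecK.
Qed.

(** Since [M = R A] is invertible, the space is the direct sum of the image of [A] and the kernel of
    [R]. The words span all [A m R], the full matrix algebra of the first summand extended by
    zero. *)
Lemma generic_centraliser : exists2 g, g \in unitmx & forall z,
  commutes z (x, y) <-> exists a h, z = mxconj g (block_mx a%:M 0 0 h).
Proof.
have [W [WE uM span]] := coreE.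
have rR : \rank R = n.
  by apply: (@right_inv_rank _ _ _ R (A *m invmx M)); rewrite mulmxA -/M mulmxV.
have r1 : \rank (row_mx 1%:M 0 : 'M[k]_(n, n + q)) = n.
  by apply: (@right_inv_rank _ _ _ _ (col_mx 1%:M 0)); rewrite mul_row_col mulmx1 mulmx0 addr0.
have [H uH HE] := row_transport r1 rR.
pose G2 : 'M_(n + q, q) := invmx H *m col_mx 0 1%:M.
have RG2 : R *m G2 = 0.
  by rewrite /G2 mulmxA -HE mulmxK // mul_row_col mulmx0 mul0mx addr0.
pose g := row_mx A G2.
have ug : g \in unitmx.
  have e : col_mx R (row_mx 0 1%:M *m H) *m g =
     block_mx M 0 (row_mx 0 1%:M *m H *m A) 1%:M.
    rewrite /g mul_col_row RG2 /G2 [X in block_mx _ _ _ X]mulmxA mulmxK //.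
    by rewrite mul_row_col mul0mx add0r mulmx1.
  have : block_mx M 0 (row_mx 0 1%:M *m H *m A) 1%:M \in unitmx.
    by rewrite unitmxE det_lblock det1 mulr1 -unitmxE.
  by rewrite -e unitmx_mul => /andP[].
have gE m : A *m m *m R = mxconj g (block_mx (m *m M) 0 0 0).
  symmetry; apply: mxconj_eq => //.
  rewrite /g mul_row_block !mulmx0 !addr0 mul_mx_row -(mulmxA _ R G2) RG2 mulmx0.
  by rewrite !mulmxA.
exists g => // z; split.
- move=> zc; have zA m : z *m (A *m m *m R) = A *m m *m R *m z.
    have [co ->] := span m.
    have -> : A *m (\sum_i co i *: W i) *m R = \sum_i co i *: word n (c *: x) (d *: y) i.
      rewrite mulmx_sumr mulmx_suml; apply: eq_bigr => i _.
      by rewrite WE -scalemxAr -scalemxAl.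
    rewrite mulmx_sumr mulmx_suml; apply: eq_bigr => i _.
    rewrite -scalemxAr -scalemxAl commute_word //.
    by case: zc => /= zx zy; split; rewrite /= -scalemxAr -scalemxAl ?zx ?zy.
  pose z' := mxconj (invmx g) z.
  have zE : z = mxconj g z' by rewrite mxconjVK.
  have z'c m : z' *m block_mx m 0 0 0 = block_mx m 0 0 0 *m z'.
    have := zA (m *m invmx M); rewrite gE mulmxKV // => e.
    by rewrite -[block_mx _ _ _ _](mxconjK _ ug) -!mxconj_mul ?unitmx_inv // e.
  have bE m : [/\ ulsubmx z' *m m = m *m ulsubmx z', m *m ursubmx z' = 0 & dlsubmx z' *m m = 0].
    have := z'c m; rewrite -[z']submxK !mulmx_block !mulmx0 !mul0mx !addr0.
    by move=> /eq_block_mx [e1 e2 e3 _]; rewrite !submxK.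
  have [a aE] : exists a, ulsubmx z' = a%:M.
    by apply: scalar_of_commute => m; have [] := bE m.
  exists a, (drsubmx z'); rewrite zE -[z' in LHS]submxK aE.
  have [_ e2 e3] := bE 1%:M; rewrite mul1mx in e2; rewrite mulmx1 in e3.
  by rewrite e2 e3.
- move=> [a [h ->]].
  have E m : mxconj g (block_mx a%:M 0 0 h) *m (A *m m *m R) =
     A *m m *m R *m mxconj g (block_mx a%:M 0 0 h).
    rewrite gE -!mxconj_mul // !mulmx_block !mulmx0 !mul0mx !addr0.
    by rewrite mul_scalar_mx mul_mx_scalar.
  by split; rewrite /= ?xE ?yE.
Qed.

End Factored.

Lemma stabiliserP N (u : 'M[k]_N * 'M[k]_N) g : SL N g ->
  (mxconj g u.1 = u.1 /\ mxconj g u.2 = u.2) <-> commutes g u.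
Proof.
move=> /SL_unit ug; split.
  by case=> e1 e2; split; [rewrite -{2}e1|rewrite -{2}e2]; rewrite /mxconj mulmxKV.
by case=> e1 e2; split; apply: mxconj_eq.
Qed.

Lemma stabiliser_transport N (u v : 'M[k]_N * 'M[k]_N) (g : 'M[k]_N) : (0 < N)%N ->
  g \in unitmx -> (forall z, commutes z v <-> exists2 z', commutes z' u & z = mxconj g z') ->
  exists2 h, SL N h & stabiliser v = [set mxconj h z | z in stabiliser u].
Proof.
move=> N0 ug H; have [a a0 SLa] := SL_scale N0 ug.
exists (a *: g) => //; apply/seteqP; split=> z.
- move=> [SLz e1 e2]; have /H [z' z'u zE] : commutes z v by apply/(stabiliserP v SLz).
  exists z'; last by rewrite mxconj_scale.
  have SLz' : SL N z'.
    move: SLz; rewrite zE /SL /= /mxconj !det_mulmx mulrAC -det_mulmx mulmxV // det1 mul1r.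
    by [].
  by have [] := (stabiliserP u SLz').2 z'u; split.
- move=> [z' [SLz' e1 e2] <-]; rewrite mxconj_scale //.
  have SLz : SL N (mxconj g z').
    rewrite /SL /= /mxconj !det_mulmx mulrAC -det_mulmx mulmxV // det1 mul1r.
    by [].
  have [] := (stabiliserP v SLz).2; last by split.
  by apply/H; exists z' => //; apply/(stabiliserP u SLz').
Qed.

Lemma isotropyP N (u : 'M[k]_N * 'M[k]_N) z : isotropy u z <-> \tr z = 0 /\ commutes z u.
Proof.
split=> [[tz e1 e2]|[tz [e1 e2]]].
  by split=> //; split; apply/eqP; rewrite -subr_eq0; apply/eqP.
by split=> //; rewrite /lie ?e1 ?e2 subrr.
Qed.

Lemma polyfun_gram N n c d :
  polyfun (fun t : 'M[k]_(N, N + N) => \det (word_gram n (c *: lsubmx t) (d *: rsubmx t))).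
Proof.
have A := polyfun_funalg k N (N + N).
have Px : mxfun (@polyfun k N (N + N)) (fun t => c *: lsubmx t).
  apply: (mxfun_scale A); first exact: (fa_const A).
  by apply: mxfun_lsub; exact: mxfun_id.
have Py : mxfun (@polyfun k N (N + N)) (fun t => d *: rsubmx t).
  apply: (mxfun_scale A); first exact: (fa_const A).
  by apply: mxfun_rsub; exact: mxfun_id.
have Pw i : mxfun (@polyfun k N (N + N)) (fun t => word n (c *: lsubmx t) (d *: rsubmx t) i).
  apply: (mxfun_mul A); last by apply: (mxfun_exp A); apply: (mxfun_add A).
  apply: (mxfun_mul A); last exact: (mxfun_mul A).
  by apply: (mxfun_exp A); apply: (mxfun_add A).
apply: (fa_det A) => i l.
have := fa_tr A (mxfun_mul A (Pw i) (Pw l)).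
by congr polyfun; apply: funext => t; rewrite [RHS]mxE.
Qed.

(* The edges of the n-cycle [l |-> l + 1] are shared between two nilpotent
   matrices; only [0 -> 1 -> 2] are consecutive edges of the first one. *)
Definition cyc_part (b : bool) n (i l : nat) : k :=
  if [&& (i < n)%N, (l < n)%N & ((l == 0%N) || odd l && (l != n.-1)) == b]
  then (i == cyc n l)%:R else 0.

Lemma cycP n l : (l = n.-1 /\ cyc n l = 0%N) \/ (l <> n.-1 /\ cyc n l = l.+1).
Proof. by rewrite /cyc; case: eqP; [left|right]. Qed.

(** The first part has nonzero rows 1, 2, 4, ..., and among these indices its only edge is 1 -> 2.
    The second has nonzero rows 0, 3, 5, ..., with the edge n - 1 -> 0 among them if n is even and
    none if n is odd. *)
Lemma cyc_parts_mem N n q (C : set 'M[k]_N) (e : 'M[k]_N) j : N = (n + q)%N ->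
  stable_cone C -> C e -> nilpotent_mx e -> e *m e != 0 -> (1 < j <= \rank e)%N ->
  (n = 2 * j)%N \/ (n.+1 = 2 * j /\ q = 0)%N ->
  C (natmx N N (cyc_part true n)) /\ C (natmx N N (cyc_part false n)).
Proof.
move=> NE SC Ce ne e2 jr nj; have [j1 _] := andP jr.
have jN : (2 * j <= N.+1)%N by lia.
have sum0 (i1 i2 : nat) : i1 <> i2 ->
    \sum_(c < j) ((c == i1 :> nat)%:R : k) * (c == i2 :> nat)%:R = 0.
  move=> i12; apply: big1 => c _; case: eqP => [->|]; last by rewrite mul0r.
  by case: eqP => [/i12//|]; rewrite mulr0.
split.
- apply: (sel_mem SC Ce ne e2 jr jN (w := fun c => if c == 0%N then 1%N else c.*2)
       (a := fun c => (c == 1%N)%:R) (b := fun d => (d == 0%N)%:R)).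
  + by move=> d dj; case: eqP; lia.
  + by move=> d d' dj d'j; case: eqP; case: eqP; lia.
  + move=> i l iN lN H; rewrite /cyc_part; case: ifP => // /and3P[i_n l_n lb].
    have [i1|i1] := eqVneq i 1%N; first by have /= := H 0%N (ltnW j1).
    case: eqP => // iE; have [[lE cE]|[lE cE]] := cycP n l; rewrite cE in iE; first by lia.
    case: (H i./2); first by lia.
    have -> : (i./2 == 0)%N = false by lia.
    by lia.
  + move=> c d cj dj; rewrite /cyc_part /cyc.
    have [_|d0] := eqVneq d 0%N.
      rewrite mulr1 /=.
      have -> : (1 == n.-1)%N = false by lia.
      have -> : (1 < n)%N by lia.
      have -> : ((if c == 0%N then 1%N else c.*2) < n)%N by case: eqP; lia.
      rewrite /=; congr (nat_of_bool _)%:R; have [->//|c0] := posnP c.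
      by lia.
    rewrite mulr0 (_ : (_ == true) = false) ?andbF //.
    by apply/negbTE; lia.
  + by apply: sum0.
- case: nj => [nE|[nE q0]].
  + apply: (sel_mem SC Ce ne e2 jr jN (w := fun c => if c == 0%N then 0%N else c.*2.+1)
       (a := fun c => (c == 0%N)%:R) (b := fun d => (d == j.-1)%:R)).
    * by move=> d dj; case: eqP; lia.
    * by move=> d d' dj d'j; case: eqP; case: eqP; lia.
    * move=> i l iN lN H; rewrite /cyc_part; case: ifP => // /and3P[i_n l_n lb].
      have [i0|i0] := eqVneq i 0%N; first by have /= := H 0%N (ltnW j1).
      case: eqP => // iE; have [[lE cE]|[lE cE]] := cycP n l; rewrite cE in iE; first by lia.
      case: (H i./2); first by lia.
      have -> : (i./2 == 0)%N = false by lia.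
    by lia.
    * move=> c d cj dj; rewrite /cyc_part /cyc.
      have [->|d1] := eqVneq d j.-1.
        rewrite mulr1 /=.
        have -> : (j.-1 == 0)%N = false by lia.
        have -> : ((j.-1).*2.+1 == n.-1)%N by lia.
        have -> : ((j.-1).*2.+1 < n)%N by lia.
        have -> : ((if c == 0%N then 0%N else c.*2.+1) < n)%N by case: eqP; lia.
        by rewrite /= andbF /=; case: (posnP c).
      rewrite mulr0; case: ifP => // /and3P[_ _].
      by case: (d == 0%N) => /=; lia.
    * by apply: sum0; lia.
  (* For n = 2j - 1 there are only j - 1 nonzero rows; row 1, which is zero in this part, fills the
     place [j.-1]. *)
  + apply: (sel_mem SC Ce ne e2 jr jN
       (w := fun c => if c == 0%N then 0%N else if c == j.-1 then 1%N else c.*2.+1)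
       (a := fun c => 0) (b := fun d => 0)).
    * by move=> d dj; do 2?(case: ifP => ?); lia.
    * by move=> d d' dj d'j; do 4?(case: ifP => ?); lia.
    * move=> i l iN lN H; rewrite /cyc_part; case: ifP => // /and3P[i_n l_n lb].
      have [i0|i0] := eqVneq i 0%N; first by have /= := H 0%N (ltnW j1).
      case: eqP => // iE; have [[lE cE]|[lE cE]] := cycP n l; rewrite cE in iE; first by lia.
      case: (H i./2); first by lia.
      have -> : (i./2 == 0)%N = false by lia.
      have -> : (i./2 == j.-1)%N = false by lia.
      by lia.
    * move=> c d cj dj; rewrite /cyc_part /cyc mul0r; case: ifP => // /and3P[_ _].
      by do 2 (case: ifP); lia.
    * by apply: big1 => d _; rewrite mul0r.
Qed.

End GenericPairs.

(** * The Gram determinant of the explicit cyclic pair *)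

Section GenericIsotropy.
Variable k : closedFieldType.

Lemma cyc_mod n m : (m < n)%N -> cyc n m = (m.+1 %% n)%N.
Proof.
move=> mn; have [[-> ->]|[mE ->]] := cycP n m.
  by rewrite prednK ?modnn // (leq_ltn_trans _ mn).
by rewrite modn_small //; lia.
Qed.

(** The solution p < n of 2 + p + m = 0 modulo n. For m = n - 1 the sum is 2n, and the subtraction
    of the other branch would be truncated. *)
Definition opp2 n m := if m == n.-1 then n.-1 else (n - 2 - m)%N.

Lemma opp2_lt n m : (1 < n)%N -> (opp2 n m < n)%N.
Proof. by rewrite /opp2; case: ifP => ?; lia. Qed.

Lemma opp2P n p m : (1 < n)%N -> (p < n)%N -> (m < n)%N ->
  (((2 + p + m) %% n)%N == 0%N) = (p == opp2 n m).
Proof.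
move=> n1 pn mn; rewrite /opp2 -/(n %| 2 + p + m)%N.
apply/idP/eqP => [/dvdnP [[|[|[|q]]] E]|]; [by lia| | |by nia|].
- by case: ifP => ?; lia.
- by case: ifP => ?; lia.
case: ifP => mE ->.
  by apply/dvdnP; exists 2%N; lia.
by apply/dvdnP; exists 1%N; lia.
Qed.

Lemma opp2_inj n m m' : (1 < n)%N -> (m < n)%N -> (m' < n)%N ->
  opp2 n m = opp2 n m' -> m = m'.
Proof. by move=> n1 mn mn'; rewrite /opp2; do 2 (case: ifP => ?); lia. Qed.

Section Example.
Variables n q : nat.
Hypothesis n2 : (2 < n)%N.
Let N := (n + q)%N.
Let X : 'M[k]_N := natmx N N (cyc_part k true n).
Let Y : 'M[k]_N := natmx N N (cyc_part k false n).
Let e_ (i : nat) := selmx k N 1 (fun=> i).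

Let cyc_sum : X + Y = natmx N N (fun i l => if (i < n)%N && (l < n)%N then (i == cyc n l)%:R else 0).
Proof.
rewrite natmxD; apply: eq_natmx => i l _ _; rewrite /cyc_part.
case: (i < n)%N; case: (l < n)%N; rewrite /= ?addr0 //.
by case: ((l == 0%N) || _); rewrite /= ?addr0 ?add0r.
Qed.

Let powE a i : (i < n)%N -> (X + Y) ^+ a *m e_ i = e_ ((i + a) %% n)%N.
Proof.
move=> i_n; have n0 : (0 < n)%N by lia.
elim: a => [|a IH]; first by rewrite expr0 mul1mx addn0 modn_small.
rewrite exprS -[_ * _]/(_ *m _) -mulmxA IH cyc_sum.
have mn : ((i + a) %% n < n)%N by rewrite ltn_mod.
rewrite natmx_sel => [|c _]; last by rewrite (leq_trans mn) // leq_addr.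
have -> : ((i + a.+1) %% n)%N = cyc n ((i + a) %% n).
  by rewrite cyc_mod // addnS -[in LHS]addn1 -modnDml addn1.
apply: eq_natmx => r c _ _; rewrite mn andbT.
case: ltnP => // nr; case: eqP => // rE.
by have := cyc_lt n0 mn; rewrite -rE ltnNge nr.
Qed.

Let XX : X *m X = e_ 2%N *m (e_ 0%N)^T.
Proof.
have N2 : (2 < N)%N by rewrite (leq_trans n2) // leq_addr.
have N1 : (1 < N)%N by lia.
apply/matrixP => i l; rewrite [RHS]mxE big_ord1 [LHS]mxE.
rewrite [(_^T) _ _]mxE ![e_ _ _ _]mxE.
have [l0|l0] := eqVneq (l : nat) 0%N; last first.
  rewrite mulr0 big1 // => r _; rewrite !mxE /cyc_part.
  case: ifP => rP; last by rewrite mul0r.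
  case: ifP => [/and3P[rn ln lP]|_]; last by rewrite mulr0.
  case: (r =P cyc n l :> nat) => rE; last by rewrite mulr0.
  have [[lE cE]|[lE cE]] := cycP n l; rewrite cE in rE; first by lia.
  by case/and3P: rP => _ _; lia.
rewrite /= mulr1 (bigD1 (Ordinal N1)) //= big1 ?addr0 => [|r].
  rewrite !mxE /cyc_part l0 /=.
  have n1 : (1 < n)%N by lia.
  have n0 : (0 < n)%N by lia.
  have c0 : cyc n 0 = 1%N by rewrite /cyc; case: eqP; lia.
  have c1 : cyc n 1 = 2%N by rewrite /cyc; case: eqP; lia.
  have nn : (1%N != n.-1) by lia.
  rewrite n1 n0 c0 c1 nn mulr1 !andbT.
  by case: ltnP => // ni; case: eqP => // iE; lia.
rewrite -val_eqE /= => r1; rewrite !mxE /cyc_part l0.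
have c0 : cyc n 0 = 1%N by rewrite /cyc; case: eqP; lia.
by rewrite c0 (negbTE r1); case: ifP; case: ifP; rewrite mulr0.
Qed.

(** [X + Y] acts as the n-cycle and [X X] only sends e_0 to e_2. Hence the words with exponents (a,
    b) and (c, d) have trace pairing 1 if n divides 2 + b + c and 2 + d + a, and 0 otherwise: the
    Gram matrix is a permutation matrix. *)
Lemma cyc_gram : \det (word_gram n X Y) != 0.
Proof.
have n1 : (1 < n)%N by lia.
have n0 : (0 < n)%N by lia.
pose w l := (opp2 n (l %% n) * n + opp2 n (l %/ n))%N.
have nn0 : (0 < n * n)%N by rewrite muln_gt0 n0.
have dn l : (l < n * n)%N -> (l %/ n < n)%N by move=> ln; rewrite ltn_divLR.
have wlt l : (l < n * n)%N -> (w l < n * n)%N.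
  move=> ln; rewrite /w.
  have h1 := opp2_lt (l %% n)%N n1; have h2 := opp2_lt (l %/ n)%N n1.
  by nia.
have winj l l' : (l < n * n)%N -> (l' < n * n)%N -> w l = w l' -> l = l'.
  move=> ln ln' E.
  have E1 : opp2 n (l %% n)%N = opp2 n (l' %% n)%N.
    have := congr1 (fun m => m %/ n)%N E.
    rewrite /w !divnMDl // (divn_small (opp2_lt (l %/ n)%N n1)).
    by rewrite (divn_small (opp2_lt (l' %/ n)%N n1)) !addn0.
  have E2 : opp2 n (l %/ n)%N = opp2 n (l' %/ n)%N.
    have := congr1 (fun m => m %% n)%N E.
    rewrite /w !modnMDl (modn_small (opp2_lt (l %/ n)%N n1)).
    by rewrite (modn_small (opp2_lt (l' %/ n)%N n1)).
  rewrite (divn_eq l n) (divn_eq l' n).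
  by rewrite (opp2_inj n1 _ _ E1) ?ltn_mod // (opp2_inj n1 _ _ E2) ?dn.
suff -> : word_gram n X Y = selmx k (n * n) (n * n) w.
  by have /mulmx1_unit [_ /unit_det] := trsel_sel k wlt winj.
apply/matrixP => i l; rewrite [RHS]mxE [LHS]mxE.
set a := (i %/ n)%N; set b := (i %% n)%N; set c := (l %/ n)%N; set d := (l %% n)%N.
have an : (a < n)%N by apply: dn.
have bn : (b < n)%N by rewrite ltn_mod.
have cn : (c < n)%N by apply: dn.
have d_n : (d < n)%N by rewrite ltn_mod.
have phi s : ((e_ 0%N)^T *m ((X + Y) ^+ s *m e_ 2%N)) = (((2 + s) %% n == 0)%N)%:R%:M.
  rewrite powE // trsel_natmx => [|? _]; last by rewrite (leq_trans n0) // leq_addr.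
  by apply/matrixP => r r'; rewrite !ord1 !mxE eqxx mulr1n eq_sym.
have phi2 s t : (e_ 0%N)^T *m (X + Y) ^+ s *m ((X + Y) ^+ t *m e_ 2%N) =
   (((2 + s + t) %% n == 0)%N)%:R%:M.
  by rewrite -addnA -phi exprD -[_ * _]/(_ *m _) !mulmxA.
have -> : word n X Y i *m word n X Y l = ((X + Y) ^+ a *m e_ 2%N) *m
    ((e_ 0%N)^T *m (X + Y) ^+ b *m ((X + Y) ^+ c *m e_ 2%N)) *m ((e_ 0%N)^T *m (X + Y) ^+ d).
  by rewrite /word -/a -/b -/c -/d XX !mulmxA.
rewrite phi2 mul_mx_scalar -scalemxAl mxtraceZ mxtrace_mulC phi2 mxtrace_scalar mulr1n.
rewrite -natrM mulnb opp2P // addnAC opp2P //; congr (nat_of_bool _)%:R.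
apply/andP/eqP => [[/eqP bE /eqP aE]|iE].
  by rewrite /w -/c -/d -aE -bE /a /b -divn_eq.
rewrite /a /b iE /w -/c -/d divnMDl // modnMDl.
by rewrite (divn_small (opp2_lt c n1)) (modn_small (opp2_lt c n1)) addn0.
Qed.

End Example.
End GenericIsotropy.

(** * Isotropy subalgebras of the orbits with nonzero square *)

Section IsotropyTypes.
Variable k : closedFieldType.
Hypothesis char0 : [pchar k] =i pred0.

Lemma natr_neq0 n : (0 < n)%N -> n%:R != 0 :> k.
Proof. by move=> n0; rewrite ((pcharf0P k).1 char0) -lt0n. Qed.

Definition iso_model n q (g : 'M[k]_(n + q)) : set 'M[k]_(n + q) :=
  [set z | exists a h, a *+ n + \tr h = 0 /\ z = mxconj g (block_mx a%:M 0 0 h)].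

Lemma generic_isotropy_orbit n q (e : 'M[k]_(n + q)) j (P : set 'M[k]_(n + q) -> Prop) :
  let O := orbit_of (SL (n + q)) e in
  nilpotent_mx e -> e *m e != 0 -> (1 < j <= \rank e)%N ->
  (n = 2 * j)%N \/ (n.+1 = 2 * j /\ q = 0)%N ->
  (forall x y, O x -> O y -> exists (A : 'M_(n + q, n)) (R : 'M_(n, n + q)) (x1 y1 : 'M_n),
     x = A *m x1 *m R /\ y = A *m y1 *m R) ->
  (forall g, g \in unitmx -> P (iso_model g)) ->
  generic_isotropy O P.
Proof.
move=> O ne e2 jr nj fact HP.
have [j1 _] := andP jr; have n2 : (2 < n)%N by lia.
have N0 : (0 < n + q)%N by lia.
(* The cyclic pair lies only in the closed cone, so orbit elements with nonzero Gram determinant are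
   obtained only up to scalars c and d. *)
pose Fam (f : 'M[k]_(n + q, n + q + (n + q)) -> k) := exists c d,
  f = fun t => \det (word_gram n (c *: lsubmx t) (d *: rsubmx t)).
pose U := [set u | (O `*` O) u /\ exists2 f, Fam f & f (pair_mx u) != 0].
have PF f : Fam f -> polyfun f by move=> [c [d ->]]; exact: polyfun_gram.
have exF : exists f x y, [/\ Fam f, O x, O y & f (row_mx x y) != 0].
  have SC : stable_cone (closed_cone O) by exact: closed_cone_stable.
  have Ce : closed_cone O e by apply: sub_closed_cone; exact: orbit_self.
  have [h1 h2] := cyc_parts_mem erefl SC Ce ne e2 jr nj.
  have [|c [x [d [y [_ Ox _ Oy H]]]]] :=
      closed_cone_nonzero2 (polyfun_gram (n + q) n 1 1) h1 h2.
    by rewrite row_mxKl row_mxKr !scale1r; exact: cyc_gram.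
  exists (fun t => \det (word_gram n (c *: lsubmx t) (d *: rsubmx t))), x, y.
  split=> //; first by exists c, d.
  by move: H; rewrite !row_mxKl !row_mxKr !scale1r.
have cent u : U u -> exists2 g, g \in unitmx &
    forall z, commutes z u <-> exists a h, z = mxconj g (block_mx a%:M 0 0 h).
  case: u => x y [[/= Ox Oy] [_ [c [d ->]]]].
  rewrite /pair_mx /= row_mxKl row_mxKr => gram.
  have [A [R [x1 [y1 [xE yE]]]]] := fact x y Ox Oy.
  exact: generic_centraliser xE yE gram.
have [Uo Ud] := @generic_locus k (n + q) e N0 Fam PF exF.
exists U; split=> // [u v Uu Uv|u Uu].
  have [gu ugu Hu] := cent u Uu; have [gv ugv Hv] := cent v Uv.
  have ugu' : invmx gu \in unitmx by rewrite unitmx_inv.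
  apply: (@stabiliser_transport _ _ u v (gv *m invmx gu)) => // [|z].
    by rewrite unitmx_mul ugv.
  rewrite Hv; split=> [[a [h ->]]|[z' /Hu [a [h ->]] ->]].
    exists (mxconj gu (block_mx a%:M 0 0 h)); first by apply/Hu; exists a, h.
    by rewrite mxconjM // mxconjK.
  by exists a, h; rewrite mxconjM // mxconjK.
have [g ug Hu] := cent u Uu.
suff -> : isotropy u = iso_model g by exact: HP.
have trE a h : \tr (mxconj g (block_mx a%:M 0 0 h)) = a *+ n + \tr h.
  by rewrite mxtrace_conj // mxtrace_block mxtrace_scalar.
apply/seteqP; split=> z.
  move=> /isotropyP [trz /Hu [a [h zE]]]; exists a, h; split=> //.
  by rewrite -trE -zE.
move=> [a [h [tr0 zE]]]; apply/isotropyP; split; first by rewrite zE trE.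
by apply/Hu; exists a, h.
Qed.

Lemma mxtrace_lie m (u v : 'M[k]_m) : \tr (lie u v) = 0.
Proof. by rewrite /lie raddfB /= mxtrace_mulC subrr. Qed.

Lemma mxconj_lie N (g x y : 'M[k]_N) : g \in unitmx ->
  mxconj g (lie x y) = lie (mxconj g x) (mxconj g y).
Proof.
move=> ug; rewrite /lie -!mxconj_mul //.
by rewrite -[RHS]addr0 -scaleN1r mxconjD mxconjZ scaleN1r addr0.
Qed.

(** The trace condition determines the scalar block as -tr(h) / n, where n is invertible in
    characteristic 0. *)
Lemma iso_gl_model n q (g : 'M[k]_(n + q)) : (0 < n)%N -> g \in unitmx ->
  iso_gl q (iso_model g).
Proof.
move=> n0 ug; have nn := natr_neq0 n0.
pose f (h : 'M[k]_q) := mxconj g (block_mx (- (n%:R)^-1 * \tr h)%:M 0 0 h).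
have flin : linear f.
  move=> a x y; rewrite /f -mxconjZ -mxconjD scale_block_mx add_block_mx !scaler0 !addr0.
  congr mxconj; congr block_mx.
  by rewrite scale_scalar_mx -raddfD /= mxtraceD mxtraceZ mulrDr mulrCA.
pose F : {linear 'M[k]_q -> 'M[k]_(n + q)} := HB.pack f (GRing.isLinear.Build _ _ _ _ f flin).
exists F; split.
- move=> x y /(congr1 (mxconj (invmx g))); rewrite !mxconjK //.
  by move=> /eq_block_mx [].
- apply/seteqP; split=> z.
    move=> [h _ <-]; exists (- (n%:R)^-1 * \tr h), h; split=> //.
    by rewrite -(mulr_natr (_ * _)) mulrAC mulNr mulVf // mulN1r addNr.
  move=> [a [h [tr0 ->]]]; exists h => //.
  rewrite /F /= /f; congr (mxconj g (block_mx _%:M 0 0 h)).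
  have -> : \tr h = - (a *+ n) by apply/eqP; rewrite -addr_eq0 addrC tr0.
  by rewrite mulrN mulNr opprK -(mulr_natl a n) mulKf.
- move=> u v; rewrite /F /= /f -mxconj_lie //; congr mxconj.
  rewrite mxtrace_lie mulr0 /lie !mulmx_block !mulmx0 !mul0mx !addr0 !add0r.
  by rewrite opp_block_mx add_block_mx !subr0 -!scalar_mxM mulrC subrr raddf0.
Qed.

Lemma generic_isotropy_small N (e : 'M[k]_N) j : nilpotent_mx e -> e *m e != 0 ->
  \rank e = j -> (2 * j <= N)%N ->
  generic_isotropy (orbit_of (SL N) e) (iso_gl (N - 2 * j)).
Proof.
move=> ne e2 re jN; have [q NE] : exists q, N = (j + j + q)%N by exists (N - 2 * j)%N; lia.
have -> : (N - 2 * j)%N = q by lia.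
have jr : (1 < j <= \rank e)%N by rewrite re leqnn -re sq_neq0_rank.
have [j1 _] := andP jr.
clear jN; subst N; apply: (generic_isotropy_orbit ne e2 jr); first by left; lia.
  move=> x y Ox Oy.
  have rx : \rank x = j by rewrite (orbit_invariants Ox).1.
  have ry : \rank y = j by rewrite (orbit_invariants Oy).1.
  (* Placing the rank factorisations of x and y side by side makes both factor through the same
     space of dimension 2j. *)
  have [A1 [R1 [-> _ _]]] := rank_factor rx; have [A2 [R2 [-> _ _]]] := rank_factor ry.
  exists (row_mx A1 A2), (col_mx R1 R2), (block_mx 1%:M 0 0 0), (block_mx 0 0 0 1%:M).
  by rewrite !mul_row_block !mulmx0 !addr0 !add0r !mulmx1 !mul_row_col !mul0mx addr0 add0r.
by move=> g ug; apply: iso_gl_model => //; lia.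
Qed.

Lemma generic_isotropy_big N (e : 'M[k]_N) : (0 < N)%N -> nilpotent_mx e -> e *m e != 0 ->
  (N <= 2 * \rank e)%N ->
  generic_isotropy (orbit_of (SL N) e) (fun s => s = [set 0]).
Proof.
move=> N0 ne e2 re; have re1 := sq_neq0_rank ne e2; have reN := nilp_rank_lt N0 ne.
have jr : (1 < uphalf N <= \rank e)%N by lia.
(* With n = N and q = 0, factoring through k^n is no condition on the pair. *)
have [n NE] : exists n, N = (n + 0)%N by exists N; rewrite addn0.
subst N; apply: (generic_isotropy_orbit ne e2 jr); first by lia.
  move=> x y _ _.
  have E (z : 'M[k]_(n + 0)) : z = col_mx 1%:M 0 *m ulsubmx z *m row_mx 1%:M 0.
    rewrite mul_col_mx mul1mx mul0mx mul_col_row !mulmx1 !mulmx0.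
    rewrite -[LHS]submxK; congr block_mx.
    - by rewrite [LHS]thinmx0.
    - by rewrite [LHS]flatmx0.
    - by rewrite [LHS]flatmx0.
  by exists (col_mx 1%:M 0), (row_mx 1%:M 0), (ulsubmx x), (ulsubmx y).
move=> g ug; apply/seteqP; split=> z /=.
  move=> [a [h [tr0 ->]]]; move: tr0; rewrite [h]flatmx0 mxtrace0 addr0 => an.
  have a0 : a = 0.
    apply/eqP; move/eqP: an; rewrite -mulr_natl mulf_eq0 (negbTE (natr_neq0 _)) //.
    by lia.
  by rewrite a0 raddf0 /mxconj block_mx0 mulmx0 mul0mx.
move=> ->; exists 0, 0; rewrite mul0rn mxtrace0 addr0; split=> //.
by rewrite raddf0 /mxconj block_mx0 mulmx0 mul0mx.
Qed.

End IsotropyTypes.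

(** * Characters and semi-invariants of the upper triangular group *)

Section Characters.
Variable k : closedFieldType.

Definition upper_mx N (b : 'M[k]_N) := forall i l : 'I_N, (l < i)%N -> b i l = 0.

Lemma upper_det N (b : 'M[k]_N) : upper_mx b -> \det b = \prod_(i < N) b i i.
Proof.
move=> ub; rewrite -det_tr det_trig; first by apply: eq_bigr => i _; rewrite mxE.
by apply/is_trig_mxP => i l il; rewrite mxE ub.
Qed.

Lemma upper_mul N (b c : 'M[k]_N) : upper_mx b -> upper_mx c -> upper_mx (b *m c).
Proof.
move=> ub uc i l li; rewrite mxE big1 // => r _.
have [ri|ir] := ltnP r i; first by rewrite ub // mul0r.
by rewrite uc ?mulr0 // (leq_trans li).
Qed.

Lemma upper_mul_diag N (b c : 'M[k]_N) i : upper_mx b -> upper_mx c ->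
  (b *m c) i i = b i i * c i i.
Proof.
move=> ub uc; rewrite mxE (bigD1 i) //= big1 ?addr0 // => r.
rewrite -val_eqE /= neq_ltn => /orP[ri|ir]; first by rewrite ub // mul0r.
by rewrite uc ?mulr0.
Qed.

Lemma upper_unit_diag N (b : 'M[k]_N) i : upper_mx b -> b \in unitmx -> b i i != 0.
Proof.
move=> ub; rewrite unitmxE unitfE upper_det // => /prodf_neq0; exact.
Qed.

Lemma upper_inv N (b : 'M[k]_N) : upper_mx b -> b \in unitmx -> upper_mx (invmx b).
Proof.
move=> ub ug; suff H d (i l : 'I_N) : (N - i <= d)%N -> (l < i)%N -> invmx b i l = 0.
  by move=> i l; apply: (H N); apply: leq_subr.
elim: d i l => [|d IH] i l; first by rewrite leqn0 subn_eq0 leqNgt ltn_ord.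
move=> id li; have := congr1 (fun M : 'M_N => M i l) (mulmxV ug).
rewrite !mxE (bigD1 i) //= big1 ?addr0 => [|r].
  rewrite -val_eqE /= (gtn_eqF li) => /eqP; rewrite mulf_eq0.
  by rewrite (negbTE (upper_unit_diag i ub ug)) => /eqP.
rewrite -val_eqE /= neq_ltn => /orP[ri|ir]; first by rewrite ub // mul0r.
by rewrite (IH r) ?mulr0 ?(ltn_trans li) //; have := ltn_ord r; lia.
Qed.

Lemma upper_inv_diag N (b : 'M[k]_N) i : upper_mx b -> b \in unitmx ->
  invmx b i i = (b i i)^-1.
Proof.
move=> ub ug; have := congr1 (fun M : 'M_N => M i i) (mulmxV ug).
rewrite upper_mul_diag //; last exact: upper_inv.
rewrite mxE eqxx => e; apply: (mulfI (upper_unit_diag i ub ug)).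
by rewrite e mulfV // upper_unit_diag.
Qed.

Lemma upper_SL_mul N (b c : 'M[k]_N) : upper_SL b -> upper_SL c -> upper_SL (b *m c).
Proof. by move=> [db ub] [dc uc]; split; [exact: SL_mul|exact: upper_mul]. Qed.

Lemma upper_SL_inv N (b : 'M[k]_N) : upper_SL b -> upper_SL (invmx b).
Proof.
by move=> [db ub]; split; [exact: SL_inv|apply: upper_inv => //; exact: SL_unit].
Qed.

(** Diagonal entries indexed by natural numbers; the value 1 out of range is neutral in products and
    inverses. *)
Definition dg N (b : 'M[k]_N) (l : nat) : k := if insub l is Some i then b i i else 1.

Lemma dgE N (b : 'M[k]_N) (i : 'I_N) : dg b i = b i i.
Proof. by rewrite /dg valK. Qed.

Lemma dg_mul N (b c : 'M[k]_N) l : upper_mx b -> upper_mx c ->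
  dg (b *m c) l = dg b l * dg c l.
Proof.
by move=> ub uc; rewrite /dg; case: insubP => [i _ _|_]; rewrite ?mulr1 // upper_mul_diag.
Qed.

Lemma dg1 N l : dg (1%:M : 'M[k]_N) l = 1.
Proof. by rewrite /dg; case: insubP => // i _ _; rewrite mxE eqxx. Qed.

Lemma dg_prod N (b : 'M[k]_N) : upper_SL b -> \prod_(l < N) dg b l = 1.
Proof.
by move=> [db ub]; rewrite -[RHS]db upper_det //; apply: eq_bigr => i _; rewrite dgE.
Qed.

Lemma dg_neq0 N (b : 'M[k]_N) l : upper_SL b -> dg b l != 0.
Proof.
move=> [/SL_unit ub up]; rewrite /dg; case: insubP => [i _ _|_]; last exact: oner_neq0.
exact: upper_unit_diag.
Qed.

Definition tor N (f : nat -> k) : 'M[k]_N := diag_mx (\row_(i < N) f i).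

Lemma torE N f (i l : 'I_N) : tor N f i l = f i *+ (i == l).
Proof. by rewrite !mxE. Qed.

Lemma dg_tor N f l : (l < N)%N -> dg (tor N f) l = f l.
Proof. by move=> lN; rewrite /dg insubT /= torE eqxx mulr1n. Qed.

Lemma tor_upper N f : upper_mx (tor N f).
Proof. by move=> i l li; rewrite torE -val_eqE /= gtn_eqF. Qed.

Lemma tor_SL N (f : nat -> k) : \prod_(l < N) f l = 1 -> upper_SL (tor N f).
Proof.
move=> f1; split; last exact: tor_upper.
by rewrite /SL /= det_diag -[RHS]f1; apply: eq_bigr => i _; rewrite mxE.
Qed.

Lemma tor_mul N f g : tor N f *m tor N g = tor N (fun l => f l * g l).
Proof.
by rewrite /tor mulmx_diag; congr diag_mx; apply/rowP => i; rewrite !mxE.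
Qed.

Lemma upoly_monomial (u : {poly k}) : (forall s, s != 0 -> u.[s] != 0) ->
  exists c m, u = c *: 'X^m.
Proof.
move=> us; have [m [v]] := multiplicity_XsubC u 0; rewrite subr0 => v0 uE.
have u0 : u != 0.
  by apply: contraTneq (us 1 (oner_neq0 _)) => ->; rewrite horner0 eqxx.
rewrite u0 /= in v0.
have /size_poly1P [c c0 vE] : size v == 1%N.
  apply: contraT => /closed_rootP [x vx]; have [x0|x0] := eqVneq x 0.
    by rewrite -x0 vx in v0.
  by have := us x x0; rewrite uE hornerM (rootP vx) mul0r eqxx.
by exists c, m; rewrite uE vE mul_polyC.
Qed.

(** Characters of the multiplicative group: the numerator of [phi] has no nonzero root, so it is a
    monomial. *)
Lemma loc_id_power (phi : k -> k) : loc (@upoly k) id phi ->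
  (forall s, s != 0 -> phi s != 0) -> phi 1 = 1 ->
  exists m : int, forall s, s != 0 -> phi s = s ^ m.
Proof.
move=> [d [h [[u uE] phiE]]] phi0 phi1.
have [|c [m umE]] := @upoly_monomial u.
  by move=> s s0; rewrite -uE -phiE // mulf_neq0 ?expf_neq0 ?phi0.
have c1 : c = 1.
  have := phiE 1 (oner_neq0 _); rewrite uE umE phi1 expr1n !hornerE expr1n.
  by rewrite !mulr1.
exists (m%:Z - d%:Z)%R => s s0; apply: (mulfI (expf_neq0 d s0)).
rewrite phiE // uE umE c1 scale1r hornerXn !exprnP -expfzDr //.
by rewrite addrCA subrr addr0.
Qed.

(** One-parameter subgroups generating the diagonal torus; the entry at N - 1 restores determinant
    one. *)
Definition lam N (i : nat) (s : k) (l : nat) : k :=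
  if l == i then s else if l == N.-1 then s^-1 else 1.

Lemma prod_lam N i s : (i < N.-1)%N -> s != 0 -> \prod_(l < N) lam N i s l = 1.
Proof.
move=> iN s0; have N0 : (0 < N)%N by lia.
have iN' : (i < N)%N by lia.
have lN : (N.-1 < N)%N by lia.
rewrite (bigD1 (Ordinal iN')) //= (bigD1 (Ordinal lN)) /=; last first.
  by rewrite -val_eqE /=; lia.
rewrite big1 => [|l]; last first.
  by rewrite -!val_eqE /= /lam => /andP[/negbTE -> /negbTE ->].
rewrite /lam !eqxx mulr1 (_ : (N.-1 == i) = false); last by lia.
by rewrite mulfV.
Qed.

Lemma big_nat_last N a (G : nat -> k) : (0 < N)%N -> (a <= N.-1)%N ->
  \prod_(a <= i < N) G i = \prod_(a <= i < N.-1) G i * G N.-1.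
Proof. by case: N => // N _ aN; rewrite big_nat_recr. Qed.

(** On the line from the diagonal part of [b] to [b] the character is a polynomial without zeros,
    hence constant. The diagonal torus is a product of the subgroups [lam], and on each of them the
    character is a power. *)
Lemma character_diag N (chi : 'M[k]_N -> k) : (0 < N)%N ->
  is_character (@upper_SL k N) chi ->
  exists m : nat -> int, forall b, upper_SL b ->
    chi b = \prod_(0 <= l < N.-1) dg b l ^ m l.
Proof.
move=> N0 [[p pE] chi1 chiM].
have chi0 b : upper_SL b -> chi b != 0.
  move=> Ub; have := chiM _ _ Ub (upper_SL_inv Ub).
  rewrite mulmxV ?chi1; last by case: Ub => /SL_unit.
  by move/esym => e; apply: contra_eq_neq e => ->; rewrite mul0r eq_sym oner_neq0.
have U := upoly_funalg k.
have Pp : polyfun (peval p) by exists p.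
have chidiag b : upper_SL b -> chi b = chi (tor N (dg b)).
  move=> Ub; pose F (s : k) := tor N (dg b) + s *: (b - tor N (dg b)).
  have FU s : upper_SL (F s).
    have ub : upper_mx b by case: Ub.
    have uF : upper_mx (F s).
      move=> i l li.
      have -> : F s i l = tor N (dg b) i l + s * (b i l - tor N (dg b) i l) by rewrite !mxE.
      by rewrite tor_upper // ub // subr0 mulr0 addr0.
    split=> //; rewrite /SL /= upper_det //; case: Ub => dUb _.
    rewrite -[RHS]dUb upper_det //; apply: eq_bigr => i _.
    by rewrite /F !mxE eqxx mulr1n dgE subrr mulr0 addr0.
  have [u uE] : upoly (fun s => peval p (F s)).
    by apply: (polyfun_comp U Pp); apply: mxfun_line.
  have chiF s : chi (F s) = u.[s] by rewrite pE // uE.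
  have /size_poly1P [c c0 ucE] : size u == 1%N.
    apply: contraT => /closed_rootP [x /rootP ux].
    by have := chi0 _ (FU x); rewrite chiF ux eqxx.
  have F1 : F 1 = b by rewrite /F scale1r addrC subrK.
  have F0 : F 0 = tor N (dg b) by rewrite /F scale0r addr0.
  by rewrite -F0 -{1}F1 !chiF ucE !hornerC.
have lamP i : exists m : int, (i < N.-1)%N ->
    forall s, s != 0 -> chi (tor N (lam N i s)) = s ^ m.
  have [iN|] := ltnP i N.-1; last by exists 0.
  have US s : s != 0 -> upper_SL (tor N (lam N i s)).
    by move=> s0; apply: tor_SL; apply: prod_lam.
  have LA := loc_funalg U (upoly_id k).
  have [| | |m mE] := @loc_id_power (fun s => chi (tor N (lam N i s))).
  - apply: (@loc_ext _ _ _ _ (fun s => peval p (tor N (lam N i s)))).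
      by move=> s s0; rewrite pE //; apply: US.
    apply: (polyfun_comp LA Pp) => r c.
    have [->|rc] := eqVneq r c; last first.
      apply: (@loc_ext _ _ _ _ (fun=> 0)); last exact: (fa_const LA).
      by move=> s _; rewrite torE (negbTE rc).
    have E : forall s, id s != 0 -> lam N i s c = tor N (lam N i s) c c.
      by move=> s _; rewrite torE eqxx mulr1n.
    apply: (loc_ext E); rewrite /lam; case: (c == i :> nat).
      exact: loc_base (upoly_id k).
    by case: (c == N.-1 :> nat); [exact: (loc_inv U)|exact: (fa_const LA)].
  - by move=> s s0; apply: chi0; apply: US.
  - rewrite -[RHS]chi1; congr chi; apply/matrixP => r c; rewrite torE mxE.
    by rewrite /lam invr1; case: ifP => _ //; case: ifP.
  by exists m.
have [m mE] := choice lamP; exists m => b Ub; rewrite chidiag //.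
(* Interpolation between the identity and the diagonal of [b]: the first r entries are those of [b],
   and the last one restores determinant one. Increasing r multiplies by one element of a subgroup
   [lam]. *)
pose part r l := if (l < r)%N then dg b l
                 else if l == N.-1 then (\prod_(0 <= c < r) dg b c)^-1 else 1.
have partSL r : (r <= N.-1)%N -> \prod_(l < N) part r l = 1.
  move=> rN; rewrite -(big_mkord xpredT (part r)) (big_cat_nat (n := r)) //=; last by lia.
  rewrite [X in _ * X](_ : _ = (\prod_(0 <= c < r) dg b c)^-1).
    rewrite big_nat [X in X * _](_ : _ = \prod_(0 <= c < r) dg b c).
      rewrite mulfV // prodf_seq_neq0; apply/allP => c _; exact: dg_neq0.
    by rewrite [RHS]big_nat; apply: eq_bigr => c /andP[_ cr]; rewrite /part cr.
  rewrite (@big_nat_last N) // big_nat big1 ?mul1r => [|c /andP[rc cN]].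
    by rewrite /part ltnNge rN /= eqxx.
  by rewrite /part ltnNge rc /= (ltn_eqF cN).
have chipart r : (r <= N.-1)%N -> chi (tor N (part r)) = \prod_(0 <= l < r) dg b l ^ m l.
  elim: r => [|r IH] rN.
    rewrite big_nil -[RHS]chi1; congr chi; apply/matrixP => i l; rewrite torE mxE.
    by rewrite /part big_nil invr1; case: ifP.
  rewrite big_nat_recr //= -IH ?(ltnW rN) // -(mE r rN _ (dg_neq0 r Ub)).
  rewrite -chiM; first 1 last.
  - by apply: tor_SL; apply: partSL; apply: ltnW.
  - by apply: tor_SL; apply: prod_lam => //; apply: dg_neq0.
  congr chi; rewrite tor_mul; congr tor; apply: funext => l.
  rewrite /part /lam ltnS; have [lr|rl|->] := ltngtP l r.
  - by rewrite (_ : (l == N.-1) = false) ?mulr1 //; lia.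
  - case: eqP => // _; last by rewrite mulr1.
    by rewrite big_nat_recr //= invfM.
  - rewrite (_ : (r == N.-1) = false) ?mul1r //; lia.
rewrite -chipart //; congr chi; apply/matrixP => i l; rewrite !torE.
congr (_ *+ _); rewrite /part; have [//|li] := ltnP i N.-1.
have iE : i = N.-1 :> nat by have := ltn_ord i; lia.
rewrite iE eqxx; apply: (mulIf (x := \prod_(0 <= c < N.-1) dg b c)).
  by rewrite prodf_seq_neq0; apply/allP => c _; exact: dg_neq0.
rewrite mulVf; last by rewrite prodf_seq_neq0; apply/allP => c _; exact: dg_neq0.
rewrite -[RHS](dg_prod Ub) -(big_mkord xpredT (dg b)).
by rewrite (@big_nat_last N) // mulrC.
Qed.

Lemma weight_conj N (B X : set 'M[k]_N) g chi : SL N g -> B `<=` SL N ->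
  (forall h x, SL N h -> X x -> X (mxconj h x)) ->
  is_weight B X chi ->
  is_weight [set mxconj g b | b in B] X (fun b => chi (mxconj (invmx g) b)).
Proof.
move=> SLg BSL XS [[[p pE] chi1 chiM] [f [h [fX hX fh]]]].
have ug := SL_unit SLg; have ug' : invmx g \in unitmx by rewrite unitmx_inv.
have A := polyfun_funalg k N N.
have conjpoly (f' : {mpoly k[N * N]}) : exists f2 : {mpoly k[N * N]},
    forall x, peval f2 x = peval f' (mxconj (invmx g) x).
  have [f2 f2E] : polyfun (fun x => peval f' (mxconj (invmx g) x)).
    apply: (polyfun_comp A (f := peval f')); first by exists f'.
    by apply: mxfun_mxconj => //; exact: mxfun_id.
  by exists f2 => x; rewrite -f2E.
split; first split.
- have [p2 p2E] := conjpoly p; exists p2 => _ [b Bb <-].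
  by rewrite p2E mxconjK // pE.
- rewrite -[RHS]chi1; congr chi.
  by apply: mxconj_eq; rewrite // mulmx1 mul1mx.
- by move=> _ _ [b Bb <-] [c Bc <-]; rewrite mxconj_mul // !mxconjK // chiM.
have [f2 f2E] := conjpoly f; have [h2 h2E] := conjpoly h.
exists f2, h2; split.
- move=> H; apply: fX => x Xx; rewrite -(mxconjK x ug) -f2E.
  by apply: H; apply: XS.
- move=> H; apply: hX => x Xx; rewrite -(mxconjK x ug) -h2E.
  by apply: H; apply: XS.
move=> _ x [b Bb <-] Xx; rewrite !f2E !h2E mxconjK //.
have -> : mxconj (invmx g) (mxconj (invmx (mxconj g b)) x) =
    mxconj (invmx b) (mxconj (invmx g) x).
  have ub := SL_unit (BSL b Bb).
  have ub' : invmx b \in unitmx by rewrite unitmx_inv.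
  have ugb : mxconj g b \in unitmx by rewrite /mxconj !unitmx_mul ug ub ug'.
  have -> : invmx (mxconj g b) = mxconj g (invmx b).
    apply: (can_inj (mulKmx ugb)); rewrite mulmxV // -mxconj_mul // mulmxV //.
    by symmetry; apply: mxconj_eq; rewrite ?mulmx1 ?mul1mx.
  rewrite -!mxconjM // ?unitmx_mul ?ug ?ub' ?ug' //; congr mxconj.
  by rewrite /mxconj !mulmxA mulVmx // mul1mx.
by apply: fh => //; apply: XS => //; apply: SL_inv.
Qed.

End Characters.

(** * Corner minors as semi-invariants of the upper triangular group *)

Section SemiInvariants.
Variable k : closedFieldType.

Lemma variety_rank_upper N (X : set 'M[k]_N) r :
  (forall h x, SL N h -> X x -> X (mxconj h x)) ->
  weight_group_rank (@upper_SL k N) X r -> variety_rank X r.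
Proof.
move=> XS [chi [chiW chiI chiG]] _ [g SLg ->].
have ug := SL_unit SLg; have SLg' := SL_inv SLg.
have USL : @upper_SL k N `<=` SL N by move=> b [].
exists (fun i b => chi i (mxconj (invmx g) b)); split.
- by move=> i; apply: weight_conj.
- move=> m H; apply: chiI => b Ub; rewrite -[RHS](H (mxconj g b)); last by exists b.
  by apply: eq_bigr => i _; rewrite mxconjK.
- move=> w wW.
  have BSL : [set mxconj g b | b in @upper_SL k N] `<=` SL N.
    move=> _ [b [SLb _] <-]; rewrite /mxconj.
    by apply: SL_mul => //; apply: SL_mul.
  have := weight_conj SLg' BSL XS wW; rewrite invmxK.
  have -> : [set mxconj (invmx g) b | b in [set mxconj g b | b in @upper_SL k N]] = @upper_SL k N.
    apply/seteqP; split=> b; first by move=> [_ [c Uc <-] <-]; rewrite mxconjK.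
    move=> Ub; exists (mxconj g b); last by rewrite mxconjK.
    by exists b.
  move=> /chiG [m mE]; exists m => _ [b Ub <-]; rewrite mE //.
  by apply: eq_bigr => i _; rewrite mxconjK.
Qed.

Definition matf m n (b : 'M[k]_(m, n)) (i l : nat) : k :=
  if insub i is Some i' then if insub l is Some l' then b i' l' else 0 else 0.

Lemma matfK m n (b : 'M[k]_(m, n)) : natmx m n (matf b) = b.
Proof. by apply/matrixP => i l; rewrite mxE /matf !valK. Qed.

Lemma matf_upper N (b : 'M[k]_N) i l : upper_mx b -> (l < i)%N -> matf b i l = 0.
Proof.
move=> ub li; rewrite /matf; case: insubP => // i' _ iE; case: insubP => // l' _ lE.
by rewrite ub // iE lE.
Qed.

Lemma matf_dg N (b : 'M[k]_N) l : (l < N)%N -> matf b l l = dg b l.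
Proof. by move=> lN; rewrite /matf /dg insubT. Qed.

(** The last i rows, read upwards from the bottom; together with the first i columns they span the
    flags preserved by upper triangular matrices. *)
Definition rowsel N i : 'M[k]_(i, N) := (selmx k N i (fun c => N.-1 - c)%N)^T.
Definition colsel N i : 'M[k]_(N, i) := selmx k N i id.

Section Minors.
Variable N : nat.

Lemma rowselE i F : (i <= N)%N -> rowsel N i *m natmx N N F = natmx i N (fun c l => F (N.-1 - c)%N l).
Proof. by move=> iN; rewrite trsel_natmx // => c ci; lia. Qed.

Lemma colselE m i F : (i <= N)%N -> natmx m N F *m colsel N i = natmx m i F.
Proof. by move=> iN; rewrite natmx_sel // => c ci; lia. Qed.

Lemma upper_rowsel i (b : 'M[k]_N) : (i <= N)%N -> upper_mx b ->
  exists2 be, rowsel N i *m b = be *m rowsel N i & \det be = \prod_(c < i) dg b (N.-1 - c).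
Proof.
move=> iN ub; pose w c := (N.-1 - c)%N.
have wN c : (c < i)%N -> (w c < N)%N by rewrite /w; lia.
have winj c d : (c < i)%N -> (d < i)%N -> w c = w d -> c = d by rewrite /w; lia.
pose G d c := matf b (w c) (w d).
exists (natmx i i G)^T.
  rewrite -{1}(matfK b) rowselE //; apply: trmx_inj; rewrite trmx_mul !trmxK.
  have -> : (natmx i N (fun c l => matf b (N.-1 - c)%N l))^T =
      natmx N i (fun l c => matf b (w c) l).
    by apply/matrixP => l c; rewrite !mxE.
  rewrite (natmx_factor wN winj) // => l c lN ci H.
  apply: matf_upper => //; rewrite ltnNge; apply/negP => wcl.
  by apply: (H (N.-1 - l)%N); rewrite /w in wcl *; lia.
rewrite det_tr upper_det; first by apply: eq_bigr => c _; rewrite mxE /G matf_dg ?wN.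
move=> d c cd; rewrite mxE /G matf_upper // /w.
by have := ltn_ord d; lia.
Qed.

Lemma upper_colsel i (b : 'M[k]_N) : (i <= N)%N -> upper_mx b ->
  exists2 be, b *m colsel N i = colsel N i *m be & \det be = \prod_(c < i) dg b c.
Proof.
move=> iN ub.
have wN c : (c < i)%N -> (c < N)%N by lia.
have winj c d : (c < i)%N -> (d < i)%N -> c = d -> c = d by [].
exists (natmx i i (matf b)).
  rewrite -{1}(matfK b) colselE // (natmx_factor wN winj) // => l c lN ci H.
  apply: matf_upper => //; rewrite ltnNge; apply/negP => cl.
  by apply: (H l); lia.
rewrite upper_det; first by apply: eq_bigr => c _; rewrite mxE matf_dg ?wN.
by move=> d c cd; rewrite mxE matf_upper.
Qed.

Definition Delta i (x : 'M[k]_N) : k := \det (rowsel N i *m x *m colsel N i).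

(** A corner minor of size i + 1 with the bottom row of x^2 in place of the next row of x. For i > 0
    its weight contains the inverse of the last diagonal entry twice, which allows single diagonal
    entries to be separated. *)
Definition Theta i (x : 'M[k]_N) : k :=
  \det (col_mx (rowsel N i *m x) (rowsel N 1 *m (x *m x)) *m colsel N (i + 1)).

Lemma polyfun_Delta i : polyfun (Delta i).
Proof.
have A := polyfun_funalg k N N.
apply: (fa_det A); apply: (mxfun_mul A); last exact: (mxfun_const A).
by apply: (mxfun_mul A); [exact: (mxfun_const A)|exact: mxfun_id].
Qed.

Lemma polyfun_Theta i : polyfun (Theta i).
Proof.
have A := polyfun_funalg k N N.
apply: (fa_det A); apply: (mxfun_mul A); last exact: (mxfun_const A).
apply: mxfun_col; apply: (mxfun_mul A); try exact: (mxfun_const A).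
  exact: mxfun_id.
by apply: (mxfun_mul A); exact: mxfun_id.
Qed.

Lemma Delta_scale i c x : Delta i (c *: x) = c ^+ i * Delta i x.
Proof. by rewrite /Delta -scalemxAr -scalemxAl detZ. Qed.

Lemma Theta_scale i c x : Theta i (c *: x) = c ^+ (i + 2) * Theta i x.
Proof.
rewrite /Theta -scalemxAl -!scalemxAr scalerA -expr2.
have -> : col_mx (c *: (rowsel N i *m x)) (c ^+ 2 *: (rowsel N 1 *m (x *m x))) =
   block_mx c%:M 0 0 (c ^+ 2)%:M *m col_mx (rowsel N i *m x) (rowsel N 1 *m (x *m x)).
  by rewrite mul_block_col !mul0mx addr0 add0r !mul_scalar_mx.
by rewrite -mulmxA det_mulmx det_ublock !det_scalar expr1 exprD.
Qed.

Definition semi_invariant (f : 'M[k]_N -> k) (al : 'M[k]_N -> k) :=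
  polyfun f /\ forall b x, upper_SL b -> f (mxconj (invmx b) x) = al b * f x.

Lemma upper_invmx_dg (b : 'M[k]_N) l : upper_SL b -> dg (invmx b) l = (dg b l)^-1.
Proof.
move=> [/SL_unit ub up]; rewrite /dg; case: insubP => [i _ _|_]; last by rewrite invr1.
exact: upper_inv_diag.
Qed.

Lemma Delta_semi i : (i <= N)%N -> semi_invariant (Delta i)
  (fun b => \prod_(c < i) (dg b (N.-1 - c))^-1 * \prod_(c < i) dg b c).
Proof.
move=> iN; split; first exact: polyfun_Delta.
move=> b x Ub; have [SLb' ub'] := upper_SL_inv Ub; have [SLb ub] := Ub.
have [be beE dbe] := upper_rowsel iN ub'; have [ga gaE dga] := upper_colsel iN ub.
rewrite /Delta /mxconj invmxK !mulmxA beE -!(mulmxA _ b) gaE.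
have -> : be *m rowsel N i *m x *m (colsel N i *m ga) =
   be *m (rowsel N i *m x *m colsel N i) *m ga by rewrite !mulmxA.
rewrite !det_mulmx dbe dga mulrAC; congr (_ * _ * _).
by apply: eq_bigr => c _; rewrite upper_invmx_dg.
Qed.

Lemma Theta_semi i : (i + 1 <= N)%N -> semi_invariant (Theta i)
  (fun b => \prod_(c < i) (dg b (N.-1 - c))^-1 * (dg b N.-1)^-1 * \prod_(c < i + 1) dg b c).
Proof.
move=> iN; split; first exact: polyfun_Theta.
move=> b x Ub; have [SLb' ub'] := upper_SL_inv Ub; have [SLb ub] := Ub.
have iN' : (i <= N)%N by lia. have N1 : (1 <= N)%N by lia.
have [be beE dbe] := upper_rowsel iN' ub'; have [ga gaE dga] := upper_colsel iN ub.
have [be1 be1E dbe1] := upper_rowsel N1 ub'.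
have ug := SL_unit SLb.
have xx : mxconj (invmx b) x *m mxconj (invmx b) x = mxconj (invmx b) (x *m x).
  by rewrite -mxconj_mul // unitmx_inv.
rewrite /Theta xx /mxconj invmxK !(mulmxA (rowsel _ _)) beE be1E -!(mulmxA (_ *m rowsel _ _)).
have -> : col_mx (be *m rowsel N i *m (x *m b)) (be1 *m rowsel N 1 *m (x *m x *m b)) =
  block_mx be 0 0 be1 *m col_mx (rowsel N i *m x) (rowsel N 1 *m (x *m x)) *m b.
  by rewrite mul_block_col !mul0mx addr0 add0r mul_col_mx !mulmxA.
rewrite -!(mulmxA _ b) gaE.
set X := col_mx (_ *m _) _.
have -> : block_mx be 0 0 be1 *m X *m (colsel N (i + 1) *m ga) =
  block_mx be 0 0 be1 *m (X *m colsel N (i + 1)) *m ga by rewrite !mulmxA.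
rewrite !det_mulmx det_ublock dbe dbe1 dga mulrAC big_ord1 subn0 upper_invmx_dg //.
congr (_ * _ * _ * _); last by rewrite /X !mulmxA.
by apply: eq_bigr => c _; rewrite upper_invmx_dg.
Qed.

Lemma polyfun_dg l : polyfun (fun b : 'M[k]_N => dg b l).
Proof.
rewrite /dg; case: insubP => [i _ _|_]; first exact: polyfun_entry.
exact: (fa_const (polyfun_funalg k N N)).
Qed.

(** Determinant one makes the inverse of a diagonal entry the product of the others, hence
    polynomial. *)
Lemma ratio_character l l' : (l' < N)%N ->
  is_character (@upper_SL k N) (fun b => dg b l / dg b l').
Proof.
move=> l'N; have A := polyfun_funalg k N N; split.
- have [p pE] : polyfun (fun b : 'M[k]_N => dg b l * \prod_(c < N | c != Ordinal l'N) dg b c).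
    apply: (fa_mul A); first exact: polyfun_dg.
    by apply: (fa_prod A) => c; exact: polyfun_dg.
  exists p => b Ub; rewrite -pE; congr (_ * _).
  have := dg_prod Ub; rewrite (bigD1 (Ordinal l'N)) //= => e.
  by apply: (mulfI (dg_neq0 l' Ub)); rewrite e mulfV ?dg_neq0.
- by rewrite !dg1 divr1.
- move=> b c [_ ub] [_ uc]; rewrite !dg_mul // invfM mulrACA.
  by [].
Qed.

Lemma weight_ratio (O : set 'M[k]_N) f h al be l l' : (l' < N)%N ->
  semi_invariant f al -> semi_invariant h be ->
  (exists2 x, O x & f x != 0) -> (exists2 x, O x & h x != 0) ->
  (forall b, upper_SL b -> al b = dg b l / dg b l' * be b) ->
  is_weight (@upper_SL k N) O (fun b => dg b l / dg b l').
Proof.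
move=> l'N [[p pE] fS] [[q qE] hS] [x Ox fx] [y Oy hy] alE.
split; first exact: ratio_character.
exists p, q; split.
- by move=> /(_ x Ox); rewrite -pE => e; rewrite e eqxx in fx.
- by move=> /(_ y Oy); rewrite -qE => e; rewrite e eqxx in hy.
move=> b z Ub Oz; rewrite -!pE -!qE fS // hS // alE //; ring.
Qed.

End Minors.

(** * Nonvanishing of the corner minors on an orbit with nonzero square *)

Section Nonvanishing.
Variables (N : nat) (e : 'M[k]_N) (j : nat).
Hypotheses (N0 : (0 < N)%N) (ne : nilpotent_mx e) (e2 : e *m e != 0).
Hypotheses (jr : (1 < j <= \rank e)%N) (jN : (2 * j <= N.+1)%N).
Let O := orbit_of (SL N) e.

Let SC : stable_cone (closed_cone O).
Proof. exact: closed_cone_stable. Qed.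
Let Ce : closed_cone O e.
Proof. by apply: sub_closed_cone; exact: orbit_self. Qed.

Lemma Delta_nonzero i : (i <= j)%N -> (2 * i <= N)%N ->
  exists2 x, O x & Delta i x != 0.
Proof.
move=> ij iN; have [j1 _] := andP jr.
pose F r c : k := ((c < i)%N && (r == N.-1 - c)%N)%:R.
have CF : closed_cone O (natmx N N F).
  apply: (sel_mem SC Ce ne e2 jr jN (w := fun c => (N.-1 - c)%N)
     (a := fun=> 0) (b := fun=> 0)).
  - by move=> c cj; lia.
  - by move=> c d cj dj; lia.
  - move=> r l rN lN H; rewrite /F; case: andP => // -[li /eqP rE].
    by case: (H l); lia.
  - move=> c d cj dj; rewrite mul0r /F (_ : (_ < i)%N = false) //.
    by lia.
  - by apply: big1 => c _; rewrite mul0r.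
apply: (closed_cone_homog (polyfun_Delta _ i) (Delta_scale i) CF).
rewrite /Delta rowselE ?colselE; try lia.
suff -> : natmx i i (fun c l => F (N.-1 - c)%N l) = 1%:M by rewrite det1 oner_neq0.
apply/matrixP => c d; rewrite !mxE /F ltn_ord /= -val_eqE /=; congr (nat_of_bool _)%:R.
by have := ltn_ord c; have := ltn_ord d; lia.
Qed.

Lemma Theta_nonzero i : (0 < i < j)%N -> (2 * i + 1 <= N)%N ->
  exists2 x, O x & Theta i x != 0.
Proof.
move=> /andP[i0 ij] iN; have [j1 jre] := andP jr.
(* An antidiagonal corner of size i and one more entry at (0, i). The bottom row of [F] is e_0, so
   that of F^2 is row 0 of [F], namely e_i, and the minor is that of the identity. Only i + 1 rows
   are nonzero, so i + 1 takes the place of j. *)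
pose F r c : k := ((c < i)%N && (r == N.-1 - c)%N || (r == 0%N) && (c == i))%:R.
have jr' : (1 < i.+1 <= \rank e)%N by lia.
have jN' : (2 * i.+1 <= N.+1)%N by lia.
have CF : closed_cone O (natmx N N F).
  apply: (sel_mem SC Ce ne e2 jr' jN' (w := fun c => if c == i then 0%N else (N.-1 - c)%N)
     (a := fun c => (c == 0%N)%:R) (b := fun c => (c == i)%:R)).
  - by move=> c cj; case: eqP; lia.
  - by move=> c d cj dj; case: eqP; case: eqP; lia.
  - move=> r l rN lN H; rewrite /F; case: (boolP (_ || _)) => // /orP[/andP[li /eqP rE]|/andP[/eqP rE /eqP lE]].
      have := H l; rewrite (_ : (l == i) = false); last by lia.
      by move=> H'; case: H'; lia.
    by have := H i (ltnSn i); rewrite eqxx rE.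
  - move=> c d cj dj; rewrite /F; have [dE|di] := eqVneq d i.
      rewrite mulr1 i0 /= (_ : (0 == i)%N = false); last by lia.
      rewrite andbF orbF subn0; congr (nat_of_bool _)%:R.
      by have [cE|ci] := eqVneq c i; lia.
    rewrite mulr0 (_ : (_ || _) = false) //.
    by lia.
  - apply: big1 => c _; have [->|] := eqVneq (c : nat) i; last by rewrite mul0r.
    by rewrite (_ : (i == 0)%N = false) ?mulr0 //; lia.
apply: (closed_cone_homog (polyfun_Theta _ i) (Theta_scale i) CF).
have E1 : rowsel N 1 *m (natmx N N F *m natmx N N F) = natmx 1 N (fun _ l => F 0%N l).
  rewrite mulmxA rowselE //.
  have -> : natmx 1 N (fun c l => F (N.-1 - c)%N l) = (selmx k N 1 (fun=> 0%N))^T.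
    apply/matrixP => c l; rewrite !mxE !ord1 /F subn0; congr (nat_of_bool _)%:R.
    by lia.
  by rewrite trsel_natmx.
rewrite /Theta E1 rowselE; last by lia.
rewrite mul_col_mx !colselE; try lia.
suff -> : col_mx (natmx i (i + 1) (fun c l => F (N.-1 - c)%N l))
    (natmx 1 (i + 1) (fun _ l => F 0%N l)) = 1%:M by rewrite det1 oner_neq0.
apply/matrixP => c d; rewrite [RHS]mxE.
have dn := ltn_ord d.
case: (splitP c) => c' cE.
  have -> : c = lshift 1 c' by exact: val_inj.
  rewrite col_mxEu mxE /F -val_eqE /=; congr (nat_of_bool _)%:R.
  by have := ltn_ord c'; lia.
have -> : c = rshift i c' by exact: val_inj.
rewrite col_mxEd mxE /F -val_eqE /=; congr (nat_of_bool _)%:R.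
by have := ltn_ord c'; lia.
Qed.

End Nonvanishing.

End SemiInvariants.

(** * Weights of the orbits with nonzero square *)

Section Ranks.
Variable k : closedFieldType.

Lemma expfz_sum (s : k) (I : Type) (r : seq I) (Q : pred I) (F : I -> int) : s != 0 ->
  \prod_(i <- r | Q i) s ^ F i = s ^ (\sum_(i <- r | Q i) F i).
Proof.
move=> s0; symmetry; apply: (big_morph (fun z : int => s ^ z)) => [x y|].
  exact: expfzDr.
exact: expr0z.
Qed.

Lemma expz_eq1 (z : int) : (forall s : k, s != 0 -> s ^ z = 1) -> z = 0.
Proof.
have pos (n : nat) : (forall s : k, s != 0 -> s ^+ n = 1) -> n = 0%N.
  case: n => // n H; have /closed_nonrootP [s] : ('X * ('X^(n.+1) - 1) : {poly k}) != 0.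
    rewrite mulf_neq0 ?polyX_eq0 // -size_poly_gt0 size_XnsubC //.
  rewrite rootE !hornerE mulf_eq0 negb_or subr_eq0 => /andP[s0].
  by rewrite H ?eqxx.
case: z => n H; first by rewrite (pos n).
suff : n.+1 = 0%N by [].
apply: pos => s s0; have := H s s0; rewrite NegzE -exprnN => /(congr1 (fun x => x^-1)).
by rewrite invrK invr1.
Qed.

Section Weights.
Variables (N : nat) (e : 'M[k]_N).
Hypothesis N0 : (0 < N)%N.
Let O := orbit_of (SL N) e.

(* A weight takes the value 1 on the elements of B that fix a generic point; only
   their diagonal matters for characters of B. *)
Lemma weight_stabiliser w F : polyfun F -> (exists2 x, O x & F x != 0) ->
  is_weight (@upper_SL k N) O w -> exists m : nat -> int,
  (forall b, upper_SL b -> w b = \prod_(0 <= l < N) dg b l ^ m l) /\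
  forall t : nat -> k, (forall y, O y -> F y != 0 -> exists b, [/\ upper_SL b,
      forall i : 'I_N, b i i = t i & b *m y = y *m b]) ->
    \prod_(0 <= l < N) t l ^ m l = 1.
Proof.
move=> PF exF [chiw [p [q [pO qO H]]]].
have [m mE] := character_diag N0 chiw.
pose m' l := if (l < N.-1)%N then m l else 0.
have E (G : nat -> k) : \prod_(0 <= l < N) G l ^ m' l = \prod_(0 <= l < N.-1) G l ^ m l.
  rewrite (@big_nat_last _ N) // {2}/m' ltnn expr0z mulr1.
  by rewrite !big_nat; apply: eq_bigr => l /andP[_ lN]; rewrite /m' lN.
exists m'; split=> [b Ub|t Ht]; first by rewrite E mE.
have exnz (f : {mpoly k[N * N]}) : ~ vanishes_on f O -> exists2 x, O x & peval f x != 0.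
  move=> nf; apply: contrapT => nex; apply: nf => x Ox; apply/eqP; apply: contrapT => /negP fx.
  by apply: nex; exists x.
have Pp : polyfun (peval p) by exists p.
have Pq : polyfun (peval q) by exists q.
have [x1 [Ox1 px1 qx1]] := orbit_irreducible N0 Pp Pq (exnz _ pO) (exnz _ qO).
have Ppq := fa_mul (polyfun_funalg k N N) Pp Pq.
have [|y [Oy pqy Fy]] := orbit_irreducible N0 Ppq PF _ exF.
  by exists x1; rewrite ?mulf_neq0.
have [b [Ub bt by_]] := Ht y Oy Fy.
have byy : mxconj (invmx b) y = y.
  by case: Ub => /SL_unit ub _; apply: mxconjV_eq.
have := H b y Ub Oy; rewrite byy => e1.
have wb : w b = 1.
  by apply: (mulIf pqy); rewrite mul1r -e1.
rewrite E -[RHS]wb mE //; rewrite !big_nat; apply: eq_bigr => l /andP[_ lN].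
have lN' : (l < N)%N by lia.
by have := bt (Ordinal lN'); rewrite -dgE /= => ->.
Qed.

(** Skeleton decomposition: a matrix of rank j is recovered from j rows and j columns that meet in
    an invertible block. *)
Lemma corner_identity j (y : 'M[k]_N) : \rank y = j -> Delta j y != 0 ->
  let S := rowsel k N j in let T := colsel k N j in
  y *m T *m invmx (S *m y *m T) *m S *m y = y.
Proof.
move=> ry Dy S T; have [A [R [yE rA rR]]] := rank_factor ry.
pose X := S *m y *m T; rewrite -/X.
have uX : X \in unitmx by rewrite unitmxE unitfE.
have XE : X = (S *m A) *m (R *m T) by rewrite /X yE !mulmxA.
have [uSA uRT] : S *m A \in unitmx /\ R *m T \in unitmx.
  by apply/andP; rewrite -unitmx_mul -XE.
have -> : y *m T *m invmx X *m S *m y = A *m ((R *m T) *m (invmx X *m ((S *m A) *m R))).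
  by rewrite yE !mulmxA.
have -> : invmx X *m ((S *m A) *m R) = invmx (R *m T) *m R.
  have e1 : S *m A = X *m invmx (R *m T) by rewrite XE mulmxK.
  by rewrite e1 -(mulmxA X) (mulKmx uX).
by rewrite mulKVmx // yE.
Qed.

(** In [Y] the factors around [D] are annihilated by [y], each on its outer side, so a + Y commutes
    with [y]. [D] is supported on the middle indices, while the corrections involving [T] and [S]
    live in the first j rows and in the last j columns; they do not reach the diagonal or below. *)
Lemma corner_stabiliser j (y : 'M[k]_N) (a : k) (t : nat -> k) : (2 * j <= N)%N ->
  \rank y = j -> Delta j y != 0 ->
  (forall l, (l < j)%N || (N - j <= l)%N -> t l = a) ->
  \prod_(l < N) t l = 1 ->
  exists b, [/\ upper_SL b, forall i : 'I_N, b i i = t i & b *m y = y *m b].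
Proof.
move=> jN ry Dy tE t1.
have /= key := corner_identity ry Dy.
set S := rowsel k N j in key; set T := colsel k N j in key.
set X := S *m y *m T in key.
clearbody X.
pose d l := if (l < j)%N || (N - j <= l)%N then 0 else t l - a.
pose D := tor N d.
pose Y := (1%:M - T *m (invmx X *m S *m y)) *m D *m (1%:M - y *m T *m invmx X *m S).
have yY : y *m Y = 0.
  have yP : y *m (1%:M - T *m (invmx X *m S *m y)) = 0.
    by rewrite mulmxBr mulmx1 !mulmxA key subrr.
  by rewrite /Y mulmxA (mulmxA y) yP !mul0mx.
have Yy : Y *m y = 0.
  have Py : (1%:M - y *m T *m invmx X *m S) *m y = 0 by rewrite mulmxBl mul1mx key subrr.
  by rewrite /Y -(mulmxA _ _ y) Py mulmx0.
exists (a%:M + Y).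
have hT m (M : 'M_(j, m)) (i : 'I_N) (l : 'I_m) : (j <= i)%N -> (T *m M) i l = 0.
  move=> ji; rewrite mxE big1 // => c _; rewrite !mxE (_ : (_ == _) = false) ?mul0r //.
  by have := ltn_ord c; lia.
have hS m (M : 'M_(m, j)) (i : 'I_m) (l : 'I_N) : (l < N - j)%N -> (M *m S) i l = 0.
  move=> lj; rewrite mxE big1 // => c _; rewrite !mxE (_ : (_ == _) = false) ?mulr0 //.
  by have := ltn_ord c; lia.
have hDr m (M : 'M_(m, N)) i l : (M *m D) i l = M i l * d l.
  rewrite mxE (bigD1 l) //= torE eqxx mulr1n big1 ?addr0 // => c cl.
  by rewrite torE (negbTE cl) mulr0.
have hDl m (M : 'M_(N, m)) i l : (D *m M) i l = d i * M i l.
  rewrite mxE (bigD1 i) //= torE eqxx mulr1n big1 ?addr0 // => c cl.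
  by rewrite torE eq_sym (negbTE cl) mul0r.
have subE (M1 M2 : 'M[k]_N) i l : (M1 - M2) i l = M1 i l - M2 i l by rewrite !mxE.
have YE (i l : 'I_N) : (l <= i)%N -> Y i l = d i *+ (i == l).
  move=> li; rewrite /Y mulmxBl mul1mx mulmxBr mulmx1 mulmxBl.
  set ka := invmx X *m S *m y; set la := y *m T *m invmx X.
  have e1 : (T *m ka *m D) i l = 0.
    rewrite hDr /d; case: ifP => [|/norP[lj _]]; first by rewrite mulr0.
    by rewrite hT ?mul0r //; lia.
  have e2 : (D *m (la *m S)) i l = 0.
    rewrite hDl /d; case: ifP => [|/norP[_ ij]]; first by rewrite mul0r.
    by rewrite hS ?mulr0 //; lia.
  have e3 : (T *m ka *m D *m (la *m S)) i l = 0.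
    have [ji|ij] := leqP j i.
      by rewrite -!(mulmxA T) hT.
    by rewrite !mulmxA hS //; lia.
  by rewrite !subE e1 e2 e3 !subr0 torE.
have bE (i : 'I_N) : (a%:M + Y) i i = t i.
  rewrite mxE [a%:M i i]mxE eqxx mulr1n YE // eqxx mulr1n /d.
  by case: ifP => [/tE ->|_]; rewrite ?addr0 // addrC subrK.
have ub : upper_mx (a%:M + Y).
  move=> i l li; rewrite mxE [a%:M i l]mxE -val_eqE /= (gtn_eqF li) mulr0n add0r.
  by rewrite YE ?(ltnW li) // -val_eqE /= (gtn_eqF li).
split=> //.
  by split=> //; rewrite /SL /= upper_det // -[RHS]t1; apply: eq_bigr => i _.
by rewrite mulmxDl mulmxDr yY Yy mul_scalar_mx mul_mx_scalar.
Qed.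

End Weights.
End Ranks.

(** * Bases of the weight group *)

Section WeightBasis.
Variable k : closedFieldType.

(* Enumerates all indices below [N - 1] outside the gap [j, N - n + j). *)
Definition outer_index N n j c := if (c < j)%N then c else (N - n + c)%N.

Lemma prod_outer N n j (G : nat -> k) : (j <= n.-1)%N -> (0 < n <= N)%N ->
  (forall l, (j <= l < N - n + j)%N -> G l = 1) ->
  \prod_(0 <= l < N.-1) G l = \prod_(c < n.-1) G (outer_index N n j c).
Proof.
move=> jn nN G1.
rewrite (@big_cat_nat _ _ _ j) //=; last by lia.
rewrite (@big_cat_nat _ _ _ (N - n + j) j) //=; try lia.
rewrite [X in _ * (X * _)]big_nat [X in _ * (X * _)]big1; last by move=> l /G1.
rewrite mul1r -(big_mkord xpredT (fun c => G (outer_index N n j c))).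
rewrite [RHS](@big_cat_nat _ _ _ j) //=; congr (_ * _).
  by rewrite !big_nat; apply: eq_bigr => l /andP[_ lj]; rewrite /outer_index lj.
rewrite (addnC (N - n)%N) big_addn.
have -> : (N.-1 - (N - n) = n.-1)%N by lia.
rewrite !big_nat; apply: eq_bigr => l /andP[jl _].
by rewrite /outer_index ltnNge jl /= addnC.
Qed.

Lemma sum_nat_last N (F : nat -> int) : (0 < N)%N ->
  \sum_(0 <= i < N) F i = \sum_(0 <= i < N.-1) F i + F N.-1.
Proof. by case: N => // N _; rewrite big_nat_recr. Qed.

Lemma ratio_prod N n j (x : nat -> k) (M : nat -> int) :
  (j <= n.-1)%N -> (0 < n <= N)%N -> (forall l, x l != 0) ->
  (forall l, (j <= l < N - n + j)%N -> M l = 0) -> \sum_(0 <= l < N) M l = 0 ->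
  \prod_(0 <= l < N) x l ^ M l =
  \prod_(c < n.-1) (x (outer_index N n j c) / x N.-1) ^ M (outer_index N n j c).
Proof.
move=> jn nN x0 Mmid Msum; have N0 : (0 < N)%N by lia.
rewrite -(@prod_outer N n j (fun l => (x l / x N.-1) ^ M l)) //; last first.
  by move=> l /Mmid ->; rewrite expr0z.
rewrite (@big_nat_last _ N) //.
under [RHS]eq_bigr do rewrite expfzMl exprz_inv.
rewrite big_split /= expfz_sum //; congr (_ * x _ ^ _).
rewrite sumrN; apply/eqP; rewrite -addr_eq0 addrC.
by move: Msum; rewrite (@sum_nat_last N) // => ->.
Qed.

Lemma sum_delta_int N i (F : nat -> int) : (i < N)%N ->
  \sum_(0 <= l < N) (l == i)%:R * F l = F i.
Proof.
move=> iN; rewrite big_mkord (bigD1 (Ordinal iN)) //= eqxx mul1r big1 ?addr0 // => l.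
by rewrite -val_eqE /= => /negbTE ->; rewrite mul0r.
Qed.

Lemma tor_pow_SL N (s : k) (tau : nat -> int) : s != 0 -> \sum_(0 <= l < N) tau l = 0 ->
  \prod_(l < N) s ^ tau l = 1.
Proof.
move=> s0 t0; rewrite -(big_mkord xpredT (fun l => s ^ tau l)) expfz_sum // t0.
exact: expr0z.
Qed.

Lemma weight_rank_of_basis N (O : set 'M[k]_N) n j :
  (j <= n.-1)%N -> (1 < n <= N)%N ->
  (forall c, (c < n.-1)%N -> is_weight (@upper_SL k N) O
      (fun b => dg b (outer_index N n j c) / dg b N.-1)) ->
  (forall w, is_weight (@upper_SL k N) O w -> exists M : nat -> int,
    [/\ forall b, upper_SL b -> w b = \prod_(0 <= l < N) dg b l ^ M l,
        forall l, (j <= l < N - n + j)%N -> M l = 0 & \sum_(0 <= l < N) M l = 0]) ->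
  weight_group_rank (@upper_SL k N) O n.-1.
Proof.
move=> jn nN W G; have N0 : (0 < N)%N by lia.
have nN' : (0 < n <= N)%N by lia.
exists (fun c b => dg b (outer_index N n j c) / dg b N.-1); split.
- by move=> c; apply: W.
- move=> m H.
  have olt (c : 'I_n.-1) : (outer_index N n j c < N.-1)%N.
    by rewrite /outer_index; have := ltn_ord c; case: ifP; lia.
  have oinj (c d : 'I_n.-1) : outer_index N n j c = outer_index N n j d -> c = d.
    move=> E; apply: val_inj; move: E; rewrite /outer_index /=.
    by do 2 (case: ifP => ?); lia.
  (* Evaluation on the one-parameter subgroup with s at the index of [c0] and s^-1 at N - 1. Summed
     over the n - 1 indices, these relations show that n times the sum of all m_c is zero. *)
  have key (c0 : 'I_n.-1) : m c0 + \sum_c m c = 0.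
    apply: expz_eq1 => s s0.
    pose tau (l : nat) : int := (l == outer_index N n j c0)%:R - (l == N.-1)%:R.
    have tau0 : \sum_(0 <= l < N) tau l = 0.
      rewrite sumrB -[X in X - _](eq_bigr _ (fun l _ => mulr1 _)).
      rewrite -[X in _ - X](eq_bigr _ (fun l _ => mulr1 _)).
      rewrite !(@sum_delta_int N _ (fun=> 1)) ?subrr //; first by lia.
      by have := olt c0; lia.
    have Ut := @tor_SL k N (fun l => s ^ tau l) (tor_pow_SL s0 tau0).
    have := H _ Ut; rewrite -[X in _ -> X = _]/(s ^ _) => <-.
    rewrite (eq_bigr (fun c => s ^ (((c == c0)%:R + 1) * m c))) => [|c _].
      rewrite expfz_sum //; congr (s ^ _).
      under [RHS]eq_bigr do rewrite mulrDl mul1r.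
      rewrite big_split /=; congr (_ + _); rewrite [RHS](bigD1 c0) /= ?eqxx ?mul1r ?big1 ?addr0 // => c /negbTE ->.
      by rewrite mul0r.
    have oc := olt c; rewrite !dg_tor; try lia.
    rewrite -exprz_exp; congr (_ ^ _); rewrite /tau eqxx.
    rewrite (_ : (N.-1 == outer_index N n j c0) = false); last by have := olt c0; lia.
    rewrite (_ : (outer_index N n j c == N.-1) = false); last by have := olt c; lia.
    rewrite sub0r subr0 -invr_expz invrK -expfzDr //; congr (s ^ (_%:R + _)).
    by congr nat_of_bool; apply/eqP/eqP => [/oinj|->].
  have : (\sum_c m c) *+ (n.-1).+1 = 0.
    rewrite mulrS; have : \sum_(c : 'I_n.-1) (m c + \sum_d m d) = 0 by apply: big1.
    by rewrite big_split /= sumr_const card_ord.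
  move=> /eqP; rewrite Num.Theory.mulrn_eq0 => /orP[|/eqP S0 i]; first by lia.
  by have := key i; rewrite S0 addr0.
- move=> w /G [M [wE Mmid Msum]].
  exists (fun c => M (outer_index N n j c)) => b Ub; rewrite wE //.
  by apply: ratio_prod => // l; apply: dg_neq0.
Qed.

Section OuterWeights.
Variables (N : nat) (e : 'M[k]_N) (j : nat).
Hypotheses (N0 : (0 < N)%N) (ne : nilpotent_mx e) (e2 : e *m e != 0).
Hypotheses (jr : (1 < j <= \rank e)%N) (jN : (2 * j <= N.+1)%N).
Let O := orbit_of (SL N) e.

(** [Delta 1] has weight b_0 / b_(N-1). For 0 < l < j the quotient Theta_l / Delta_l is used, and
    for l >= N - j the quotient Theta_i / Delta_(i+1) with i = N - 1 - l; either time the weights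
    differ by b_l / b_(N-1). *)
Lemma outer_weight l : (l < N.-1)%N -> (l < j)%N || (N - j <= l)%N ->
  is_weight (@upper_SL k N) O (fun b => dg b l / dg b N.-1).
Proof.
move=> lN out; have [j1 _] := andP jr.
have lN' : (N.-1 < N)%N by lia.
have NZ i : (i <= j)%N -> (2 * i <= N)%N -> exists2 x, O x & Delta i x != 0.
  exact: Delta_nonzero.
have TZ i : (0 < i < j)%N -> (2 * i + 1 <= N)%N -> exists2 x, O x & Theta i x != 0.
  exact: Theta_nonzero.
have [lj|jl] := ltnP l j.
  have [->|l0] := posnP l.
    apply: (weight_ratio lN' (Delta_semi k (i := 1) _) (Delta_semi k (i := 0) _)); try lia.
    - by apply: NZ; lia.
    - by apply: NZ; lia.
    by move=> b Ub; rewrite !big_ord1 !big_ord0 subn0 mulr1 mulrC mulr1.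
  apply: (weight_ratio lN' (Theta_semi k (i := l) _) (Delta_semi k (i := l) _)); try lia.
  - by apply: TZ; lia.
  - by apply: NZ; lia.
  move=> b Ub; rewrite addn1 big_ord_recr /=; ring.
rewrite ltnNge jl /= in out.
have ll : (N.-1 - l < N)%N by lia.
apply: (weight_ratio lN' (Theta_semi k (i := N.-1 - l) _) (Delta_semi k (i := (N.-1 - l) + 1) _)); try lia.
- by apply: TZ; lia.
- by apply: NZ; lia.
move=> b Ub; rewrite addn1 [in RHS]big_ord_recr /=.
have -> : (N.-1 - (N.-1 - l) = l)%N by lia.
have := dg_neq0 l Ub; have := dg_neq0 N.-1 Ub => bN bl.
by field; rewrite bl bN.
Qed.

End OuterWeights.

Lemma weight_rank_small N (e : 'M[k]_N) j : (0 < N)%N -> nilpotent_mx e -> e *m e != 0 ->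
  \rank e = j -> (2 * j < N)%N ->
  weight_group_rank (@upper_SL k N) (orbit_of (SL N) e) (2 * j - 1).
Proof.
move=> N0 ne e2 re jN.
have jr : (1 < j <= \rank e)%N by rewrite re leqnn -re sq_neq0_rank.
have [j1 _] := andP jr.
have -> : (2 * j - 1 = (2 * j).-1)%N by lia.
apply: (@weight_rank_of_basis _ _ _ j); try lia.
  move=> c cj; apply: (outer_weight N0 ne e2 jr (leqW (ltnW jN))); rewrite /outer_index; case: ifP; lia.
move=> w Ww.
have [m [wE mt]] := weight_stabiliser N0 (polyfun_Delta k N j)
   (Delta_nonzero N0 ne e2 jr (leqW (ltnW jN)) (leqnn j) (ltnW jN)) Ww.
(* Stabilisers of generic points in additive form: [m] is orthogonal to every tau of sum zero that
   is constant on the outer indices. *)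
have lin (tau : nat -> int) a : (forall l, (l < j)%N || (N - j <= l)%N -> tau l = a) ->
    \sum_(0 <= l < N) tau l = 0 -> \sum_(0 <= l < N) tau l * m l = 0.
  move=> ta t0; apply: expz_eq1 => s s0; rewrite -expfz_sum //.
  rewrite -[RHS](mt (fun l => s ^ tau l)); first by apply: eq_bigr => l _; rewrite exprz_exp.
  move=> y Oy Dy.
  have ry : \rank y = j by rewrite (orbit_invariants Oy).1.
  have tE l : (l < j)%N || (N - j <= l)%N -> s ^ tau l = s ^ a by move=> /ta ->.
  exact: (corner_stabiliser N0 (ltnW jN) ry Dy tE (tor_pow_SL s0 t0)).
have split3 (F : nat -> int) : \sum_(0 <= l < N) F l =
    \sum_(0 <= l < j) F l + (\sum_(j <= l < N - j) F l + \sum_(N - j <= l < N) F l).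
  by rewrite (@big_cat_nat _ _ _ j) //=; [rewrite (@big_cat_nat _ _ _ (N - j) j) //=|]; lia.
pose c := m j.
have mid l : (j <= l < N - j)%N -> m l = c.
  move=> /andP[jl lN].
  have D (F : nat -> int) : \sum_(0 <= i < N) ((i == l)%:R - (i == j)%:R) * F i = F l - F j.
    under eq_bigr do rewrite mulrBl.
    by rewrite sumrB !sum_delta_int //; lia.
  apply/eqP; rewrite -subr_eq0 -(D m) (lin _ 0) // => [i out|].
    have [/negbTE -> /negbTE ->] : i != l /\ i != j.
      by clear -out jl lN jN j1; lia.
    by rewrite subrr.
  by have := D (fun=> 1); under eq_bigr do rewrite mulr1; rewrite subrr.
(* Shifting all exponents by a constant changes nothing, because the determinant is one. *)
exists (fun l => m l - c); split.
- move=> b Ub; rewrite wE //.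
  have E : \prod_(0 <= l < N) dg b l ^ (- c) = 1.
    rewrite -(big_morph (fun x => x ^ (- c)) (id1 := 1) (op1 := *%R) (id2 := 1) (op2 := *%R)).

    + by rewrite big_mkord dg_prod // exp1rz.
    + by move=> x y; rewrite expfzMl.
    + exact: exp1rz.
  by rewrite -[LHS]mulr1 -[X in _ * X]E -big_split /=; apply: eq_bigr => l _; rewrite expfzDr // dg_neq0.
- by move=> l lmid; rewrite mid ?subrr //; lia.
pose out (l : nat) := (l < j)%N || (N - j <= l)%N.
have cst a b (x : int) : \sum_(a <= l < b) x = x *+ (b - a) by rewrite sumr_const_nat.
have outsum (F : nat -> int) : \sum_(0 <= l < N) (out l)%:R * F l =
   \sum_(0 <= l < j) F l + \sum_(N - j <= l < N) F l.
  rewrite split3; congr (_ + _).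
    by rewrite !big_nat; apply: eq_bigr => l /andP[_ lj]; rewrite /out lj mul1r.
  rewrite big_nat big1 ?add0r => [|l /andP[jl lN]].
    by rewrite !big_nat; apply: eq_bigr => l /andP[jl _]; rewrite /out jl orbT mul1r.
  by rewrite /out ltnNge jl leqNgt lN mul0r.
have dsum (F : nat -> int) : \sum_(0 <= l < N) (2 * j)%:R * (l == j)%:R * F l = (2 * j)%:R * F j.
  under eq_bigr do rewrite -mulrA.
  by rewrite -mulr_sumr sum_delta_int //; lia.
have D (F : nat -> int) : \sum_(0 <= l < N) ((out l)%:R - (2 * j)%:R * (l == j)%:R) * F l =
    \sum_(0 <= l < j) F l + \sum_(N - j <= l < N) F l - (2 * j)%:R * F j.
  under eq_bigr do rewrite mulrBl.
  by rewrite sumrB outsum dsum.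
(* Test vector: 1 at the 2j outer indices and -2j at j, which is a middle index because 2j < N. *)
have H : \sum_(0 <= l < j) m l + \sum_(N - j <= l < N) m l = (2 * j)%:R * c.
  apply/eqP; rewrite -subr_eq0 -(D m) (lin _ 1) // => [l ol|].
    have /negbTE -> : l != j by clear -ol jN; lia.
    by rewrite /out ol mulr0 subr0.
  have := D (fun=> 1); under eq_bigr do rewrite mulr1; rewrite !cst mulr1 -mulrnDr.
  by rewrite (_ : (j - 0 + (N - (N - j)) = 2 * j)%N) ?subrr //; clear -jN; lia.
rewrite split3 !sumrB !cst.
rewrite [X in _ + (X - _ + _)](_ : _ = c *+ (N - j - j)); last first.
  by rewrite -cst !big_nat; apply: eq_bigr => l /mid.
rewrite subrr add0r addrACA H -opprD -mulrnDr -mulr_natl.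
by rewrite (_ : (j - 0 + (N - (N - j)) = 2 * j)%N) ?subrr //; lia.
Qed.

End WeightBasis.

(** * The case of maximal rank: the centre as only constraint *)

Section RanksBig.
Variable k : closedFieldType.
Hypothesis char0 : [pchar k] =i pred0.

Lemma prim_root_ex n : (0 < n)%N -> exists z : k, n.-primitive_root z.
Proof.
move=> n0; pose p : {poly k} := 'X^n - 1.
have [rs Dp] := closed_field_poly_normal p.
rewrite (monicP _) ?monicXnsubC // scale1r in Dp.
have nk := natr_neq0 char0 n0.
have rn1 : all n.-unity_root rs by apply/allP => z; rewrite -root_prod_XsubC -Dp.
have sz : (n < (size rs).+1)%N by rewrite -(size_prod_XsubC rs id) -Dp size_XnsubC.
have [|z] := hasP (has_prim_root n0 rn1 _ sz); last by exists z.
by rewrite -separable_prod_XsubC -Dp separable_Xn_sub_1.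
Qed.

Lemma dvdz_of_roots n (M : int) : (0 < n)%N -> (forall z : k, z ^+ n = 1 -> z ^ M = 1) ->
  exists c, M = c * n%:Z.
Proof.
move=> n0 H; have [z zp] := prim_root_ex n0.
have := H z (prim_expr_order zp); case: M {H} => m /eqP.
  by rewrite -[z ^ _]/(z ^+ m) -(prim_order_dvd zp) => /dvdnP[c ->]; exists c%:Z; rewrite -PoszM.
rewrite -[z ^ _]/(z ^- m.+1) invr_eq1 -(prim_order_dvd zp) => /dvdnP[c E].
by exists (- c%:Z); rewrite NegzE E PoszM mulNr.
Qed.

(** Scalar matrices alone give the upper bound: N-th roots of unity act trivially, so N divides the
    sum of the exponents, and a constant shift makes this sum zero. *)
Lemma weight_rank_big N (e : 'M[k]_N) : (0 < N)%N -> nilpotent_mx e -> e *m e != 0 ->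
  (N <= 2 * \rank e)%N ->
  weight_group_rank (@upper_SL k N) (orbit_of (SL N) e) (N - 1).
Proof.
move=> N0 ne e2 re; have r1 := sq_neq0_rank ne e2; have rN := nilp_rank_lt N0 ne.
pose j := uphalf N.
have jr : (1 < j <= \rank e)%N by rewrite /j; lia.
have jN : (2 * j <= N.+1)%N by rewrite /j; lia.
rewrite subn1; apply: (@weight_rank_of_basis _ _ _ _ j); try (rewrite /j; lia).
  move=> c cN; apply: (outer_weight N0 ne e2 jr jN); rewrite /outer_index; case: ifP; rewrite /j; lia.
move=> w Ww.
have [|m [wE mt]] := weight_stabiliser N0 (fa_const (polyfun_funalg k N N) 1) _ Ww.
  by exists e; [exact: orbit_self|exact: oner_neq0].
have [c cE] : exists c, \sum_(0 <= l < N) m l = c * N%:Z.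
  apply: dvdz_of_roots => // z zN.
  have z0 : z != 0.
    by apply/eqP => zz; move/eqP: zN; rewrite zz expr0n eqn0Ngt N0 eq_sym oner_eq0.
  rewrite -expfz_sum //; apply: (mt (fun=> z)) => y _ _.
  exists z%:M; split; last by rewrite scalar_mxC.
  - split; first by rewrite /SL /= det_scalar.
    by move=> a b ba; rewrite mxE -val_eqE /= gtn_eqF.
  - by move=> i; rewrite mxE eqxx.
exists (fun l => m l - c); split.
- move=> b Ub; rewrite wE //.
  have E : \prod_(0 <= l < N) dg b l ^ (- c) = 1.
    rewrite -(big_morph (fun x => x ^ (- c)) (id1 := 1) (op1 := *%R) (id2 := 1) (op2 := *%R)).
    + by rewrite big_mkord dg_prod // exp1rz.
    + by move=> x y; rewrite expfzMl.
    + exact: exp1rz.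
  by rewrite -[LHS]mulr1 -[X in _ * X]E -big_split /=; apply: eq_bigr => l _; rewrite expfzDr // dg_neq0.
- by move=> l; lia.
- by rewrite sumrB cE sumr_const_nat subn0 -mulr_natr natz subrr.
Qed.

Lemma variety_rank_orbit N (e : 'M[k]_N) r : (0 < N)%N ->
  weight_group_rank (@upper_SL k N) (orbit_of (SL N) e) r -> variety_rank (orbit_of (SL N) e) r.
Proof. by move=> N0; apply: variety_rank_upper => h x /SL_unit uh; exact: orbit_conj. Qed.

End RanksBig.

(** * Square-zero orbits *)

Section SquareZero.
Variable k : closedFieldType.

Lemma square_zero_factor n r (A : 'M[k]_(n, r)) (R : 'M[k]_(r, n)) :
  \rank A = r -> \rank R = r -> A *m R *m (A *m R) = 0 -> R *m A = 0.
Proof.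
move=> /rank_left_inv[B BA] /rank_right_inv[D RD] AR.
have : B *m (A *m R *m (A *m R)) *m D = 0 by rewrite AR mulmx0 mul0mx.
by rewrite !mulmxA BA mul1mx -(mulmxA _ R D) RD mulmx1.
Qed.

(** In coordinates where the row factor is (0 1), the relation [R A = 0] confines the column factor
    to the first m coordinates, where any two matrices of rank r are equivalent. *)
Lemma square_zero_conj m r (x y : 'M[k]_(m + r)) : x *m x = 0 -> y *m y = 0 ->
  \rank x = r -> \rank y = r -> exists2 g, g \in unitmx & mxconj g x = y.
Proof.
have frame (z : 'M[k]_(m + r)) : z *m z = 0 -> \rank z = r ->
    exists H (A : 'M_(m, r)), [/\ H \in unitmx, \rank A = r & H *m z = col_mx A 0 *m row_mx 0 1%:M *m H].
  move=> z2 /rank_factor[A [R [zE rA rR]]].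
  have RA : R *m A = 0 by apply: square_zero_factor; rewrite -?zE.
  have r1 : \rank (row_mx 0 1%:M : 'M[k]_(r, m + r)) = r.
    by apply: (@right_inv_rank _ _ _ _ (col_mx 0 1%:M)); rewrite mul_row_col mul0mx add0r mulmx1.
  have [H uH HE] := row_transport r1 rR.
  have HA : H *m A = col_mx (usubmx (H *m A)) 0.
    rewrite -[LHS]vsubmxK; congr col_mx.
    have : row_mx 0 1%:M *m (H *m A) = 0 by rewrite mulmxA HE.
    by rewrite -{1}[H *m A]vsubmxK mul_row_col mul0mx add0r mul1mx.
  exists H, (usubmx (H *m A)); split=> //; last by rewrite -HA -mulmxA HE -mulmxA -zE.
  have [B BA] := rank_left_inv rA.
  have : B *m invmx H *m (H *m A) = 1%:M by rewrite mulmxA mulmxKV.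
  rewrite {1}HA -[B *m _]hsubmxK mul_row_col mulmx0 addr0; exact: left_inv_rank.
move=> x2 y2 rx ry; have [H [A [uH rA HE]]] := frame x x2 rx.
have [H' [A' [uH' rA' HE']]] := frame y y2 ry.
have [P uP PA] := col_transport rA rA'.
pose D : 'M[k]_(m + r) := block_mx P 0 0 1%:M.
have uD : D \in unitmx by rewrite unitmxE det_ublock det1 mulr1 -unitmxE.
have E1 : D *m col_mx A 0 = col_mx A' 0.
  by rewrite mul_block_col !mul0mx !mulmx0 !addr0 PA.
have E2 : row_mx 0 1%:M *m D = row_mx 0 1%:M :> 'M_(r, m + r).
  by rewrite mul_row_block !mul0mx !mulmx0 !add0r mulmx1.
have ug : invmx H' *m D *m H \in unitmx by rewrite !unitmx_mul unitmx_inv uH uH' uD.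
exists (invmx H' *m D *m H) => //; apply: mxconj_eq => //.
have yE : y *m invmx H' = invmx H' *m (col_mx A' 0 *m row_mx 0 1%:M).
  by rewrite -[LHS](mulKmx uH') [H' *m _]mulmxA HE' mulmxK.
rewrite -!mulmxA HE !mulmxA yE -[in LHS](mulmxA _ D) E1.
by rewrite -!mulmxA (mulmxA _ D) E2 !mulmxA.
Qed.

Lemma square_zero_orbit N (e x : 'M[k]_N) : (0 < N)%N -> e *m e = 0 ->
  orbit_of (SL N) e x <-> x *m x = 0 /\ \rank x = \rank e.
Proof.
move=> N0 e2; split=> [Ox|[x2 rx]].
  split; last exact: (orbit_invariants Ox).1.
  by have [g /SL_unit ug <-] := Ox; rewrite -mxconj_mul // e2 /mxconj mulmx0 mul0mx.
have [m NE] : exists m, N = (m + \rank e)%N.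
  by exists (N - \rank e)%N; rewrite subnK ?rank_leq_row.
have [r re] : exists r, \rank e = r by exists (\rank e).
rewrite re in rx NE; subst N; have [g ug <-] := square_zero_conj e2 x2 re rx.
exact: mxconj_orbit.
Qed.

Lemma mem_scanl_twos n b t : (t \in scanl addn b (nseq n 2%N)) =
  [&& b < t, t <= b + 2 * n & ~~ odd (t - b)]%N.
Proof. by elim: n b => [|n IH] b /=; [rewrite in_nil; lia | rewrite inE IH; lia]. Qed.

Lemma mem_scanl_ones n b t : (t \in scanl addn b (nseq n 1%N)) = (b < t <= b + n)%N.
Proof. by elim: n b => [|n IH] b /=; [rewrite in_nil; lia | rewrite inE IH; lia]. Qed.

Lemma foldl_twos n b : foldl addn b (nseq n 2%N) = (b + 2 * n)%N.
Proof. by elim: n b => [|n IH] b /=; [lia | rewrite IH; lia]. Qed.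

Definition twos_ones N r := nseq r 2%N ++ nseq (N - 2 * r) 1%N.

Lemma partition_twos_ones N r : partition_of N (twos_ones N r) -> (2 * r <= N)%N.
Proof.
by move=> /and3P[_ _ /eqP]; rewrite sumn_cat !sumn_nseq; lia.
Qed.

(** The partial sums that interrupt the superdiagonal are 2, 4, ..., 2r and every integer from there
    to N; what remains maps e_(2c+1) to e_(2c). *)
Lemma jordan_twos_ones N r : (2 * r <= N)%N ->
  jordan_nilp N (twos_ones N r) =
  selmx k N r (fun c => c.*2) *m (selmx k N r (fun c => c.*2.+1))^T.
Proof.
move=> rN; rewrite -[LHS]/(natmx N N (fun i l => ((l == i.+1) && (i.+1 \notin scanl addn 0%N (twos_ones N r)))%:R)).
rewrite (@natmx_factor _ N r (fun c => c.*2)); try lia.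
  congr (_ *m _); apply/matrixP => c l; rewrite !mxE; congr (nat_of_bool _)%:R.
  rewrite scanl_cat mem_cat mem_scanl_twos foldl_twos mem_scanl_ones.
  have := ltn_ord l; have := ltn_ord c; lia.
move=> i l iN lN ic.
case: eqP => //= li; rewrite scanl_cat mem_cat mem_scanl_twos foldl_twos mem_scanl_ones.
suff -> : (0 < i.+1 <= 0 + 2 * r)%N && ~~ odd (i.+1 - 0) || (0 + 2 * r < i.+1 <= 0 + 2 * r + (N - 2 * r))%N.
  by [].
by have := ic i./2; lia.
Qed.

Lemma jordan_square_zero N r : (2 * r <= N)%N ->
  let J := jordan_nilp N (twos_ones N r) : 'M[k]_N in J *m J = 0 /\ \rank J = r.
Proof.
move=> rN /=; rewrite jordan_twos_ones //; set S := selmx _ _ _ _; set T := selmx _ _ _ _.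
have rS : \rank S = r by apply: rank_sel; lia.
have rT : \rank T = r by apply: rank_sel; lia.
split; last first.
  rewrite mxrankMfree ?rS // /row_free mxrank_tr rT //.
rewrite -!mulmxA (mulmxA T^T) (_ : T^T *m S = 0) ?mul0mx ?mulmx0 //.
rewrite trsel_natmx; last by lia.
by apply/matrixP => c d; rewrite !mxE; case: eqP => //; lia.
Qed.

Lemma nilp_orbit_twos_ones N r (e : 'M[k]_N) : (0 < N)%N ->
  partition_of N (twos_ones N r) -> orbit_of (SL N) e = nilp_orbit N (twos_ones N r) ->
  [/\ (2 * r <= N)%N, e *m e = 0 & \rank e = r].
Proof.
move=> N0 /partition_twos_ones rN OE; have [J2 rJ] := jordan_square_zero rN.
have : nilp_orbit N (twos_ones N r) e by rewrite -OE; apply: orbit_self.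
move=> [g ug ->]; split=> //; last by rewrite mxrank_mxconj.
by rewrite -mxconj_mul // J2 /mxconj mulmx0 mul0mx.
Qed.

End SquareZero.

(** * Sums of square-zero matrices and even characteristic polynomials *)

Section EvenSpectrum.
Variable k : closedFieldType.
Hypothesis char0 : [pchar k] =i pred0.

(** Excluding c = 0 loses nothing over an infinite field and allows powers of c to be cancelled. *)
Definition even_spectrum N (x : 'M[k]_N) :=
  forall c, c != 0 -> \det (c%:M - x) = \det (c%:M + x).

Lemma horner_char_poly N (x : 'M[k]_N) c : (char_poly x).[c] = \det (c%:M - x).
Proof.
rewrite -/(horner_eval c _) -det_map_mx; congr (\det _); apply/matrixP => i l.
by rewrite !mxE /= /horner_eval !(hornerE, hornerMn).
Qed.

Lemma poly_eq_nonzero (p q : {poly k}) : (forall c, c != 0 -> p.[c] = q.[c]) -> p = q.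
Proof.
move=> pq; apply/eqP; rewrite -subr_eq0; apply: contraT => d0.
have /closed_nonrootP[c] : (p - q) * 'X != 0 by rewrite mulf_neq0 ?polyX_eq0.
rewrite rootM rootX negb_or /root !hornerE => /andP[pqc c0].
by rewrite pq // subrr eqxx in pqc.
Qed.

Lemma even_spectrumP N (x : 'M[k]_N) : even_spectrum x <->
  forall i, odd i -> (i <= N)%N -> (char_poly x)`_(N - i) = 0.
Proof.
pose q := \poly_(l < N.+1) ((-1) ^+ (N + l) * (char_poly x)`_l).
have qE c : q.[c] = \det (c%:M + x).
  have -> : c%:M + x = - ((- c)%:M - x) by rewrite opprB addrC -scaleN1r scale_scalar_mx mulN1r opprK.
  rewrite -[X in \det X]scaleN1r detZ -horner_char_poly horner_poly horner_coef size_char_poly mulr_sumr.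
  by apply: eq_bigr => l _; rewrite exprD -!mulrA; congr (_ * _); rewrite mulrCA -exprMn mulN1r.
split=> [E|E c _]; last first.
  rewrite -qE -horner_char_poly horner_poly horner_coef size_char_poly; apply: eq_bigr => l _.
  have lN := ltn_ord l; have [oN|/negbTE eN] := boolP (odd (N + l)); last by rewrite -signr_odd eN mul1r.
  by have := E (N - l)%N; rewrite subKn // => ->; rewrite ?mulr0 ?mul0r //; lia.
have pq : char_poly x = q by apply: poly_eq_nonzero => c c0; rewrite horner_char_poly qE E.
move=> i oi iN; have := congr1 (fun p : {poly k} => p`_(N - i)) pq.
rewrite coef_poly ltnS leq_subr -signr_odd (_ : odd (N + (N - i))) ?expr1; last by lia.
rewrite mulN1r => /eqP; rewrite -subr_eq0 opprK -mulr2n -mulr_natr mulf_eq0.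
by rewrite (negbTE (natr_neq0 char0 _)) // orbF => /eqP.
Qed.

Lemma det_add_square_zero N (x : 'M[k]_N) c : x *m x = 0 -> \det (c%:M + x) = c ^+ N.
Proof.
move=> x2; have [s sE] := closed_field_poly_normal (char_poly (- x)).
rewrite (monicP (char_poly_monic _)) scale1r in sE.
have s0 a : a \in s -> a = 0.
  move=> sa; have : root (char_poly (- x)) a by rewrite sE root_prod_XsubC.
  rewrite -eigenvalue_root_char => /eigenvalueP[v vx v0].
  have : v *m (- x) *m (- x) = 0 by rewrite !mulmxN mulNmx opprK -mulmxA x2 mulmx0.
  by rewrite vx -scalemxAl vx scalerA => /eqP; rewrite scaler_eq0 (negbTE v0) orbF mulf_eq0 orbb => /eqP.
have sN : size s = N by apply: succn_inj; rewrite -(size_prod_XsubC s id) -sE size_char_poly.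
rewrite -[X in _ + X]opprK -horner_char_poly sE horner_prod -sN.
elim: s s0 {sE sN} => [|a s IH] s0; first by rewrite big_nil expr0.
rewrite big_cons exprS hornerXsubC [a]s0 ?mem_head // subr0; congr (_ * _); apply: IH => b sb.
by apply: s0; rewrite inE sb orbT.
Qed.

(* For square-zero x and y, (c + x)(c - x - y)(c + y) = c (c^2 - xy). *)
Lemma det_sub_square_zero N (x y : 'M[k]_N) c : x *m x = 0 -> y *m y = 0 ->
  c ^+ N * \det (c%:M - (x + y)) * c ^+ N = c ^+ N * \det ((c * c)%:M - x *m y).
Proof.
move=> x2 y2; rewrite -{1}(det_add_square_zero c x2) -{1}(det_add_square_zero c y2).
rewrite -(det_scalar N c) -!det_mulmx; congr (\det _).
have xxy : x *m (x *m y) = 0 by rewrite mulmxA x2 mul0mx.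
have xyy : x *m y *m y = 0 by rewrite -mulmxA y2 mulmx0.
have -> : (c%:M + x) *m (c%:M - (x + y)) = (c * c)%:M - c *: y - x *m y.
  rewrite mulmxDl !mulmxBr !mulmxDr x2 !mul_scalar_mx mul_mx_scalar scale_scalar_mx.
  by apply/matrixP => i l; move: (x *m y) => z; rewrite !mxE; ring.
rewrite mulmxDr !mulmxBl xyy -!scalemxAl y2 !mul_scalar_mx !mul_mx_scalar !scalerBr scale_scalar_mx.
by apply/matrixP => i l; move: (x *m y) => z; rewrite !mxE; ring.
Qed.

(** The right-hand side of [det_sub_square_zero] depends only on [x y], which is unchanged when both
    signs are reversed. *)
Lemma even_spectrum_sum N (x y : 'M[k]_N) : x *m x = 0 -> y *m y = 0 -> even_spectrum (x + y).
Proof.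
move=> x2 y2 c c0; have cN : c ^+ N != 0 by rewrite expf_neq0.
have := @det_sub_square_zero N (- x) (- y) c; rewrite !mulmxN !mulNmx !opprK => /(_ x2 y2).
rewrite -(det_sub_square_zero c x2 y2) => /(mulIf cN)/(mulfI cN) <-.
by rewrite -opprD opprK.
Qed.

Lemma even_spectrum_closed N (A : set 'M[k]_N) :
  (forall x, A x -> even_spectrum x) -> forall x, zclosure A x -> even_spectrum x.
Proof.
move=> Ae x /zclosureP clx c c0; have PA := polyfun_funalg k N N.
apply/eqP; rewrite -subr_eq0; apply/eqP.
apply: (clx (fun x => \det (c%:M - x) - \det (c%:M + x))) => [|y /Ae/(_ c c0) ->].
  have Pid := @mxfun_id k N N; have Pc := mxfun_const PA (c%:M : 'M_N).
  apply: (fa_sub PA); apply: (fa_det PA); apply: (mxfun_add PA) => //.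
  exact: (mxfun_opp PA).
by rewrite subrr.
Qed.

Lemma square_zero_closed N (A : set 'M[k]_N) :
  (forall x, A x -> x *m x = 0) -> forall x, zclosure A x -> x *m x = 0.
Proof.
move=> A0 x /zclosureP clx; apply/matrixP => i l; rewrite [RHS]mxE.
apply: (clx (fun x => (x *m x) i l)) => [|y /A0 ->]; last by rewrite mxE.
by apply: (mxfun_mul (polyfun_funalg k N N)); exact: mxfun_id.
Qed.

Lemma even_spectrum_block n q (M : 'M[k]_n) (B : 'M[k]_(n, q)) :
  even_spectrum (block_mx M B 0 0) -> even_spectrum M.
Proof.
move=> E c c0; have := E c c0; rewrite scalar_mx_block opp_block_mx !add_block_mx.
rewrite subr0 !addr0 subr0 !det_ublock => /mulIf -> //.
by rewrite det_scalar expf_neq0.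
Qed.

Lemma even_spectrum_conj n (g M : 'M[k]_n) : g \in unitmx ->
  even_spectrum (mxconj g M) <-> even_spectrum M.
Proof. by move=> ug; rewrite !even_spectrumP char_poly_conj. Qed.

(** A row eigenvector for the head of the list is split off and the rest follows by induction. The
    prescribed order of the eigenvalues is what later allows opposite ones to be paired. *)
Lemma trig_conj n (M : 'M[k]_n) (s : seq k) : char_poly M = \prod_(a <- s) ('X - a%:P) ->
  exists2 g, g \in unitmx & is_trig_mx (mxconj g M) /\ forall i, mxconj g M i i = s`_i.
Proof.
elim: s n M => [|a s IH] [|n] M ME.
- by exists 1%:M; rewrite ?unitmx1 //; split; [apply/is_trig_mxP; case|case].
- by have := size_char_poly M; rewrite ME big_nil size_poly1.
- by have := size_char_poly M; rewrite ME size_prod_XsubC.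
have /eigenvalueP[v vM v0] : eigenvalue M a.
  by rewrite eigenvalue_root_char ME root_prod_XsubC mem_head.
have e1 : \rank (row_mx 1%:M 0 : 'rV[k]_(1 + n)) = 1%N.
  by apply: (@right_inv_rank _ _ _ _ (col_mx 1%:M 0)); rewrite mul_row_col mulmx0 addr0 mulmx1.
have rv : \rank v = 1%N by rewrite rank_rV v0.
have [g ug gE] := @row_transport k 1 (1 + n) _ v e1 rv.
pose M1 : 'M_(1 + n) := mxconj g M.
have M1E : M1 = block_mx a%:M 0 (dlsubmx M1) (drsubmx M1).
  have uM1 : usubmx M1 = row_mx a%:M 0.
    have <- : row_mx 1%:M 0 *m M1 = usubmx M1.
      by rewrite -[X in _ *m X]vsubmxK mul_row_col mul1mx mul0mx addr0.
    rewrite /M1 /mxconj !mulmxA gE vM -scalemxAl -gE mulmxK // scale_row_mx scaler0.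
    by rewrite scalemx1.
  by rewrite -[LHS]vsubmxK uM1 block_mxEv -[dsubmx M1]hsubmxK.
have pM1 : char_poly M1 = ('X - a%:P) * char_poly (drsubmx M1).
  rewrite {1}M1E /char_poly /char_poly_mx map_block_mx scalar_mx_block opp_block_mx add_block_mx.
  rewrite map_mx0 subr0 det_lblock; congr (_ * _).
  by rewrite det_mx11 !mxE eqxx.
have {}/IH[h uh [hT hd]] : char_poly (drsubmx M1) = \prod_(b <- s) ('X - b%:P).
  apply: (@mulfI _ ('X - a%:P)); first by rewrite polyXsubC_eq0.
  by rewrite -pM1 char_poly_conj // ME big_cons.
pose H : 'M_(1 + n) := block_mx 1%:M 0 0 h.
have uH : H \in unitmx by rewrite unitmxE det_ublock det1 mul1r -unitmxE.
exists (H *m g); first by rewrite unitmx_mul uH.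
rewrite mxconjM //.
have -> : mxconj H M1 = block_mx a%:M 0 (h *m dlsubmx M1) (mxconj h (drsubmx M1)).
  apply: mxconj_eq => //; rewrite M1E !mulmx_block !mulmx0 !mul0mx !mul1mx !mulmx1 !addr0 !add0r.
  by rewrite /mxconj mulmxKV // block_mxKdl block_mxKdr.
split.
  apply/is_trig_mxP => i l; case: (@split_ordP 1 n i) => i' ->; case: (@split_ordP 1 n l) => l' -> /=.
  - by rewrite !ord1.
  - by move=> _; apply: (etrans (block_mxEur _ _ _ _ _ _)); rewrite mxE.
  - by rewrite ord1.
  - by rewrite ltn_add2l => /(is_trig_mxP hT); apply: etrans; apply: block_mxEdr.
move=> i; case: (@split_ordP 1 n i) => i' ->.
  by apply: (etrans (block_mxEul _ _ _ _ _ _)); rewrite ord1 mxE.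
by apply: (etrans (block_mxEdr _ _ _ _ _ _)); apply: hd.
Qed.

(** The polynomial is a polynomial in X^2. The b_i are square roots of the roots of the latter, and
    b_i, -b_i occupy the adjacent places 2i and 2i + 1. *)
Lemma even_poly_factor r (p : {poly k}) : p \is monic -> size p = (2 * r).+1 ->
  (forall i, odd i -> p`_i = 0) ->
  exists b : nat -> k, p = \prod_(a <- mkseq (fun i => (-1) ^+ i * b i./2) (2 * r)) ('X - a%:P).
Proof.
move=> mp sp podd.
have pE : p = even_poly p \Po 'X^2.
  rewrite -[LHS]poly_even_odd (_ : odd_poly p = 0) ?comp_poly0 ?mul0r ?addr0 //.
  by apply/polyP => i; rewrite coef_odd_poly podd ?coef0 //= odd_double.
have [t tE] := closed_field_poly_normal (even_poly p).
have [b bt] : exists b : nat -> k, forall i, b i ^+ 2 = t`_i.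
  by have [b bE] := choice (fun i => @nth_root_ex k 2 t`_i isT); exists b.
have pb : p = lead_coef (even_poly p) *:
    \prod_(a <- mkseq (fun i => (-1) ^+ i * b i./2) (2 * size t)) ('X - a%:P).
  rewrite [LHS]pE {1}tE comp_polyZ; congr (_ *: _).
  rewrite rmorph_prod big_map (big_nth 0) big_mkord
    (_ : iota 0 (2 * size t) = index_iota 0 (2 * size t)); last by rewrite /index_iota subn0.
  rewrite -(big_mkord xpredT (fun i => ('X - (t`_i)%:P) \Po 'X^2)).
  elim: (size t) => [|m IH]; first by rewrite muln0 !big_nil.
  rewrite (_ : 2 * m.+1 = (2 * m).+2)%N; last by lia.
  rewrite big_nat_recr // IH big_nat_recr // big_nat_recr // -[RHS]mulrA; congr (_ * _).
  have -> : ((2 * m).+1)./2 = m by lia.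
  have -> : (2 * m)./2 = m by lia.
  rewrite -(signr_odd _ (2 * m)) -(signr_odd _ (2 * m).+1) oddS.
  have -> : odd (2 * m) = false by lia.
  rewrite comp_polyB comp_polyX comp_polyC -bt expr0 expr1 mul1r mulN1r polyCN opprK -subr_sqr.
  by rewrite rmorphXn.
have L1 : lead_coef (even_poly p) = 1.
  have := monicP mp; rewrite {1}pb lead_coefZ (monicP (monic_prod_XsubC _ _ _)) mulr1 //.
rewrite L1 scale1r in pb.
have st : size t = r.
  by have := sp; rewrite {1}pb size_prod_XsubC size_mkseq; lia.
by exists b; rewrite {1}pb st.
Qed.

End EvenSpectrum.

(** * Secant varieties of the square-zero orbits *)

Section SecantSquareZero.
Variable k : closedFieldType.
Hypothesis char0 : [pchar k] =i pred0.

Lemma det_trig_signed r (d : nat -> k) c : \prod_(0 <= i < 2 * r) (c - (-1) ^+ i * d i./2) =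
  \prod_(0 <= i < 2 * r) (c + (-1) ^+ i * d i./2).
Proof.
elim: r => [|m IH]; first by rewrite muln0 !big_nil.
rewrite (_ : 2 * m.+1 = (2 * m).+2)%N; last by lia.
rewrite big_nat_recr // big_nat_recr // IH [RHS]big_nat_recr // [X in _ = X * _]big_nat_recr //.
have -> : ((2 * m).+1)./2 = m by lia.
have -> : (2 * m)./2 = m by lia.
rewrite exprS /=; set P := \prod_(0 <= i < 2 * m) _; ring.
Qed.

Lemma trig_even_spectrum r (M : 'M[k]_(2 * r)) (d : nat -> k) : is_trig_mx M ->
  (forall i, M i i = (-1) ^+ i * d i./2) -> even_spectrum M.
Proof.
move=> /is_trig_mxP MT Md c _; rewrite !det_trig.
- have := det_trig_signed r d c; rewrite !big_mkord => E.
  transitivity (\prod_(i < 2 * r) (c - (-1) ^+ i * d i./2)).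
    by apply: eq_bigr => i _; rewrite !mxE eqxx Md.
  by rewrite E; apply: eq_bigr => i _; rewrite !mxE eqxx Md.
- by apply/is_trig_mxP => i l il; rewrite !mxE MT // -val_eqE ltn_eqF ?addr0.
- by apply/is_trig_mxP => i l il; rewrite !mxE MT // -val_eqE ltn_eqF ?subr0.
Qed.

Lemma char_poly_companion n (p : {poly k}) : p \is monic -> n = (size p).-1 ->
  char_poly (natmx n n (compf n (fun i => - p`_i))) = p.
Proof.
move=> mp ->; rewrite -[RHS](companionmxK mp) /char_poly -det_tr; congr (\det _).
apply/matrixP => i l; rewrite !mxE /compf; congr (_ - _%:P); first by rewrite eq_sym.
by case: eqP => // _; rewrite eq_sym.
Qed.

Lemma coef_char_poly_companion n (c : nat -> k) i : (i < n)%N ->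
  (char_poly (natmx n n (compf n c)))`_i = - c i.
Proof.
move=> iN; pose p : {poly k} := 'X^n - \poly_(l < n) c l.
have sp : size p = n.+1 by rewrite size_polyDl size_polyXn // size_polyN ltnS size_poly.
have mp : p \is monic.
  by rewrite monicE lead_coefDl ?lead_coefXn // size_polyXn size_polyN ltnS size_poly.
have pc l : (l < n)%N -> p`_l = - c l.
  by move=> ln; rewrite coefB coefXn coef_poly ln ltn_eqF // sub0r.
have -> : natmx n n (compf n c) = natmx n n (compf n (fun i => - p`_i)).
  by apply: eq_natmx => a l aN lN; rewrite /compf pc // opprK.
by rewrite char_poly_companion ?sp ?pc.
Qed.

(** A line between matrices with even characteristic polynomial can leave this class. So [M] is
    first made lower triangular with diagonal b_0, -b_0, b_1, -b_1, ..., and the line leads to [W],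
    with diagonal 1, -1, 1, -1, ... and ones below it: opposite entries stay paired, and [W] has the
    cyclic vector e_0. *)
Lemma even_cyclic_dense r (M : 'M[k]_(2 * r)) : (0 < r)%N -> even_spectrum M ->
  exists g F h, [/\ g \in unitmx, mxfun (@upoly k) F, upoly h, exists t, h t != 0 &
    F 0 = mxconj g M /\
    forall t, h t != 0 -> F t \in unitmx /\ exists c g', [/\ g' \in unitmx,
      mxconj g' (F t) = natmx (2 * r) (2 * r) (compf (2 * r) c) &
      forall i, odd i -> (i < 2 * r)%N -> c i = 0]].
Proof.
move=> r0 EM; set n := (2 * r)%N.
have coef0 (Z : 'M[k]_n) : even_spectrum Z -> forall i, odd i -> (i <= n)%N -> (char_poly Z)`_i = 0.
  move=> /(even_spectrumP char0) E i oi iN.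
  by have := E (n - i)%N; rewrite subKn // => -> //; rewrite /n in iN *; lia.
have [b pE] : exists b : nat -> k,
    char_poly M = \prod_(a <- mkseq (fun i => (-1) ^+ i * b i./2) n) ('X - a%:P).
  apply: even_poly_factor; [exact: char_poly_monic|exact: size_char_poly|].
  move=> i oi; have [iN|iN] := leqP i n; first exact: coef0.
  by rewrite nth_default // size_char_poly.
have [g ug [LT Ld]] := trig_conj pE; 
have [L LE] : exists L, L = mxconj g M by exists (mxconj g M).
rewrite -LE in LT Ld.
pose W : 'M[k]_n := natmx n n (fun i l => if i == l then (-1) ^+ i else (i == l.+1)%:R).
pose v := selmx k n 1 (fun=> 0%N).
pose F (s : k) := L + s *: (W - L).
pose U s : 'M_n := \matrix_(i < n, a < n) (F s ^+ a *m v) i 0.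
have UE s (i a : 'I_n) : U s i a = (F s ^+ a *m v) i 0 by rewrite mxE.
have F1 : F 1 = W by rewrite /F scale1r addrC subrK.
have PF : mxfun (@upoly k) F by exact: mxfun_line.
have A := upoly_funalg k.
have FT s : is_trig_mx (F s).
  apply/is_trig_mxP => i l il; rewrite !mxE (is_trig_mxP LT) // (ltn_eqF il) (ltn_eqF (leqW il)).
  by rewrite !(subr0, mulr0, addr0).
have Wv a (i : 'I_n) : (a <= i)%N -> (W ^+ a *m v) i 0 = (i == a :> nat)%:R.
  elim: a i => [|a IH] i ai; first by rewrite expr0 mul1mx !mxE.
  rewrite exprS -[_ * _]/(_ *m _) -mulmxA mxE.
  have an : (a < n)%N by have := ltn_ord i; lia.
  rewrite (bigD1 (Ordinal an)) //= IH // eqxx mulr1 big1 ?addr0 => [|l la].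
    rewrite !mxE /= (_ : (i == a :> nat) = false) //; lia.
  have [lla|al] := ltnP l a; last first.
    by rewrite IH // (_ : (l == a :> nat) = false) ?mulr0 //; apply: negbTE la.
  by rewrite [W i l]mxE (gtn_eqF (ltn_trans lla ai)) (gtn_eqF (leq_ltn_trans lla ai)) mul0r.
exists g, F, (fun s => \det (U s) * \det (F s)); split=> //.
- apply: (fa_mul A); apply: (fa_det A) => //.
  move=> i a; have := mxfun_mul A (mxfun_exp A a PF) (mxfun_const A v) i 0.
  by congr upoly; apply: funext => s; rewrite [RHS]mxE.
- exists 1; rewrite F1 mulf_neq0 //; last first.
    rewrite det_trig -?F1 //; apply/prodf_neq0 => i _.
    by rewrite F1 mxE eqxx expf_neq0 // oppr_eq0 oner_eq0.
  rewrite -det_tr det_trig.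
    by apply/prodf_neq0 => i _; rewrite mxE UE F1 Wv // eqxx oner_neq0.
  by apply/is_trig_mxP => i l il; rewrite mxE UE F1 Wv 1?ltnW // gtn_eqF.
split; first by rewrite /F scale0r addr0 LE.
move=> s; rewrite mulf_eq0 negb_or => /andP[dU dF].
split; first by rewrite unitmxE unitfE.
have [|c [h [uh hE]]] := @cyclic_companion k n (F s) v; first by rewrite unitmxE unitfE.
exists c, h; split=> // i oi iN.
apply: oppr_inj; rewrite -(coef_char_poly_companion c iN) oppr0 -hE char_poly_conj //.
apply: coef0 (ltnW iN) => //; apply: (trig_even_spectrum (d := fun l => b l + s * (1 - b l))) (FT s) _ => l.
by rewrite !mxE eqxx Ld nth_mkseq //; ring.
Qed.

Lemma rank_le_rows n j (w : nat -> nat) (F : nat -> nat -> k) :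
  (forall c, (c < j)%N -> (w c < n)%N) -> (forall c d, (c < j)%N -> (d < j)%N -> w c = w d -> c = d) ->
  (forall i l, (i < n)%N -> (l < n)%N -> (forall c, (c < j)%N -> i <> w c) -> F i l = 0) ->
  (\rank (natmx n n F) <= j)%N.
Proof.
move=> wn wi F0; rewrite (natmx_factor wn wi F0).
by apply: leq_trans (mxrankM_maxl _ _) (rank_leq_col _).
Qed.

(** In the square of a part, the column index of the first factor is itself a row index of the
    part's parity. The subdiagonal changes parity, and the last column has odd index and vanishes in
    odd rows. Each rank is at most r, and the sum of the parts has rank 2r. *)
Lemma even_companion_parts r q (c : nat -> k) : (0 < r)%N ->
  (forall i, odd i -> (i < 2 * r)%N -> c i = 0) ->
  natmx (2 * r) (2 * r) (compf (2 * r) c) \in unitmx ->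
  forall b, let x := natmx (2 * r + q) (2 * r + q) (parity_part b (2 * r) c) in
  x *m x = 0 /\ \rank x = r.
Proof.
set n := (2 * r)%N => r0 c0 uK.
pose P b := natmx (n + q) (n + q) (parity_part b n c).
have Ple b : (\rank (P b) <= r)%N.
  apply: (@rank_le_rows _ _ (fun d => b + d.*2)%N); rewrite /n; try by case: b; lia.
  move=> i l iN lN id; rewrite /parity_part; case: ifP => // /and3P[i1 _ /eqP ob].
  by case: (id i./2); rewrite -?ob ?odd_double_half; lia.
have Pr : (n <= \rank (P true) + \rank (P false))%N.
  apply: leq_trans (mxrank_add _ _); rewrite -companion_split.
  by rewrite rank_diag_block_mx mxrank0 addn0 mxrank_unit.
move=> b /=; rewrite -/(P b); split; last first.
  by apply/eqP; rewrite eqn_leq Ple; have := Ple true; have := Ple false; case: b; rewrite /n in Pr *; lia.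
apply/matrixP => i l; rewrite !mxE; apply: big1 => d _; rewrite !mxE /parity_part.
case: ifP => [/and3P[iN dN /eqP ob]|]; last by rewrite mul0r.
case: ifP => [/and3P[_ lN /eqP od]|]; last by rewrite mulr0.
rewrite /compf; have [dn|dn] := eqVneq (d : nat) n.-1.
  rewrite c0 ?mul0r //; rewrite ob -od dn /n; lia.
rewrite (_ : (i == d.+1 :> nat) = false) ?mul0r //; apply/negbTE/eqP => E.
by move: ob; rewrite E /= od; case: (b).
Qed.

Lemma CS_square_zero N (e : 'M[k]_N) r : (0 < N)%N -> e *m e = 0 -> \rank e = r ->
  (0 < r)%N -> (2 * r <= N)%N ->
  CS (orbit_of (SL N) e) = Dr N (2 * r) `&` [set M | even_spectrum M].
Proof.
move=> N0 e2 re r0 rN; have e0 : e != 0 by rewrite -mxrank_eq0 re -lt0n.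
have ne : nilpotent_mx e by exists 2%N.
rewrite CS_orbit //; set C := closed_cone _; have SC : stable_cone C by exact: closed_cone_stable.
have OC x : x *m x = 0 -> \rank x = r -> C x.
  by move=> x2 rx; apply: sub_closed_cone; apply/square_zero_orbit; rewrite ?re.
have CO x : C x -> x *m x = 0 /\ (\rank x <= r)%N.
  move=> Cx; split.
    apply: square_zero_closed Cx => _ [c [y [_ /square_zero_orbit[//|//|y2 _] ->]]].
    by rewrite -scalemxAl -scalemxAr y2 !scaler0.
  rewrite -re; apply: rank_le_closed Cx => _ [c [y [_ Oy ->]]].
  by rewrite -(orbit_invariants Oy).1 mxrank_scale.
apply/seteqP; split=> x.
  move=> Sx; split.
    apply: rank_le_closed Sx => {}x [y [z [/CO[_ ry] /CO[_ rz] ->]]].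
    by apply: leq_trans (mxrank_add _ _) _; lia.
  apply: even_spectrum_closed Sx => {}x [y [z [/CO[y2 _] /CO[z2 _] ->]]].
  exact: even_spectrum_sum.
move=> [rx Ex]; have [q NE] : exists q, N = (2 * r + q)%N by exists (N - 2 * r)%N; lia.
subst N; have [g ug [M' [B ME]]] := rank_block rx.
rewrite -(mxconjK x ug); apply: sumset_closure_conj; rewrite ?unitmx_inv // ME.
have EM : even_spectrum M'.
  by apply: (even_spectrum_block (B := B)); rewrite -ME even_spectrum_conj.
have [h [F [f [uh PF Pf exf [F0 fF]]]]] := even_cyclic_dense r0 EM.
have -> : block_mx M' B 0 0 =
    mxconj (invmx (block_mx h 0 0 1%:M)) (block_mx (mxconj h M') (h *m B) 0 0).
  symmetry; apply: mxconjV_eq.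
    by rewrite unitmxE det_ublock det1 mulr1 -unitmxE.
  rewrite !mulmx_block !mulmx0 !mul0mx !addr0 !add0r mulmx1.
  by rewrite /mxconj mulmxKV.
apply: sumset_closure_conj => //.
  by rewrite unitmx_inv unitmxE det_ublock det1 mulr1 -unitmxE.
rewrite -F0; have A := upoly_funalg k.
apply: (zclosure_curve (F := fun t => block_mx (F t) (h *m B) 0 0) _ Pf exf).
  apply: (mxfun_block PF); exact: (mxfun_const A).
move=> t /fF [uF [c [g' [ug' gE c0]]]].
have [h' uh' ->] := block_unit_conj (h *m B) ug' uF.
apply: sumset_closure_conj => //; rewrite gE companion_split; apply: sub_zclosure.
have uK : natmx (2 * r) (2 * r) (compf (2 * r) c) \in unitmx.
  by rewrite -gE !unitmx_mul unitmx_inv ug' uF.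
have Pm := even_companion_parts q r0 c0 uK.
exists (natmx (2 * r + q) (2 * r + q) (parity_part true (2 * r) c)),
       (natmx (2 * r + q) (2 * r + q) (parity_part false (2 * r) c)).
by split=> //; apply: OC; have [] := Pm true; have [] := Pm false.
Qed.

Lemma sigma_eq0 N (M : 'M[k]_N) i : sigma i M = 0 <-> (char_poly M)`_(N - i) = 0.
Proof.
rewrite /sigma; split=> [/eqP|->]; last by rewrite mulr0.
by rewrite mulf_eq0 expf_eq0 oppr_eq0 oner_eq0 andbF => /eqP.
Qed.

Lemma char_poly_rank N (M : 'M[k]_N) n i : (\rank M <= n)%N -> (n < i <= N)%N ->
  (char_poly M)`_(N - i) = 0.
Proof.
move=> rM iN; have [q NE] : exists q, N = (n + q)%N by exists (N - n)%N; lia.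
subst N; have [g ug [M' [B ME]]] := rank_block rM.
rewrite -(char_poly_conj M ug) ME /char_poly /char_poly_mx map_block_mx scalar_mx_block.
rewrite opp_block_mx add_block_mx !map_mx0 !subr0 det_ublock det_scalar coefMXn.
by rewrite (_ : (n + q - i < q)%N) //; lia.
Qed.

(** Beyond 2r the coefficients vanish by the rank bound alone. *)
Lemma even_spectrum_sigma N (M : 'M[k]_N) r : (\rank M <= 2 * r)%N -> (0 < r)%N ->
  (2 * r <= N)%N -> even_spectrum M <->
  forall i, odd i -> (1 <= i <= 2 * r - 1)%N -> sigma i M = 0.
Proof.
move=> rM r0 rN; rewrite (even_spectrumP char0); split=> H i oi.
  by move=> /andP[i1 ir]; apply/sigma_eq0; apply: H => //; lia.
move=> iN; have [ir|ir] := leqP i (2 * r); last by apply: (char_poly_rank rM); rewrite ir.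
by apply/sigma_eq0; apply: H => //; lia.
Qed.

Lemma sigma1 N (M : 'M[k]_N) : (0 < N)%N -> sigma 1 M = \tr M.
Proof. by move=> N0; rewrite /sigma subn1 char_poly_trace // expr1 mulN1r opprK. Qed.

Lemma CS_twos N (e : 'M[k]_N) r : (0 < N)%N -> e *m e = 0 -> \rank e = r ->
  (0 < r)%N -> (2 * r <= N)%N ->
  CS (orbit_of (SL N) e) = Dro N (2 * r) `&`
    [set M | forall i, odd i -> (3 <= i <= 2 * r - 1)%N -> sigma i M = 0] /\
  CS (orbit_of (SL N) e) = Dr N (2 * r) `&`
    [set M | forall i, odd i -> (1 <= i <= 2 * r - 1)%N -> sigma i M = 0].
Proof.
move=> N0 e2 re r0 rN; rewrite (CS_square_zero N0 e2 re r0 rN).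
have DrP (M : 'M[k]_N) : Dr N (2 * r) M -> (\rank M <= 2 * r)%N by [].
have E (M : 'M[k]_N) : Dr N (2 * r) M -> even_spectrum M <-> sl N M /\
    forall i, odd i -> (3 <= i <= 2 * r - 1)%N -> sigma i M = 0.
  move=> /DrP DM; rewrite (even_spectrum_sigma DM) // /sl /= -sigma1 //; split=> [H|[H1 H] i oi ir].
    by split=> [|i oi ir]; apply: H => //; lia.
  have [->//|i1] := eqVneq i 1%N; apply: H => //; lia.
split; apply/seteqP; split=> M.
- by move=> [DM /(E M DM)[]].
- by move=> [[DM sM] H]; split=> //; apply/(E M DM).
- by move=> [DM EM]; split=> //; apply/(even_spectrum_sigma (DrP M DM)).
- by move=> [DM EM]; split=> //; apply/(even_spectrum_sigma (DrP M DM)).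
Qed.

End SecantSquareZero.

(** * Generic pairs of square-zero matrices *)

Section PairModel.
Variable k : closedFieldType.
Hypothesis char0 : [pchar k] =i pred0.

(** Because of the shift by 2, the factor diag(d_i^2) enters between two Vandermonde matrices: the
    determinant detects distinct and nonzero d_i, and extra zero eigenvalues do not contribute to
    the traces. *)
Definition hankel r (p : nat -> k) : 'M[k]_r := \matrix_(a < r, b < r) p (a + b + 2)%N.

Lemma det_hankel r (d : 'rV[k]_r) :
  \det (hankel r (fun m => \sum_i d 0 i ^+ m)) =
  (\prod_(i < r) \prod_(l < r | (i < l)%N) (d 0 l - d 0 i)) ^+ 2 * (\prod_i d 0 i) ^+ 2.
Proof.
have -> : hankel r (fun m => \sum_i d 0 i ^+ m) =
    Vandermonde r d *m diag_mx (\row_i d 0 i ^+ 2) *m (Vandermonde r d)^T.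
  apply/matrixP => a b; rewrite mul_mx_diag !mxE; apply: eq_bigr => i _.
  by rewrite !mxE !exprD; ring.
rewrite !det_mulmx det_tr det_diag det_Vandermonde -[(\prod_i d 0 i) ^+ 2]prodrXl.
under [X in _ * X * _]eq_bigr do rewrite mxE.
by rewrite mulrAC -expr2.
Qed.

Lemma hankel_distinct r (d : 'rV[k]_r) : \det (hankel r (fun m => \sum_i d 0 i ^+ m)) != 0 ->
  (forall i, d 0 i != 0) /\ injective (d 0).
Proof.
rewrite det_hankel mulf_eq0 negb_or !expf_eq0 /= => /andP[/prodf_neq0 V /prodf_neq0 D].
split=> [i|i l il]; first exact: D.
apply/eqP; apply: contraT; rewrite -val_eqE neq_ltn => /orP[] h.
  by have /prodf_neq0/(_ l h) := V i isT; rewrite il subrr eqxx.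
by have /prodf_neq0/(_ i h) := V l isT; rewrite il subrr eqxx.
Qed.

Lemma trig_mulmx n (L M : 'M[k]_n) : is_trig_mx L -> is_trig_mx M ->
  is_trig_mx (L *m M) /\ forall i, (L *m M) i i = L i i * M i i.
Proof.
move=> /is_trig_mxP LT /is_trig_mxP MT; split.
  apply/is_trig_mxP => i l il; rewrite mxE; apply: big1 => c _.
  have [ic|ci] := ltnP i c; first by rewrite LT // mul0r.
  by rewrite MT ?mulr0 // (leq_ltn_trans ci).
move=> i; rewrite mxE (bigD1 i) //= big1 ?addr0 // => c; rewrite -val_eqE neq_ltn => /orP[] ci.
  by rewrite MT ?mulr0.
by rewrite LT ?mul0r.
Qed.

Lemma trig_tr_exp n (L : 'M[k]_n) m : is_trig_mx L -> \tr (L ^+ m) = \sum_i L i i ^+ m.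
Proof.
move=> LT; suff [_ E] : is_trig_mx (L ^+ m) /\ forall i, (L ^+ m) i i = L i i ^+ m.
  by apply: eq_bigr => i _; rewrite E.
elim: m => [|m [IT IE]]; first by split=> [|i]; rewrite ?mxE ?eqxx // scalar_mx_is_trig.
have [T E] := trig_mulmx LT IT; rewrite exprS; split=> // i.
by rewrite -[_ * _]/(_ *m _) E IE exprS.
Qed.

Lemma mxconj_exp n (g Z : 'M[k]_n) m : g \in unitmx -> mxconj g Z ^+ m = mxconj g (Z ^+ m).
Proof.
move=> ug; elim: m => [|m IH]; first by rewrite /mxconj mulmx1 mulmxV.
by rewrite !exprS IH -[_ * _]/(_ *m _) mxconj_mul.
Qed.

(** Triangularisation turns the traces into power sums of the diagonal, whose entries are therefore
    distinct. So [Z] is diagonalisable, and the same argument applies to its diagonal form. *)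
Lemma hankel_diag r (Z : 'M[k]_r) : (0 < r)%N ->
  \det (hankel r (fun m => \tr (Z ^+ m))) != 0 ->
  exists S (d : 'rV_r), [/\ S \in unitmx, forall i, d 0 i != 0, injective (d 0) &
    Z *m S = S *m diag_mx d].
Proof.
case: r Z => // r Z _ hZ.
have hE (L g : 'M[k]_r.+1) : g \in unitmx -> is_trig_mx L -> L = mxconj g Z ->
    (forall i, L i i != 0) /\ injective (fun i => L i i).
  move=> ug LT LE; pose d : 'rV_r.+1 := \row_i L i i.
  have [|d0 di] := @hankel_distinct _ d.
    suff -> : hankel r.+1 (fun m => \sum_i d 0 i ^+ m) = hankel r.+1 (fun m => \tr (Z ^+ m)) by [].
    apply/matrixP => a b; rewrite !mxE -(mxtrace_conj _ ug) -mxconj_exp // -LE trig_tr_exp //.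
    by apply: eq_bigr => i _; rewrite mxE.
  split=> [i|i l il]; first by have := d0 i; rewrite mxE.
  by apply: di; rewrite !mxE.
have [s sE] := closed_field_poly_normal (char_poly Z).
rewrite (monicP (char_poly_monic _)) scale1r in sE.
have [g ug [LT Ld]] := trig_conj sE; have [_ Li] := hE _ g ug LT erefl.
have ss : size s = r.+1 by apply: succn_inj; rewrite -(size_prod_XsubC s id) -sE size_char_poly.
have us : uniq s.
  apply/(uniqP 0) => i l; rewrite !inE ss => ir lr il.
  have := Li (Ordinal ir) (Ordinal lr); rewrite /= !Ld /= => /(_ il) /(congr1 val); exact.
have /diagonalizableP [P uP /diagonalizable_forPex [d /(simmxPp (stablemx_unit _ uP)) dE]] :
    exists2 rs, uniq rs & mxminpoly Z %| \prod_(x <- rs) ('X - x%:P).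
  by exists s => //; rewrite -sE mxminpoly_dvd_char.
have DE : diag_mx d = mxconj P Z by rewrite /mxconj dE mulmxK.
have [d0 di] := hE _ P uP (diag_mx_is_trig d) DE.
exists (invmx P), d; split; first by rewrite unitmx_inv.
- by move=> i; have := d0 i; rewrite mxE eqxx.
- by move=> i l il; apply: di; rewrite !mxE !eqxx.
- by rewrite DE /mxconj !mulmxA mulVmx // mul1mx.
Qed.

Definition model_x r q : 'M[k]_(r + r + q) := block_mx (block_mx 0 1%:M 0 0) 0 0 0.
Definition model_y r q (d : 'rV[k]_r) : 'M[k]_(r + r + q) := block_mx (block_mx 0 0 (diag_mx d) 0) 0 0 0.

Lemma unit_of_diag r (d : 'rV[k]_r) : (forall i, d 0 i != 0) -> diag_mx d \in unitmx.
Proof. by move=> d0; rewrite unitmxE unitfE det_diag; apply/prodf_neq0 => i _; apply: d0. Qed.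

(** With x = A1 R1, y = A2 R2 and Z = R2 A1 R1 A2, the positive powers of [x y] and [Z] have equal
    traces. If Z S = S D, then U = A1 R1 A2 S and V = A2 S satisfy x V = U, y U = V D and x U = y V
    = 0; the common kernel of R1 and R2 completes the basis. *)
Lemma pair_frame r q (x y : 'M[k]_(r + r + q)) : (0 < r)%N -> x *m x = 0 -> y *m y = 0 ->
  \rank x = r -> \rank y = r -> \det (hankel r (fun m => \tr ((x *m y) ^+ m))) != 0 ->
  exists G (d : 'rV_r), [/\ G \in unitmx, forall i, d 0 i != 0, injective (d 0) &
    x *m G = G *m model_x r q /\ y *m G = G *m model_y q d].
Proof.
move=> r0 x2 y2 /rank_factor[A1 [R1 [xE rA1 rR1]]] /rank_factor[A2 [R2 [yE rA2 rR2]]] hZ.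
have RA1 : R1 *m A1 = 0 by apply: square_zero_factor; rewrite -?xE.
have RA2 : R2 *m A2 = 0 by apply: square_zero_factor; rewrite -?yE.
pose P := R1 *m A2; pose Q := R2 *m A1; pose Z := Q *m P.
have xyE m : (x *m y) ^+ m.+1 = A1 *m P *m Z ^+ m *m R2.
  elim: m => [|m IH]; first by rewrite expr1 expr0 mulmx1 xE yE /P !mulmxA.
  rewrite exprSr IH exprSr xE yE -[_ * (_ *m _)]/(_ *m _) -[_ * Z]/(_ *m _) /Z /Q /P !mulmxA.
  by [].
have trE m : \tr ((x *m y) ^+ m.+1) = \tr (Z ^+ m.+1).
  rewrite xyE mxtrace_mulC exprS -[Z * _]/(Z *m _); congr (\tr _).
  by rewrite /Z /Q !mulmxA.
have [|S [d [uS d0 di ZS]]] := @hankel_diag r Z r0.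
  suff -> : hankel r (fun m => \tr (Z ^+ m)) = hankel r (fun m => \tr ((x *m y) ^+ m)) by [].
  apply/matrixP => a b; by rewrite !mxE addn2 trE.
have uD := unit_of_diag d0; have uZ : Z \in unitmx.
  by have : Z *m S \in unitmx by [rewrite ZS unitmx_mul uS]; rewrite unitmx_mul => /andP[].
have [uQ uP] : Q \in unitmx /\ P \in unitmx by move: uZ; rewrite unitmx_mul => /andP[].
pose U := A1 *m (P *m S); pose V := A2 *m S; pose R := col_mx R1 R2.
have RW : R *m row_mx U V = block_mx 0 (P *m S) (Z *m S) 0.
  rewrite /R mul_col_row /U /V !(mulmxA R1) !(mulmxA R2) RA1 RA2 !mul0mx -/P -/Q.
  by rewrite [Q *m (P *m S)]mulmxA.
have uRW : R *m row_mx U V \in unitmx.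
  have [i1 i1E] : exists B, P *m S *m B = 1%:M by exists (invmx (P *m S)); rewrite mulmxV // unitmx_mul uP.
  have [i2 i2E] : exists B, Z *m S *m B = 1%:M by exists (invmx (Z *m S)); rewrite mulmxV // unitmx_mul uZ.
  have [] // := @mulmx1_unit _ _ (R *m row_mx U V) (block_mx 0 i2 i1 0).
  by rewrite RW mulmx_block !mul0mx !mulmx0 !addr0 !add0r i1E i2E -scalar_mx_block.
have rR : \rank R = (r + r)%N.
  by apply: (@right_inv_rank _ _ _ _ (row_mx U V *m invmx (R *m row_mx U V))); rewrite mulmxA mulmxV.
have r1 : \rank (row_mx 1%:M 0 : 'M[k]_(r + r, r + r + q)) = (r + r)%N.
  by apply: (@right_inv_rank _ _ _ _ (col_mx 1%:M 0)); rewrite mul_row_col mulmx1 mulmx0 addr0.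
have [H uH HE] := row_transport r1 rR.
pose K : 'M_(r + r + q, q) := invmx H *m col_mx 0 1%:M.
have RK : R *m K = 0 by rewrite /K mulmxA -HE mulmxK // mul_row_col mulmx0 mul0mx addr0.
have [RK1 RK2] : R1 *m K = 0 /\ R2 *m K = 0.
  by move: RK; rewrite /R mul_col_mx -[0 in X in X -> _]col_mx0 => /eq_col_mx.
exists (row_mx (row_mx U V) K), d; split=> //.
  have e : col_mx R (row_mx 0 1%:M *m H) *m row_mx (row_mx U V) K =
     block_mx (R *m row_mx U V) 0 (row_mx 0 1%:M *m H *m row_mx U V) 1%:M.
    rewrite mul_col_row RK /K [X in block_mx _ _ _ X]mulmxA mulmxK //.
    by rewrite mul_row_col mul0mx add0r mulmx1.
  have : block_mx (R *m row_mx U V) 0 (row_mx 0 1%:M *m H *m row_mx U V) 1%:M \in unitmx.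
    by rewrite unitmxE det_lblock det1 mulr1 -unitmxE.
  by rewrite -e unitmx_mul => /andP[].
split.
- rewrite /model_x mul_row_block !mulmx0 !addr0 mul_row_block !mulmx0 !addr0 mulmx1 ?add0r.
  rewrite mul_mx_row xE -(mulmxA A1 R1 K) RK1 mulmx0 mul_mx_row; congr (row_mx (row_mx _ _) _).
    by rewrite /U -!mulmxA (mulmxA R1) RA1 mul0mx mulmx0.
  by rewrite /V /U -!mulmxA (mulmxA R1).
- rewrite /model_y mul_row_block !mulmx0 !addr0 mul_row_block !mulmx0 !addr0 add0r.
  rewrite mul_mx_row yE -(mulmxA A2 R2 K) RK2 mulmx0 mul_mx_row; congr (row_mx (row_mx _ _) _).
    by rewrite /U /V -!mulmxA -ZS (mulmxA R2) -/Q /Z -!mulmxA.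
  by rewrite /V -!mulmxA (mulmxA R2) RA2 mul0mx mulmx0.
Qed.

Definition model_centraliser r q (c : 'rV[k]_r) (h : 'M[k]_q) : 'M[k]_(r + r + q) :=
  block_mx (block_mx (diag_mx c) 0 0 (diag_mx c)) 0 0 h.

Lemma commute_diag r (a : 'M[k]_r) (d : 'rV[k]_r) : injective (d 0) ->
  a *m diag_mx d = diag_mx d *m a -> exists c, a = diag_mx c.
Proof.
move=> di ad; have /diag_mxP[c ->] : is_diag_mx a; last by exists c.
apply/is_diag_mxP => i l il; have /matrixP/(_ i l) := ad; rewrite mul_mx_diag mul_diag_mx !mxE.
rewrite mulrC => /eqP; rewrite -subr_eq0 -mulrBl mulf_eq0 subr_eq0 => /orP[|/eqP//].
by move=> /eqP/di e; rewrite e eqxx in il.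
Qed.

(** Commuting with the first matrix makes the two r x r diagonal blocks equal; commuting with the
    second makes this block commute with D, hence diagonal. As D is invertible, all mixed blocks
    vanish. *)
Lemma model_commute r q (d : 'rV[k]_r) z : (forall i, d 0 i != 0) -> injective (d 0) ->
  commutes z (model_x r q, model_y q d) <-> exists c h, z = model_centraliser c h.
Proof.
move=> d0 di; have uD := unit_of_diag d0; split; last first.
  move=> [c [h ->]]; split; rewrite /= /model_centraliser /model_x /model_y !mulmx_block;
    rewrite !(mulmx0, mul0mx, addr0, add0r) ?(mulmx1, mul1mx) //.
  by rewrite diag_mxC.
move=> [/=]; rewrite -[z]submxK; set A := ulsubmx z; set B := ursubmx z.
set C := dlsubmx z; set h := drsubmx z.
rewrite /model_x /model_y !mulmx_block !(mulmx0, mul0mx, addr0, add0r).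
move=> /eq_block_mx[xA xB xC _] /eq_block_mx[yA yB yC _].
move: xA xB xC yA yB yC; rewrite -[A]submxK -[B]vsubmxK -[C]hsubmxK.
set a := ulsubmx A; set b := ursubmx A; set c := dlsubmx A; set e := drsubmx A.
rewrite !mulmx_block !mul_block_col !mul_row_block !(mulmx0, mul0mx, addr0, add0r, mulmx1, mul1mx).
rewrite -!col_mx0 -!row_mx0.
move=> /eq_block_mx[c0 ae _ _] /esym/eq_col_mx[B0 _] /eq_row_mx[_ C0].
move=> /eq_block_mx[bD _ eD Db] /esym/eq_col_mx[_ B1] /eq_row_mx[C1 _].
have b0 : b = 0 by rewrite -(mulmxK uD b) bD mul0mx.
have B10 : usubmx B = 0 by rewrite -(mulKmx uD (usubmx B)) B1 mulmx0.
have C10 : rsubmx C = 0 by rewrite -(mulmxK uD (rsubmx C)) C1 mul0mx.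
have [a' aE] : exists a', a = diag_mx a' by apply: (commute_diag di); rewrite ae eD ae.
exists a', h; rewrite /model_centraliser b0 -c0 -ae aE B0 B10 C0 C10.
by rewrite col_mx0 row_mx0.
Qed.

Definition toral_model r q (g : 'M[k]_(r + r + q)) : set 'M[k]_(r + r + q) :=
  [set z | exists c h, \tr (model_centraliser c h) = 0 /\ z = mxconj g (model_centraliser c h)].

Lemma polyfun_hankel N r :
  polyfun (fun t : 'M[k]_(N, N + N) => \det (hankel r (fun m => \tr ((lsubmx t *m rsubmx t) ^+ m)))).
Proof.
have PA := polyfun_funalg k N (N + N); apply: (fa_det PA) => a b.
have := fa_tr PA (mxfun_exp PA (a + b + 2) (mxfun_mul PA (mxfun_lsub (@mxfun_id k N (N + N))) (mxfun_rsub (@mxfun_id k N (N + N))))).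
by congr polyfun; apply: funext => t; rewrite mxE.
Qed.

Lemma model_hankel r q : \det (hankel r (fun m => \tr ((model_x r q *m model_y q (\row_i i.+1%:R)) ^+ m))) != 0.
Proof.
set d := \row_i _.
have -> : hankel r (fun m => \tr ((model_x r q *m model_y q d) ^+ m)) = hankel r (fun m => \sum_i d 0 i ^+ m).
  apply/matrixP => a b; rewrite !mxE addn2.
  pose L : 'M_(r + r + q) := block_mx (block_mx (diag_mx d) 0 0 0) 0 0 0.
  have -> : model_x r q *m model_y q d = L.
    by rewrite /model_x /model_y !mulmx_block !(mulmx0, mul0mx, addr0, add0r, mul1mx).
  rewrite trig_tr_exp; last by rewrite !is_trig_block_mx // diag_mx_is_trig !mx0_is_trig !eqxx.
  rewrite big_split_ord /= big_split_ord /= [X in _ + X]big1 => [|i _].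
    rewrite [X in _ + X + _]big1 => [|i _].
      by rewrite !addr0; apply: eq_bigr => i _; rewrite /L !block_mxEul mxE eqxx.
    by rewrite /L block_mxEul block_mxEdr mxE expr0n.
  by rewrite /L block_mxEdr mxE expr0n.
have dn (i j : nat) : (i < j)%N -> (j.+1%:R - i.+1%:R : k) != 0.
  by move=> ij; rewrite -natrB ?ltnS ?(ltnW ij) //; apply: (natr_neq0 char0); lia.
rewrite det_hankel mulf_neq0 // expf_neq0 //; apply/prodf_neq0 => i _.
  by apply/prodf_neq0 => l il; rewrite !mxE dn.
by rewrite mxE; apply: (natr_neq0 char0).
Qed.

Lemma model_orbit r q (e : 'M[k]_(r + r + q)) (d : 'rV[k]_r) : (0 < r)%N -> e *m e = 0 -> \rank e = r ->
  (forall i, d 0 i != 0) ->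
  orbit_of (SL (r + r + q)) e (model_x r q) /\ orbit_of (SL (r + r + q)) e (model_y q d).
Proof.
move=> r0 e2 re d0; have N0 : (0 < r + r + q)%N by lia.
split; apply/(square_zero_orbit _ N0 e2); rewrite re /model_x /model_y; split.
- by rewrite !mulmx_block !(mulmx0, mul0mx, addr0, add0r, block_mx0).
- rewrite rank_diag_block_mx mxrank0 addn0 block_mxEv row_mx0 rank_col_mx0 rank_row_0mx.
  exact: mxrank1.
- by rewrite !mulmx_block !(mulmx0, mul0mx, addr0, add0r, block_mx0).
- rewrite rank_diag_block_mx mxrank0 addn0 block_mxEv row_mx0 rank_col_0mx rank_row_mx0.
  by rewrite mxrank_unit // unit_of_diag.
Qed.

Lemma generic_isotropy_model r q (e : 'M[k]_(r + r + q)) (P : set 'M[k]_(r + r + q) -> Prop) :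
  let O := orbit_of (SL (r + r + q)) e in
  (0 < r)%N -> e *m e = 0 -> \rank e = r ->
  (forall g, g \in unitmx -> P (toral_model g)) -> generic_isotropy O P.
Proof.
move=> O r0 e2 re HP; have N0 : (0 < r + r + q)%N by lia.
pose f0 (t : 'M[k]_(r + r + q, r + r + q + (r + r + q))) := \det (hankel r (fun m => \tr ((lsubmx t *m rsubmx t) ^+ m))).
(* The model pair lies in the orbit itself, so one polynomial without rescaling suffices. *)
pose Fam f := f = f0.
pose U := [set u | (O `*` O) u /\ exists2 f, Fam f & f (pair_mx u) != 0].
have PF f : Fam f -> polyfun f by move=> ->; exact: polyfun_hankel.
have exF : exists f x y, [/\ Fam f, O x, O y & f (row_mx x y) != 0].
  pose d : 'rV[k]_r := \row_i i.+1%:R.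
  have [|Ox Oy] := @model_orbit r q e d r0 e2 re; first by move=> i; rewrite mxE; apply: (natr_neq0 char0).
  exists f0, (model_x r q), (model_y q d); split=> //.
  by rewrite /f0 row_mxKl row_mxKr model_hankel.
have cent u : U u -> exists2 g, g \in unitmx &
    forall z, commutes z u <-> exists c h, z = mxconj g (model_centraliser c h).
  case: u => x y [[/= /(square_zero_orbit _ N0 e2)[x2 rx] /(square_zero_orbit _ N0 e2)[y2 ry]] [_ ->]].
  rewrite /f0 /pair_mx /= row_mxKl row_mxKr => hk; rewrite re in rx ry.
  have [G [d [uG d0 di [xG yG]]]] := pair_frame r0 x2 y2 rx ry hk.
  have xE : x = mxconj G (model_x r q) by rewrite /mxconj -xG mulmxK.
  have yE : y = mxconj G (model_y q d) by rewrite /mxconj -yG mulmxK.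
  have cj z z' : mxconj G z *m mxconj G z' = mxconj G z' *m mxconj G z <-> z *m z' = z' *m z.
    rewrite -!mxconj_mul //; split=> [E|-> //].
    by rewrite -[LHS](mxconjK _ uG) E mxconjK.
  exists G => // z; rewrite -[z in commutes z](mxconjVK z uG) xE yE /commutes /= !cj.
  rewrite -[_ /\ _]/(commutes _ (model_x r q, model_y q d)) model_commute //.
  split=> [[c [h E]]|[c [h ->]]]; exists c, h; last by rewrite mxconjK.
  by rewrite -E mxconjVK.
have [Uo Ud] := @generic_locus k (r + r + q) e N0 Fam PF exF.
exists U; split=> // [u v Uu Uv|u Uu].
  have [gu ugu Hu] := cent u Uu; have [gv ugv Hv] := cent v Uv.
  have ugu' : invmx gu \in unitmx by rewrite unitmx_inv.
  apply: (@stabiliser_transport _ _ u v (gv *m invmx gu)) => // [|z].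
    by rewrite unitmx_mul ugv.
  rewrite Hv; split=> [[c [h ->]]|[z' /Hu [c [h ->]] ->]].
    exists (mxconj gu (model_centraliser c h)); first by apply/Hu; exists c, h.
    by rewrite mxconjM // mxconjK.
  by exists c, h; rewrite mxconjM // mxconjK.
have [g ug Hu] := cent u Uu.
suff -> : isotropy u = toral_model g by exact: HP.
apply/seteqP; split=> z.
  move=> /isotropyP [trz /Hu [c [h zE]]]; exists c, h; split=> //.
  by rewrite -(mxtrace_conj _ ug) -zE.
move=> [c [h [tr0 zE]]]; apply/isotropyP; split; first by rewrite zE mxtrace_conj.
by apply/Hu; exists c, h.
Qed.

Lemma trace_model r q (c : 'rV[k]_r) (h : 'M[k]_q) :
  \tr (model_centraliser c h) = 2 * \sum_i c 0 i + \tr h.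
Proof.
by rewrite /model_centraliser !mxtrace_block mxtrace_diag mulr_natl.
Qed.

Lemma iso_gl_toral_model r q (g : 'M[k]_(r.+1 + r.+1 + q)) : g \in unitmx ->
  iso_gl_toral q r (toral_model g).
Proof.
move=> ug; have nz2 : (2 : k) != 0 by apply: (natr_neq0 char0).
(* The last toral coordinate is determined by the others and by tr z = 0. *)
pose c (t : 'M[k]_q * 'rV[k]_r) : 'rV[k]_r.+1 := \row_i
  if unlift ord_max i is Some l then t.2 0 l else - (\tr t.1 / 2) - \sum_l t.2 0 l.
have cl t l : c t 0 (lift ord_max l) = t.2 0 l by rewrite mxE liftK.
have cm t : c t 0 ord_max = - (\tr t.1 / 2) - \sum_l t.2 0 l by rewrite mxE unlift_none.
have lm i : i = ord_max \/ exists l : 'I_r, i = lift ord_max l.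
  by case: (unliftP ord_max i) => [l ->|->]; [right; exists l|left].
have csum t : 2 * \sum_i c t 0 i + \tr t.1 = 0.
  rewrite big_ord_recr /= cm (eq_bigr (fun l => t.2 0 l)) => [|l _].
    by rewrite addrCA subrr addr0 mulrN mulrC divfK // addNr.
  by rewrite -cl; congr (c t 0 _); apply: val_inj; rewrite /= /bump leqNgt ltn_ord.
have clin a t u : c (a *: t + u) = a *: c t + c u.
  have E (A B : 'rV[k]_r.+1) i : (a *: A + B) 0 i = a * A 0 i + B 0 i by rewrite !mxE.
  apply/rowP => i; rewrite E; have [->|[l ->]] := lm i; rewrite ?cl ?cm.
    rewrite /= mxtraceD mxtraceZ (eq_bigr (fun l => a * t.2 0 l + u.2 0 l)) => [|l _]; last by rewrite !mxE.
    by rewrite big_split /= -mulr_sumr; ring.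
  by rewrite /= !mxE.
pose f t := mxconj g (model_centraliser (c t) t.1).
have flin : linear f.
  move=> a t u; rewrite /f -mxconjZ -mxconjD clin /model_centraliser.
  by rewrite !linearD !linearZ /= !scale_block_mx !add_block_mx !scaler0 !addr0.
pose F : {linear ('M[k]_q * 'rV[k]_r)%type -> 'M[k]_(r.+1 + r.+1 + q)} :=
  HB.pack f (GRing.isLinear.Build _ _ _ _ f flin).
exists F; split; last first.
  exists (invmx g); first by rewrite unitmx_inv.
  move=> _ [t _ <-]; rewrite /F /= /f mxconjK // /model_centraliser.
  by rewrite !is_diag_block_mx // !mx0_is_diag !diag_mx_is_diag !eqxx.
split.
- move=> [h d] [h' d'] /(congr1 (mxconj (invmx g))); rewrite /F /= /f !mxconjK //.
  move=> /eq_block_mx[/eq_block_mx[cc _ _ _] _ _ /= hh]; congr (_, _) => //.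
  apply/rowP => l; have /matrixP/(_ (lift ord_max l) (lift ord_max l)) := cc.
  by rewrite !mxE eqxx !liftK.
- apply/seteqP; split=> z.
    move=> [t _ <-]; exists (c t), t.1; split=> //.
    by rewrite trace_model csum.
  move=> [c' [h [tr0 ->]]]; exists (h, \row_l c' 0 (lift ord_max l)) => //.
  rewrite /F /= /f /=; congr (mxconj g (model_centraliser _ _)); apply/rowP => i.
  have [->|[l ->]] := lm i; last by rewrite cl mxE.
  have : \sum_i c (h, \row_l c' 0 (lift ord_max l)) 0 i = \sum_i c' 0 i.
    by apply: (mulfI nz2); apply: (addIr (\tr h)); rewrite csum -trace_model.
  rewrite !big_ord_recr /= (eq_bigr (fun i => c' 0 (widen_ord (leqnSn r) i))) => [/addrI //|l _].
  have -> : widen_ord (leqnSn r) l = lift ord_max l.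
    by apply: val_inj; rewrite /= /bump leqNgt ltn_ord.
  by rewrite cl mxE.
- move=> u v; rewrite /F /= /f -mxconj_lie //; congr mxconj.
  have -> : c (gl_toral_lie u v) = 0.
    apply/rowP => i; rewrite [RHS]mxE; have [->|[l ->]] := lm i; last by rewrite cl mxE.
    by rewrite cm /= mxtrace_lie mul0r oppr0 add0r big1 ?oppr0 // => l _; rewrite mxE.
  rewrite /model_centraliser /lie !mulmx_block !(mulmx0, mul0mx, addr0, add0r).
  rewrite !opp_block_mx !add_block_mx !oppr0 !addr0 raddf0.
  by rewrite [diag_mx (c v) *m _]diag_mxC subrr.
Qed.

Lemma generic_isotropy_twos N (e : 'M[k]_N) r : (0 < r)%N -> (2 * r <= N)%N ->
  e *m e = 0 -> \rank e = r ->
  generic_isotropy (orbit_of (SL N) e) (iso_gl_toral (N - 2 * r) (r - 1)).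
Proof.
case: r => // r _ rN e2 re; have [q NE] : exists q, N = (r.+1 + r.+1 + q)%N.
  by exists (N - 2 * r.+1)%N; lia.
have -> : (N - 2 * r.+1 = q)%N by lia.
rewrite subn1 /=; clear rN; subst N; apply: generic_isotropy_model => //.
by move=> g ug; apply: iso_gl_toral_model.
Qed.

End PairModel.

(** * Sphericity and rank of square-zero orbits *)

Section SphericalOrbit.
Variable k : closedFieldType.

(* Row c of M is the last row of the adjugate of the leading block of size c + 1. *)
Lemma lower_elimination r (F : nat -> nat -> k) :
  (forall i, (i <= r)%N -> \det (natmx i i F) != 0) ->
  exists M : 'M[k]_r, [/\ is_trig_mx M, forall c, M c c != 0,
    forall c d : 'I_r, (d < c)%N -> (M *m natmx r r F) c d = 0 &
    forall c, (M *m natmx r r F) c c != 0].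
Proof.
move=> F0; pose A c : 'M[k]_c.+1 := natmx c.+1 c.+1 F.
pose a c e : k := if (e <= c)%N then (\adj (A c)) ord_max (inord e) else 0.
have aF (c d : 'I_r) : (d <= c)%N ->
    (natmx r r a *m natmx r r F) c d = \det (A c) * (d == c :> nat)%:R.
  move=> dc; have dc' : (d < c.+1)%N by [].
  transitivity ((\adj (A c) *m A c) ord_max (Ordinal dc')); last first.
    by rewrite mul_adj_mx mxE -val_eqE /= eq_sym mulr_natr.
  rewrite mxE [RHS]mxE (bigID (fun e : 'I_r => (e < c.+1)%N)) /= [X in _ + X]big1 ?addr0; last first.
    by move=> e; rewrite -leqNgt => ce; rewrite mxE /a leqNgt ce mul0r.
  rewrite (big_ord_narrow (ltn_ord c)) /=; apply: eq_bigr => e _.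
  rewrite [natmx r r a _ _]mxE [natmx r r F _ _]mxE /a /= -ltnS ltn_ord inord_val.
  by congr (_ * _); rewrite /A mxE.
have Mcc c : natmx r r a c c != 0 :> k.
  rewrite mxE /a leqnn (_ : inord c = ord_max :> 'I_c.+1); last by apply: val_inj; rewrite /= inordK.
  rewrite mxE /cofactor addnn -signr_odd odd_double mul1r.
  suff -> : row' ord_max (col' ord_max (A c)) = natmx c c F by exact: F0 (ltnW (ltn_ord c)).
  have bumpE (e : 'I_c) : bump c e = e by rewrite /bump leqNgt ltn_ord.
  by apply/matrixP => e d; rewrite !mxE /= !bumpE.
exists (natmx r r a); split=> //.
- by apply/is_trig_mxP => c d cd; rewrite mxE /a leqNgt cd.
- by move=> c d dc; rewrite aF ?(ltnW dc) // (ltn_eqF dc) mulr0.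
- by move=> c; rewrite aF // eqxx mulr1 F0.
Qed.

Lemma sign_eq1 (z : int) : [pchar k] =i pred0 -> (-1 : k) ^ z = 1 -> exists a, z = a + a.
Proof.
move=> char0; have N11 : (-1 : k) != 1.
  rewrite -subr_eq0 -opprD oppr_eq0; apply: (natr_neq0 char0 (n := 2)); lia.
have sgn n : (-1 : k) ^+ n = 1 -> ~~ odd n.
  by rewrite -signr_odd; case: (odd n) => // /eqP; rewrite expr1 (negbTE N11).
case: z => n.
  by move=> /sgn oN; exists (n./2%:Z); lia.
rewrite -[_ ^ _]/((-1) ^- n.+1) => /eqP; rewrite invr_eq1 => /eqP/sgn oN.
by exists (- (n.+1)./2%:Z); lia.
Qed.

Section Orbit.
Variables (N r : nat).
Hypotheses (N0 : (0 < N)%N) (rN : (2 * r <= N)%N).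
Let S := rowsel k N r.
Let T := colsel k N r.

(** The orbit representative with ones on the antidiagonal of the lower-left r x r corner; its orbit
    under the upper triangular group is dense. *)
Definition corner_nilp : 'M[k]_N := S^T *m T^T.
Let J := corner_nilp.

Let hT m (M : 'M_(r, m)) (i : 'I_N) l : (r <= i)%N -> (T *m M) i l = 0.
Proof.
move=> ri; rewrite mxE big1 // => c _; rewrite !mxE (_ : (_ == _) = false) ?mul0r //.
by have := ltn_ord c; lia.
Qed.

Let hTc m (M : 'M_(r, m)) (i : 'I_N) (c : 'I_r) l : i = c :> nat -> (T *m M) i l = M c l.
Proof.
move=> ic; rewrite mxE (bigD1 c) //= !mxE ic eqxx mul1r big1 ?addr0 // => d.
by rewrite -val_eqE /= !mxE ic eq_sym => /negbTE ->; rewrite mul0r.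
Qed.

Let hSt m (M : 'M_(r, m)) (i : 'I_N) l : (i < N - r)%N -> (S^T *m M) i l = 0.
Proof.
move=> ri; rewrite mxE big1 // => c _; rewrite !mxE (_ : (_ == _) = false) ?mul0r //.
by have := ltn_ord c; lia.
Qed.

Let hStc m (M : 'M_(r, m)) (i : 'I_N) (c : 'I_r) l : i = (N.-1 - c)%N :> nat -> (S^T *m M) i l = M c l.
Proof.
move=> ic; have cr := ltn_ord c; rewrite mxE (bigD1 c) //= !mxE ic eqxx mul1r big1 ?addr0 // => d.
have dr := ltn_ord d; rewrite -val_eqE /= !mxE ic => dc.
by rewrite (_ : (_ == _) = false) ?mul0r //; lia.
Qed.

Let hS m (M : 'M_(m, r)) i (l : 'I_N) : (l < N - r)%N -> (M *m S) i l = 0.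
Proof.
move=> lr; rewrite mxE big1 // => c _; rewrite !mxE (_ : (_ == _) = false) ?mulr0 //.
by have := ltn_ord c; lia.
Qed.

Let hSc m (M : 'M_(m, r)) i (l : 'I_N) (c : 'I_r) : l = (N.-1 - c)%N :> nat -> (M *m S) i l = M i c.
Proof.
move=> ic; have cr := ltn_ord c; rewrite mxE (bigD1 c) //= !mxE ic eqxx mulr1 big1 ?addr0 // => d.
have dr := ltn_ord d; rewrite -val_eqE /= !mxE ic => dc.
by rewrite (_ : (_ == _) = false) ?mulr0 //; lia.
Qed.

Let MT m (M : 'M_(m, N)) i (l : 'I_N) (c : 'I_r) : l = c :> nat -> (M *m T) i c = M i l.
Proof.
move=> lc; rewrite mxE (bigD1 l) //= !mxE lc eqxx mulr1 big1 ?addr0 // => d.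
by rewrite -val_eqE /= !mxE lc => /negbTE ->; rewrite mulr0.
Qed.

Let index_cases (i : 'I_N) : [\/ exists c : 'I_r, i = c :> nat, (r <= i < N - r)%N |
  exists c : 'I_r, i = (N.-1 - c)%N :> nat].
Proof.
have iN := ltn_ord i; have [ir|ri] := ltnP i r; first by constructor 1; exists (Ordinal ir).
have [iM|Mi] := ltnP i (N - r); first by constructor 2.
have ir : (N.-1 - i < r)%N by lia.
by constructor 3; exists (Ordinal ir) => /=; lia.
Qed.

(* With X = S y T the corner of y and M X upper triangular, the conjugator is
   b = S^T M S + T M S y + Pi (1 - y T X^-1 S), Pi being the projection onto the
   middle coordinates. *)
Lemma corner_conj y : y *m y = 0 -> \rank y = r -> (forall i, (i <= r)%N -> Delta i y != 0) ->
  exists2 b, upper_SL b & mxconj b y = J.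
Proof.
move=> y2 ry Dy; have /= key := corner_identity ry (Dy r (leqnn r)).
set X := rowsel k N r *m y *m colsel k N r in key; rewrite -/S -/T in X key.
pose F c d := matf y (N.-1 - c)%N d.
have corner i : (i <= r)%N -> rowsel k N i *m y *m colsel k N i = natmx i i F.
  move=> ir; have iN : (i <= N)%N by lia.
  by rewrite -{1}(matfK y) rowselE // colselE.
have [|M [MT' Mc MX Xc]] := @lower_elimination r F.
  by move=> i ir; rewrite -corner //; apply: Dy.
rewrite -corner // -/S -/T -/X in MX Xc.
pose p (l : nat) : k := ((r <= l) && (l < N - r))%N%:R.
pose Z : 'M_N := 1%:M - y *m T *m invmx X *m S.
pose b := S^T *m (M *m S) + T *m (M *m S *m y) + tor N p *m Z.
have hD (A : 'M_N) i l : (tor N p *m A) i l = p i * A i l by rewrite mul_diag_mx !mxE.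
have bE i l : b i l = (S^T *m (M *m S)) i l + (T *m (M *m S *m y)) i l + p i * Z i l.
  by rewrite mxE hD mxE.
have b1 (i : 'I_N) (c : 'I_r) l : i = c :> nat -> b i l = (M *m S *m y) c l.
  move=> ic; have cr := ltn_ord c; rewrite bE (hTc _ _ ic) hSt ?ic; last by lia.
  by rewrite /p leqNgt cr mul0r addr0 add0r.
have b2 (i : 'I_N) (c : 'I_r) l : i = (N.-1 - c)%N :> nat -> b i l = (M *m S) c l.
  move=> ic; have cr := ltn_ord c; rewrite bE (hStc _ _ ic) hT ?ic; last by lia.
  by rewrite /p (_ : (_ && _) = false) ?mul0r ?addr0 //; lia.
have b3 (i l : 'I_N) : (r <= i < N - r)%N -> b i l = (i == l)%:R - (y *m T *m invmx X *m S) i l.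
  move=> im; have /andP[i1 i2] := im; rewrite bE hT // hSt // /p im mul1r !add0r /Z.
  by move: (y *m T *m invmx X *m S) => V; rewrite !mxE.
have ub : upper_mx b.
  move=> i l li; have [[c ic]|im|[c ic]] := index_cases i.
  - rewrite (b1 _ _ _ ic); have cr := ltn_ord c; have lr : (l < r)%N by lia.
    rewrite -(@MT _ _ _ l (Ordinal lr)) // -!mulmxA -/S -/T [S *m (y *m T)]mulmxA -/X.
    by rewrite MX //= -ic.
  - have /andP[i1 i2] := im; rewrite b3 // hS; last by lia.
    by rewrite subr0 -val_eqE /= gtn_eqF.
  - rewrite (b2 _ _ _ ic); have cr := ltn_ord c; have [lr|lr] := ltnP l (N - r); first exact: hS.
    have dr : (N.-1 - l < r)%N by have := ltn_ord l; lia.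
    rewrite (@hSc _ _ _ l (Ordinal dr)) /=; last by have := ltn_ord l; lia.
    by apply: (is_trig_mxP MT') => /=; lia.
have bd i : b i i != 0.
  have [[c ic]|im|[c ic]] := index_cases i.
  - rewrite (b1 _ _ _ ic) -(MT _ _ ic) -!mulmxA -/S -/T [S *m (y *m T)]mulmxA -/X.
    exact: Xc.
  - by have /andP[i1 i2] := im; rewrite b3 // hS // subr0 eqxx oner_neq0.
  - by rewrite (b2 _ _ _ ic) (hSc _ _ ic).
have ubu : b \in unitmx by rewrite unitmxE unitfE upper_det //; apply/prodf_neq0 => i _.
have TB : T^T *m b = M *m S *m y.
  apply/matrixP => c l; have cN : (c < N)%N by have := ltn_ord c; lia.
  transitivity ((T^T *m b)^T l c); first by rewrite [RHS]mxE.
  rewrite trmx_mul trmxK (@MT _ _ _ (Ordinal cN) c) // mxE.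
  exact: b1.
have by_ : b *m y = J *m b.
  rewrite /J /corner_nilp -mulmxA -/T TB /b !mulmxDl -!mulmxA y2 !mulmx0 addr0.
  by rewrite /Z mulmxBl mul1mx key subrr mulmx0 addr0.
have [a a0 SLa] := SL_scale N0 ubu.
exists (a *: b); last by rewrite mxconj_scale //; apply: mxconj_eq.
by split=> // i l li; rewrite mxE ub // mulr0.
Qed.

Lemma corner_nilpE : J = natmx N N (fun i l => ((i == N.-1 - l) && (l < r))%N%:R).
Proof.
apply/matrixP => i l; rewrite [RHS]mxE; have iN := ltn_ord i.
have [ir|ri] := ltnP i (N - r).
  by rewrite /J /corner_nilp hSt // (_ : (_ && _) = false) //; have := ltn_ord l; lia.
have [[c ic]|im|[c ic]] := index_cases i; try by have := ltn_ord c; lia.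
  by lia.
have cr := ltn_ord c; rewrite /J /corner_nilp (hStc _ _ ic) !mxE ic; congr (nat_of_bool _)%:R.
have [->|lc] := eqVneq (l : nat) c; first by rewrite eqxx cr.
by symmetry; apply/negbTE/negP => /andP[/eqP E lr]; move/eqP: lc; apply; lia.
Qed.

Lemma Delta_corner i : (i <= r)%N -> Delta i J = 1.
Proof.
move=> ir; have iN : (i <= N)%N by lia.
rewrite /Delta corner_nilpE rowselE // colselE // -[RHS](det1 k i); congr (\det _).
apply/matrixP => c d; rewrite !mxE; congr (nat_of_bool _)%:R; rewrite -val_eqE /=.
by have := ltn_ord c; have := ltn_ord d; lia.
Qed.

Lemma corner_square_zero : J *m J = 0 /\ \rank J = r.
Proof.
have wS c : (c < r)%N -> (N.-1 - c < N)%N by lia.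
have iS c d : (c < r)%N -> (d < r)%N -> (N.-1 - c = N.-1 - d)%N -> c = d by lia.
have rS : \rank S = r by rewrite mxrank_tr rank_sel.
have rT : \rank T = r by apply: rank_sel => // c cr; lia.
split; last first.
  have fT : row_free T^T by rewrite /row_free mxrank_tr rT.
  by rewrite /J /corner_nilp (mxrankMfree _ fT) mxrank_tr.
have ST : T^T *m S^T = 0.
  rewrite -trmx_mul; apply: trmx_inj; rewrite trmxK trmx0; apply/matrixP => c d; rewrite [RHS]mxE.
  have dN : (d < N)%N by have := ltn_ord d; lia.
  rewrite (@MT _ _ _ (Ordinal dN) d) // !mxE /= (_ : (_ == _) = false) //.
  by have := ltn_ord c; have := ltn_ord d; lia.
by rewrite /J /corner_nilp -!mulmxA (mulmxA T^T) ST mul0mx mulmx0.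
Qed.

Variable e : 'M[k]_N.
Hypotheses (r0 : (0 < r)%N) (e2 : e *m e = 0) (re : \rank e = r).
Let O := orbit_of (SL N) e.

Lemma corner_orbit : O J.
Proof. by have [J2 rJ] := corner_square_zero; apply/(square_zero_orbit _ N0 e2); rewrite re. Qed.

Lemma orbit_upper_corner y : O y -> (\prod_(i < r.+1) Delta i y) != 0 ->
  exists2 b, upper_SL b & mxconj b y = J.
Proof.
move=> /(square_zero_orbit _ N0 e2)[y2 ry] /prodf_neq0 Dy.
rewrite re in ry; apply: corner_conj => // i ir.
by have := Dy (Ordinal (ir : (i < r.+1)%N)) isT.
Qed.

Lemma polyfun_prod_Delta : polyfun (fun y : 'M[k]_N => \prod_(i < r.+1) Delta i y).
Proof. by apply: (fa_prod (polyfun_funalg k N N)) => i; apply: polyfun_Delta. Qed.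

Lemma prod_Delta_corner : \prod_(i < r.+1) Delta i J != 0.
Proof. by apply/prodf_neq0 => i _; rewrite Delta_corner ?oner_neq0 // -ltnS. Qed.

(** Every point with nonzero minors Delta_0, ..., Delta_r is carried to [J] by the upper triangular
    group. These points are dense by irreducibility, and conjugation by [g] transfers the result to
    any Borel subgroup. *)
Lemma spherical_square_zero : spherical O.
Proof.
move=> _ [g SLg ->]; have ug := SL_unit SLg.
have OJ := corner_orbit.
exists (mxconj g J); first exact: orbit_conj.
split.
  by move=> _ [_ [b [SLb ub] <-] <-]; do !apply: orbit_conj => //; rewrite -?mxconjM;
     rewrite ?unitmx_mul ?unitmx_inv ?ug ?(SL_unit SLb).
have dens : O `<=` zclosure (orbit_of (@upper_SL k N) J).
  move=> x Ox; apply/zclosureP => f Pf fA; apply/eqP; apply: contraT => fx.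
  have [||y [Oy fy Dy]] := orbit_irreducible N0 Pf polyfun_prod_Delta (e := e).
  - by exists x.
  - by exists J => //; exact: prod_Delta_corner.
  have [b Ub bE] := orbit_upper_corner Oy Dy; move: fy; rewrite fA ?eqxx //.
  exists (invmx b); first exact: upper_SL_inv.
  by rewrite -bE mxconjK //; case: Ub => /SL_unit.
move=> x Ox; have Oy : O (mxconj (invmx g) x) by apply: orbit_conj; rewrite ?unitmx_inv.
rewrite -(mxconjVK x ug).
apply: (zclosure_map (A := orbit_of (@upper_SL k N) J)) (dens _ Oy).
  by apply: mxfun_mxconj; [exact: polyfun_funalg|exact: mxfun_id].
move=> _ [b Ub <-]; apply: sub_zclosure; exists (mxconj g b); first by exists b.
have ub : b \in unitmx by case: Ub => /SL_unit.
have ugb : mxconj g b \in unitmx by rewrite /mxconj !unitmx_mul unitmx_inv ug ub.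
by apply: mxconj_eq => //; rewrite -!mxconj_mul // /mxconj mulmxKV.
Qed.

Lemma corner_weight i : (i < r)%N ->
  is_weight (@upper_SL k N) O (fun b => dg b i / dg b (N.-1 - i)).
Proof.
move=> ir; have OJ := corner_orbit.
have lN : (N.-1 - i < N)%N by lia.
apply: (weight_ratio lN (Delta_semi k (i := i.+1) _) (Delta_semi k (i := i) _)); try lia.
- by exists J; rewrite // Delta_corner ?oner_neq0.
- by exists J; rewrite // Delta_corner ?oner_neq0 // ltnW.
by move=> b Ub; rewrite !big_ord_recr /=; ring.
Qed.

(** The entries of [J] join l to N - 1 - l, so a symmetric diagonal matrix commutes with [J].
    Conjugating it by an upper triangular matrix preserves its diagonal. *)
Lemma corner_torus (t : nat -> k) y : (forall l, (l < r)%N -> t l = t (N.-1 - l)%N) ->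
  \prod_(l < N) t l = 1 -> O y -> \prod_(i < r.+1) Delta i y != 0 ->
  exists b, [/\ upper_SL b, forall i : 'I_N, b i i = t i & b *m y = y *m b].
Proof.
move=> tt t1 Oy Dy; have [b0 Ub0 b0E] := orbit_upper_corner Oy Dy.
have [SLb0 ub0] := Ub0; have uu0 := SL_unit SLb0.
have Ut := @tor_SL k N t t1; have [_ ut] := Ut.
have tJ : tor N t *m J = J *m tor N t.
  rewrite corner_nilpE; apply/matrixP => i l; rewrite mul_diag_mx mul_mx_diag !mxE mulrC.
  case: andP => [[/eqP il lr]|_]; last by rewrite !mul0r.
  by rewrite !mul1r [in RHS]tt // -il.
exists (mxconj (invmx b0) (tor N t)); split.
- rewrite /mxconj invmxK; apply: upper_SL_mul => //; apply: upper_SL_mul => //.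
  exact: upper_SL_inv.
- have ui := upper_inv ub0 uu0.
  move=> i; rewrite /mxconj invmxK !upper_mul_diag //; last exact: upper_mul.
  by rewrite upper_inv_diag // torE eqxx mulrAC mulVf ?mul1r // upper_unit_diag.
- have -> : y = mxconj (invmx b0) J by rewrite -b0E mxconjK.
  by rewrite -!mxconj_mul ?unitmx_inv // tJ.
Qed.

Lemma prod_paired (x : nat -> k) (M : nat -> int) : (forall l, x l != 0) ->
  (forall l, (r <= l < N - r)%N -> M l = 0) ->
  (forall l, (l < r)%N -> M (N.-1 - l)%N = - M l) ->
  \prod_(0 <= l < N) x l ^ M l = \prod_(i < r) (x i / x (N.-1 - i)%N) ^ M i.
Proof.
move=> x0 M0 MM; rewrite (@big_cat_nat _ _ _ r) //=; last by lia.
rewrite (@big_cat_nat _ _ _ (N - r) r) //=; try lia.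
rewrite [X in _ * (X * _)]big_nat [X in _ * (X * _)]big1 ?mul1r; last by move=> l /M0 ->; rewrite expr0z.
have rev (G : nat -> k) : \prod_(N - r <= i < N) G i = \prod_(i < r) G (N.-1 - i)%N.
  rewrite -{1}[(N - r)%N]add0n big_addn (_ : N - (N - r) = r)%N; last by lia.
  rewrite big_nat_rev /= big_mkord; apply: eq_bigr => i _; have ir := ltn_ord i.
  by congr G; lia.
rewrite rev big_mkord -big_split /=; apply: eq_bigr => i _.
by rewrite MM // expfzMl exprz_inv.
Qed.

Hypothesis char0 : [pchar k] =i pred0.

(** The exponents [m] of a weight are orthogonal to all symmetric tau of sum zero. So they have a
    constant value c in the middle and m_i + m_(N-1-i) = 2c; after subtracting c they are
    antisymmetric, and the weight is a product of the ratios b_i / b_(N-1-i). *)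
Lemma weight_rank_square_zero : weight_group_rank (@upper_SL k N) O r.
Proof.
exists (fun i b => dg b i / dg b (N.-1 - i)); split.
- by move=> i; apply: corner_weight.
- move=> m H i; have ir := ltn_ord i.
  suff : m i + m i = 0 by lia.
  apply: (@expz_eq1 k) => s s0.
  pose tau (l : nat) : int := (l == i)%:R - (l == (N.-1 - i)%N)%:R.
  have tau0 : \sum_(0 <= l < N) tau l = 0.
    have D a : (a < N)%N -> \sum_(0 <= l < N) (l == a)%:R = 1 :> int.
      by move=> aN; have := sum_delta_int (fun=> 1) aN; under eq_bigr do rewrite mulr1.
    by rewrite sumrB !D ?subrr //; lia.
  have Ut := @tor_SL k N (fun l => s ^ tau l) (tor_pow_SL s0 tau0).
  have := H _ Ut; rewrite (bigD1 i) //= big1 ?mulr1 => [|j ji]; last first.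
    have jr := ltn_ord j; rewrite !dg_tor; try lia.
    have ij : (j == i :> nat) = false by apply/negbTE.
    rewrite /tau ij; have -> : (j == N.-1 - i :> nat)%N = false by lia.
    have -> : (N.-1 - j == i :> nat)%N = false by lia.
    have -> : (N.-1 - j == N.-1 - i :> nat)%N = false.
      by apply/negbTE/eqP => E; move/eqP: ij; apply; lia.
    by rewrite subrr expr0z divr1 exp1rz.
  rewrite !dg_tor; try lia.
  rewrite /tau !eqxx; have -> : (i == N.-1 - i :> nat)%N = false by lia.
  have -> : (N.-1 - i == i :> nat)%N = false by lia.
  rewrite subr0 sub0r -invr_expz invrK -expfzDr // => <-.
  by rewrite exprz_exp mulrDl mul1r.
move=> w Ww.
have [|m [wE mt]] := weight_stabiliser N0 polyfun_prod_Delta _ Ww.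
  by exists J; [exact: corner_orbit|exact: prod_Delta_corner].
have test (t : nat -> k) : (forall l, (l < r)%N -> t l = t (N.-1 - l)%N) ->
    \prod_(l < N) t l = 1 -> \prod_(0 <= l < N) t l ^ m l = 1.
  by move=> tt t1; apply: mt => y Oy Dy; apply: corner_torus.
have lin (tau : nat -> int) : (forall l, (l < r)%N -> tau l = tau (N.-1 - l)%N) ->
    \sum_(0 <= l < N) tau l = 0 -> \sum_(0 <= l < N) tau l * m l = 0.
  move=> ta t0; apply: (@expz_eq1 k) => s s0; rewrite -expfz_sum //.
  rewrite -[RHS](test (fun l => s ^ tau l)); first by apply: eq_bigr => l _; rewrite exprz_exp.
    by move=> l lr; rewrite ta.
  exact: tor_pow_SL.
pose tau4 (a b c d l : nat) : int := (l == a)%:R + (l == b)%:R - (l == c)%:R - (l == d)%:R.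
have D4 a b c d (G : nat -> int) : (a < N)%N -> (b < N)%N -> (c < N)%N -> (d < N)%N ->
    \sum_(0 <= l < N) tau4 a b c d l * G l = G a + G b - G c - G d.
  move=> aN bN cN dN; under eq_bigr do rewrite !mulrBl mulrDl.
  by rewrite !sumrB big_split /= !sum_delta_int.
have test4 a b c d : (a < N)%N -> (b < N)%N -> (c < N)%N -> (d < N)%N ->
    (forall l, (l < r)%N -> tau4 a b c d l = tau4 a b c d (N.-1 - l)%N) ->
    m a + m b = m c + m d.
  move=> aN bN cN dN H; apply/eqP; rewrite -subr_eq0 opprD addrA -D4 // lin //.
  have := D4 a b c d (fun=> 1) aN bN cN dN; under eq_bigr do rewrite mulr1.
  by move=> ->.
have swap i l : (i < r)%N -> (l < r)%N ->
    ((N.-1 - l == i)%N = (l == N.-1 - i)%N) * ((N.-1 - l == N.-1 - i)%N = (l == i)).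
  by move=> ir lr; split; lia.
have mid p l : (r <= p < N - r)%N -> (l < r)%N ->
    ((l == p) = false) * ((N.-1 - l == p)%N = false).
  by move=> pm lr; split; lia.
have [c [cmid cpair]] : exists c : int, (forall l, (r <= l < N - r)%N -> m l = c) /\
    forall i, (i < r)%N -> m i + m (N.-1 - i)%N = c + c.
  have [Nr|Nr] := ltnP (2 * r) N.
    have rm : (r <= r < N - r)%N by lia.
    exists (m r); split=> [l lm|i ir].
      have : m l + m r = m r + m r.
        apply: test4 => [||||l' lr]; try lia.
        by rewrite /tau4 !(mid l l' lm lr) !(mid r l' rm lr).
      by lia.
    apply: test4 => [||||l lr]; try lia.
    rewrite /tau4 !(swap i l ir lr) !(mid r l rm lr); ring.
  (* For N = 2r there is no middle index to supply c. That the common value m_i + m_(N-1-i) is even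
     is seen on the stabilising element with -1 at 0 and N - 1, since one-parameter subgroups do not
     detect it. *)
  have [a aE] : exists a, m 0%N + m N.-1 = a + a.
    have N10 : (-1 : k) != 0 by rewrite oppr_eq0 oner_eq0.
    pose tau (l : nat) : int := (l == 0%N)%:R + (l == N.-1)%:R.
    have D (G : nat -> int) : \sum_(0 <= l < N) tau l * G l = G 0%N + G N.-1.
      under eq_bigr do rewrite mulrDl.
      by rewrite big_split /= !sum_delta_int //; lia.
    apply: (sign_eq1 char0); rewrite -D -expfz_sum // -[RHS](test (fun l => (-1) ^ tau l)).
    - by apply: eq_bigr => l _; rewrite exprz_exp.
    - move=> l lr; have := swap 0%N l r0 lr; rewrite subn0 /tau => -[-> ->].
      by rewrite addrC.
    - rewrite -(big_mkord xpredT (fun l => (-1) ^ tau l)) expfz_sum //.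
      by have := D (fun=> 1); under eq_bigr do rewrite mulr1; move=> ->; rewrite -[LHS]/((-1) ^+ 2) sqrrN expr1n.
  exists a; split=> [l|i ir]; first by lia.
  rewrite -aE; apply: test4 => [||||l lr]; try lia.
  have := swap 0%N l r0 lr; rewrite subn0 => -[s1 s2].
  by rewrite /tau4 !(swap i l ir lr) s1 s2; ring.
exists (fun i => m i - c) => b Ub; rewrite wE //.
have E : \prod_(0 <= l < N) dg b l ^ (- c) = 1.
  rewrite -(big_morph (fun x => x ^ (- c)) (id1 := 1) (op1 := *%R) (id2 := 1) (op2 := *%R)).
  + by rewrite big_mkord dg_prod // exp1rz.
  + by move=> x y; rewrite expfzMl.
  + exact: exp1rz.
rewrite -(@prod_paired (dg b) (fun l => m l - c)) => [|l|l lm|l lr].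
- by rewrite -[LHS]mulr1 -[X in _ * X]E -big_split /=; apply: eq_bigr => l _; rewrite expfzDr // dg_neq0.
- exact: dg_neq0.
- by rewrite cmid ?subrr.
- by have := cpair l lr; lia.
Qed.

End Orbit.

End SphericalOrbit.

Theorem theorem5p1 (k : closedFieldType) (char0 : [pchar k] =i pred0)
    (N : nat) (N_ge2 : (2 <= N)%N)
    (e : 'M[k]_N) (e_sl : sl N e) (e_neq0 : e != 0) (e_nilp : nilpotent_mx e)
    (O : set 'M[k]_N) (O_def : O = orbit_of (SL N) e) :
  [/\ (* (i) *)
      (N <= 2 * \rank e)%N -> e ^+ 2 != 0 ->
        [/\ generic_isotropy O (fun s => s = [set 0]),
            variety_rank O (N - 1)
          & CS O = sl N],
      (* (ii) *)
      forall j : nat, \rank e = j -> (2 * j < N)%N -> e ^+ 2 != 0 ->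
        [/\ (2 <= j <= (N - 1) %/ 2)%N,
            generic_isotropy O (iso_gl (N - 2 * j)),
            variety_rank O (2 * j - 1)
          & CS O = Dro N (2 * j)]
    & (* (iii) *)
      forall r : nat, let lam := nseq r 2%N ++ nseq (N - 2 * r) 1%N in
        partition_of N lam -> O = nilp_orbit N lam ->
        [/\ spherical O,
            (1 <= r)%N /\ (2 * r <= N)%N,
            generic_isotropy O (iso_gl_toral (N - 2 * r) (r - 1)),
            variety_rank O r /\ \rank e = r
          & CS O = Dro N (2 * r) `&`
                [set M | forall i, odd i -> (3 <= i <= 2 * r - 1)%N ->
                                   sigma i M = 0] /\
            CS O = Dr N (2 * r) `&`
                [set M | forall i, odd i -> (1 <= i <= 2 * r - 1)%N ->
                                   sigma i M = 0]]].
Proof.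
have N0 : (0 < N)%N := ltnW N_ge2; rewrite {O}O_def.
have sqE : (e ^+ 2 != 0) = (e *m e != 0) by [].
split.
- move=> re; rewrite sqE => e2; split.
  + exact: generic_isotropy_big.
  + by apply: variety_rank_orbit => //; apply: weight_rank_big.
  + exact: CS_big.
- move=> j rj jN; rewrite sqE => e2.
  have j1 : (1 < j)%N by rewrite -rj sq_neq0_rank.
  split; first by lia.
  + by apply: generic_isotropy_small => //; apply: ltnW.
  + by apply: variety_rank_orbit => //; apply: weight_rank_small.
  + by apply: CS_small => //; apply: ltnW.
- move=> r lam part OE; have [rN e2 re] := nilp_orbit_twos_ones N0 part OE.
  have r0 : (0 < r)%N by rewrite -re lt0n mxrank_eq0.
  split=> //.
  + exact: (spherical_square_zero N0 rN).
  + exact: generic_isotropy_twos.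
  + by split=> //; apply: variety_rank_orbit => //; apply: (weight_rank_square_zero N0 rN).
  + exact: CS_twos.
Qed.
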